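(* $\mathbb{H}P^2$ is $\mathcal{G}^4$-stable, i.e. $\mathcal{G}^4_\tau(\mathbb{H}P^2)\simeq\mathcal{G}^4_\omega(\mathbb{H}P^2)$ (homotopy equivalence) for all twistings $\tau,\omega\in\pi_3(\mathrm{SO}(8))$.
   Context: Gyrations: let $M$ be a closed simply-connected $n$-manifold, regarded as a complex with a single $n$-cell; $\overline{M}$ is its $(n-1)$-skeleton and $f_M:S^{n-1}\to\overline{M}$ is the attaching map of the top cell. Let $k\geq 2$ and let $\tau:S^{k-1}\to\mathrm{SO}(n)$ represent a class in $\pi_{k-1}(\mathrm{SO}(n))$ (a ''twisting''). Using the standard action of $\mathrm{SO}(n)$ on $S^{n-1}$ define $t:S^{n-1}\times S^{k-1}\to S^{n-1}\times S^{k-1}$ by $t(a,x)=(\tau(x)\cdot a,x)$. The $k$-gyration $\mathcal{G}^k_\tau(M)$ is the strict pushout of $1\times\iota:S^{n-1}\times S^{k-1}\to S^{n-1}\times D^k$ ($\iota$ the inclusion of the boundary of the disc) and $(f_M\times 1)\circ t:S^{n-1}\times S^{k-1}\to\overline{M}\times S^{k-1}$. Equivalently, $\mathcal{G}^k_\tau(M)=\big((M-\mathrm{Int}(D^n))\times S^{k-1}\big)\cup_t\big(S^{n-1}\times D^k\big)$ for an embedded disc $D^n\subset M$. Its homotopy type depends only on the homotopy class of $\tau$. $M$ is called $\mathcal{G}^k$-stable if $\mathcal{G}^k_\tau(M)\simeq\mathcal{G}^k_\omega(M)$ for all $\tau,\omega\in\pi_{k-1}(\mathrm{SO}(n))$.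 The quaternionic projective plane $\mathbb{H}P^2$ has dimension $n=8$. *)

(* Defs.v *)
From HB Require Import structures.
From Stdlib Require Import Relations.
From mathcomp Require Import all_boot all_order all_algebra generic_quotient.
From mathcomp Require Import all_classical all_reals all_analysis.
From mathcomp Require Import ring lra.

Set Implicit Arguments.
Unset Strict Implicit.
Unset Printing Implicit Defensive.

Import Order.TTheory GRing.Theory Num.Theory.
Import numFieldNormedType.Exports.

Local Open Scope classical_set_scope.
Local Open Scope ring_scope.
Local Open Scope quotient_scope.

Section homotopy.
Variable R : realType.

Definition homotopic (X Y : topologicalType) (f g : X -> Y) :=
  exists H : X * R -> Y,
    [/\ {within [set: X] `*` `[0, 1], continuous H},
        forall x, H (x, 0) = f x & forall x, H (x, 1) = g x].

Definition homotopy_equivalent (X Y : topologicalType) :=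
  exists (f : X -> Y) (g : Y -> X),
    [/\ continuous f, continuous g,
        homotopic (g \o f) idfun & homotopic (f \o g) idfun].

End homotopy.

Section pushout.
Variables (A B C : topologicalType) (f : A -> B) (g : A -> C).

Definition pushout_summand (b : bool) : topologicalType := if b then B else C.

Definition pushout_sum : topologicalType := {b : bool & pushout_summand b}.

Definition pushout_inl (b : B) : pushout_sum := existT pushout_summand true b.
Definition pushout_inr (c : C) : pushout_sum := existT pushout_summand false c.

Definition pushout_step (u v : pushout_sum) :=
  exists a, u = pushout_inl (f a) /\ v = pushout_inr (g a).

Definition pushout_rel (u v : pushout_sum) : bool :=
  `[< clos_refl_sym_trans _ pushout_step u v >].

Let pushout_refl : reflexive pushout_rel.
Proof. by move=> u; apply/asboolP; exact: rst_refl. Qed.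

Let pushout_sym : symmetric pushout_rel.
Proof.
by move=> u v; apply/idP/idP => /asboolP uv; apply/asboolP; exact: rst_sym.
Qed.

Let pushout_trans : transitive pushout_rel.
Proof.
by move=> v u w /asboolP uv /asboolP vw; apply/asboolP; exact: rst_trans vw.
Qed.

Definition pushout_equiv :=
  EquivRel pushout_rel pushout_refl pushout_sym pushout_trans.

Definition pushout : topologicalType :=
  quotient_topology {eq_quot pushout_equiv}.

End pushout.

Section spheres.
Variable R : realType.

Definition sqnorm n (v : 'rV[R]_n) : R := \sum_i v 0 i ^+ 2.

(* the unit sphere of R^n, of dimension n - 1 *)
Definition usphere n : set 'rV[R]_n := [set v | sqnorm v = 1].
Definition udisc n : set 'rV[R]_n := [set v | sqnorm v <= 1].
Arguments usphere : clear implicits.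
Arguments udisc : clear implicits.

Lemma usphere_udisc n : usphere n `<=` udisc n.
Proof. by move=> v; rewrite /usphere /udisc /= => ->. Qed.

Definition SO n : set 'M[R]_n := [set A | A *m A^T = 1%:M /\ \det A = 1].
Arguments SO : clear implicits.

Lemma sqnormE n (v : 'rV[R]_n) : sqnorm v = (v *m v^T) 0 0.
Proof. by rewrite mxE; apply: eq_bigr => i _; rewrite mxE expr2. Qed.

Lemma SO_usphere n (A : SO n) (a : usphere n) :
  val a *m (val A)^T \in usphere n.
Proof.
apply/mem_set; rewrite /usphere /= sqnormE trmx_mul trmxK mulmxA.
rewrite -(mulmxA (val a)).
have [AAT _] := set_valP A.
by rewrite (mulmx1C AAT) mulmx1 -sqnormE; exact: set_valP a.
Qed.

(* vectors are rows, so the column vector A a is written a *m A^T *)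
Definition SO_act n (A : SO n) (a : usphere n) : usphere n :=
  SigSub (SO_usphere A a).

End spheres.
Arguments usphere : clear implicits.
Arguments udisc : clear implicits.
Arguments SO : clear implicits.

Section top_cell.
Variable R : realType.

(* A decomposition of M as the union of a subspace and of a single n-cell,
   i.e. a homeomorphism from skel \cup_f D^n to M, f being the restriction of
   char_map to the boundary sphere. *)
Record top_cell (n : nat) (M : topologicalType) := TopCell {
  skel : set M ;
  char_map : udisc R n -> M ;
  char_map_continuous : continuous char_map ;
  char_map_boundary : forall v, usphere R n (val v) -> skel (char_map v) ;
  char_map_inj : forall v w, sqnorm (val v) < 1 -> sqnorm (val w) < 1 ->
    char_map v = char_map w -> v = w ;
  char_map_interior :
    [set char_map v | v in [set v | sqnorm (val v) < 1]] = ~` skel ;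
  top_cell_open : forall U : set M, open (char_map @^-1` U) ->
    open ((val : skel -> M) @^-1` U) -> open U }.

Variables (n : nat) (M : topologicalType) (c : top_cell n M).

Lemma attach_subproof (a : usphere R n) :
  char_map c (subfun (@usphere_udisc R n) a) \in skel c.
Proof. by apply/mem_set/char_map_boundary; exact: set_valP a. Qed.

Definition attach (a : usphere R n) : skel c := SigSub (attach_subproof a).

End top_cell.

Section gyration.
Variables (R : realType).

(* based maps from S^(k-1), with base point (1, 0, ..., 0), to SO(n) *)
Record twisting (n k : nat) := Twisting {
  twist :> usphere R k -> SO R n ;
  twist_continuous : continuous twist ;
  twist_based : forall x, val x = \row_i (i == 0 :> nat)%:R ->
    val (twist x) = 1%:M }.

Variables (n k : nat) (M : topologicalType) (c : top_cell R n M).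

Definition twist_map (tau : twisting n k) (p : usphere R n * usphere R k) :
  usphere R n * usphere R k := (SO_act (tau p.2) p.1, p.2).

Definition gyration (tau : twisting n k) : topologicalType :=
  pushout
    (fun p : usphere R n * usphere R k =>
       (p.1, subfun (@usphere_udisc R k) p.2) : usphere R n * udisc R k)
    ((fun p : usphere R n * usphere R k =>
       (attach c p.1, p.2) : skel c * usphere R k) \o twist_map tau).

End gyration.

Definition gyration_stable (R : realType) (n k : nat) (M : topologicalType)
    (c : top_cell R n M) :=
  forall tau omega : twisting R n k,
    homotopy_equivalent R (gyration c tau) (gyration c omega).

Section quaternions.
Variable R : realType.

(* (a, b, c, d) stands for a + b i + c j + d k *)
Definition qmul (p q : 'rV[R]_4) : 'rV[R]_4 :=
  let: (a, b, c, d) := (p 0 0, p 0 1, p 0 2, p 0 3) in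
  let: (a', b', c', d') := (q 0 0, q 0 1, q 0 2, q 0 3) in
  \row_i [:: a * a' - b * b' - c * c' - d * d';
             a * b' + b * a' + c * d' - d * c';
             a * c' - b * d' + c * a' + d * b';
             a * d' + b * c' - c * b' + d * a']`_i.

Definition qreal (s : R) : 'rV[R]_4 := \row_i [:: s; 0; 0; 0]`_i.

Definition qconj (q : 'rV[R]_4) : 'rV[R]_4 :=
  \row_i [:: q 0 0; - q 0 1; - q 0 2; - q 0 3]`_i.

Lemma sum4 (F : 'I_4 -> R) : \sum_i F i = F 0 + F 1 + F 2 + F 3.
Proof.
rewrite !big_ord_recl big_ord0 addr0 !addrA.
by congr (F _ + F _ + F _ + F _); apply/val_inj.
Qed.

Lemma ord4P (P : 'I_4 -> Prop) : P 0 -> P 1 -> P 2 -> P 3 -> forall i, P i.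
Proof.
move=> P0 P1 P2 P3 [[|[|[|[|//]]]] lt_i].
- by rewrite (_ : Ordinal _ = 0) //; apply/val_inj.
- by rewrite (_ : Ordinal _ = 1) //; apply/val_inj.
- by rewrite (_ : Ordinal _ = 2) //; apply/val_inj.
- by rewrite (_ : Ordinal _ = 3) //; apply/val_inj.
Qed.

Lemma qmulA : associative qmul.
Proof.
by move=> p q r; apply/rowP; apply: ord4P; rewrite !mxE /= ?mxE /=; ring.
Qed.

Lemma qmulqV q : qmul q (qconj q) = qreal (sqnorm q).
Proof.
by apply/rowP; apply: ord4P; rewrite !mxE /= ?mxE /= /sqnorm ?sum4; ring.
Qed.

Lemma qmulVq q : qmul (qconj q) q = qreal (sqnorm q).
Proof.
by apply/rowP; apply: ord4P; rewrite !mxE /= ?mxE /= /sqnorm ?sum4; ring.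
Qed.

Lemma qmulqr q s : qmul q (qreal s) = s *: q.
Proof. by apply/rowP; apply: ord4P; rewrite !mxE /= ?mxE /=; ring. Qed.

Lemma qmulrq q s : qmul (qreal s) q = s *: q.
Proof. by apply/rowP; apply: ord4P; rewrite !mxE /= ?mxE /=; ring. Qed.

Lemma qmulZr s p q : qmul p (s *: q) = s *: qmul p q.
Proof. by apply/rowP; apply: ord4P; rewrite !mxE /= ?mxE /=; ring. Qed.

Lemma sqnorm_qmul p q : sqnorm (qmul p q) = sqnorm p * sqnorm q.
Proof. by rewrite /sqnorm !sum4 !mxE /= ?mxE /=; ring. Qed.

Lemma sqnorm_qconj q : sqnorm (qconj q) = sqnorm q.
Proof. by rewrite /sqnorm !sum4 !mxE /= ?mxE /=; ring. Qed.

Lemma sqnorm_qreal s : sqnorm (qreal s) = s ^+ 2.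
Proof. by rewrite /sqnorm !sum4 !mxE /=; ring. Qed.
End quaternions.

Section topology_lemmas.
Variable R : realType.

Lemma mx_continuous (X : topologicalType) m n (f : X -> 'M[R]_(m, n)) :
  (forall i j, continuous (fun x => f x i j)) -> continuous f.
Proof.
move=> fc x U [P fxP PU].
apply: (@filterS _ _ _ (f @^-1` [set A | forall i j, P i j (A i j)])).
  by move=> y; exact: PU.
apply: filter_forall => i; apply: filter_forall => j.
exact: (fc i j x (P i j) (fxP i j)).
Qed.

Section real_functions.
Variable X : topologicalType.
Implicit Types f g : X -> R.

Lemma eq_continuous f g : f =1 g -> continuous f -> continuous g.
Proof. by move=> /funext ->. Qed.

Lemma addr_continuous f g :
  continuous f -> continuous g -> continuous (fun x => f x + g x).
Proof. by move=> cf cg x; exact: continuousD (cf x) (cg x). Qed.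

Lemma subr_continuous f g :
  continuous f -> continuous g -> continuous (fun x => f x - g x).
Proof. by move=> cf cg x; exact: continuousB (cf x) (cg x). Qed.

Lemma mulr_continuous f g :
  continuous f -> continuous g -> continuous (fun x => f x * g x).
Proof. by move=> cf cg x; exact: continuousM (cf x) (cg x). Qed.

Lemma entry_continuous m n (f : X -> 'M[R]_(m, n)) i j :
  continuous f -> continuous (fun x => f x i j).
Proof.
move=> cf x; apply: (@continuous_comp _ _ _ f (fun M : 'M[R]_(m, n) => M i j)).
  exact: cf.
exact: coord_continuous.
Qed.

End real_functions.

Lemma sqnorm_continuous n : continuous (@sqnorm R n).
Proof.
apply: continuous_big => [|i _]; first exact: add_continuous.
apply: (@eq_continuous _ (fun v : 'rV[R]_n => v 0 i * v 0 i)) => [v|].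
  by rewrite expr2.
by apply: mulr_continuous; exact: coord_continuous.
Qed.

Lemma set_val_continuous (X : topologicalType) (A : set X) :
  continuous (val : A -> X).
Proof. exact: initial_continuous. Qed.

Lemma to_set_continuous (X Y : topologicalType) (A : set X) (f : Y -> A) :
  continuous (val \o f) -> continuous f.
Proof. exact: continuous_comp_initial. Qed.

Lemma closed_val_image (X : topologicalType) (A : set X) (B : set A) :
  closed A -> closed B -> closed [set val b | b in B].
Proof.
move=> Acl; rewrite -openC => -[W Wo WB].
have -> : [set val b | b in B] = A `&` ~` W.
  apply/seteqP; split=> [_ [b Bb <-]|x [Ax nWx]].
    split; first exact: set_valP b.
    by move=> Wb; have : (~` B) b by rewrite -WB; exact: Wb.
  exists (SigSub (mem_set Ax)) => //; apply: contrapT.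
  by move=> nB; apply: nWx; have : (~` B) (SigSub (mem_set Ax)) by []; rewrite -WB.
by apply: closedI => //; exact: open_closedC.
Qed.

Lemma udisc_closed n : closed (udisc R n).
Proof.
apply: (@closed_comp _ _ (@sqnorm R n) [set x | x <= 1]) => [v _|].
  exact: sqnorm_continuous.
exact: closed_le.
Qed.

Lemma usphere_closed n : closed (usphere R n).
Proof.
apply: (@closed_comp _ _ (@sqnorm R n) [set x | x = 1]) => [v _|].
  exact: sqnorm_continuous.
exact: closed_eq.
Qed.

Lemma udisc_compact n (A : set 'rV[R]_n) :
  A `<=` udisc R n -> closed A -> compact A.
Proof.
move=> A1; apply: bounded_closed_compact; exists 1; split => // M M1 v /A1 v1.
apply: (le_trans _ (ltW M1)); rewrite /Num.norm/= mx_normrE.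
apply: bigmax_le => //= -[i j] _ /=; rewrite (ord1 i).
rewrite -(@ler_pXn2r _ 2) ?nnegrE // expr1n real_normK ?num_real//.
apply: le_trans v1; rewrite /sqnorm (bigD1 j) //= lerDl sumr_ge0 // => k _.
exact: sqr_ge0.
Qed.

End topology_lemmas.

Section projective_space.
Variable R : realType.

(* R^(4m) is identified with H^m through vec_mx, one quaternion per row, and
   the quaternions act on the right. *)
Definition qscale m (x : 'rV[R]_(m * 4)) (q : 'rV[R]_4) : 'rV[R]_(m * 4) :=
  mxvec (\matrix_i qmul (row i (vec_mx x)) q).

Lemma row_qscale m (x : 'rV[R]_(m * 4)) q i :
  row i (vec_mx (qscale x q)) = qmul (row i (vec_mx x)) q.
Proof. by rewrite mxvecK rowK. Qed.

Lemma rows_inj m (x y : 'rV[R]_(m * 4)) :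
  (forall i, row i (vec_mx x) = row i (vec_mx y)) -> x = y.
Proof. by move=> /row_matrixP/(can_inj vec_mxK). Qed.

Lemma sqnorm_rows m (x : 'rV[R]_(m * 4)) :
  sqnorm x = \sum_i sqnorm (row i (vec_mx x)).
Proof.
rewrite /sqnorm (reindex _ (curry_mxvec_bij m 4)) /=.
under [RHS]eq_bigr => i _ do under eq_bigr => j _ do rewrite !mxE.
rewrite [RHS](pair_bigA _ (fun i j => x 0 (mxvec_index i j) ^+ 2)) /=.
by apply: eq_bigr => -[i j] _.
Qed.

Lemma sqnorm_qscale m (x : 'rV[R]_(m * 4)) q :
  sqnorm (qscale x q) = sqnorm x * sqnorm q.
Proof.
rewrite !sqnorm_rows mulr_suml; apply: eq_bigr => i _.
by rewrite row_qscale sqnorm_qmul.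
Qed.

Lemma qscaleA m (x : 'rV[R]_(m * 4)) p q :
  qscale (qscale x p) q = qscale x (qmul p q).
Proof. by apply: rows_inj => i; rewrite !row_qscale qmulA. Qed.

Lemma qscale1 m (x : 'rV[R]_(m * 4)) : qscale x (qreal 1) = x.
Proof. by apply: rows_inj => i; rewrite row_qscale qmulqr scale1r. Qed.

Definition qline m (x y : usphere R (m * 4)) : bool :=
  `[< exists2 q, sqnorm q = 1 & val y = qscale (val x) q >].

Let qline_refl m : reflexive (@qline m).
Proof.
move=> x; apply/asboolP; exists (qreal 1); last by rewrite qscale1.
by rewrite sqnorm_qreal expr1n.
Qed.

Let qline_sym m : symmetric (@qline m).
Proof.
suff sub x y : @qline m x y -> qline y x by move=> x y; apply/idP/idP; exact: sub.
move=> /asboolP[q q1 yE]; apply/asboolP; exists (qconj q).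
  by rewrite sqnorm_qconj.
by rewrite yE qscaleA qmulqV q1 qscale1.
Qed.

Let qline_trans m : transitive (@qline m).
Proof.
move=> y x z /asboolP[p p1 yE] /asboolP[q q1 zE]; apply/asboolP.
exists (qmul p q); last by rewrite zE yE qscaleA.
by rewrite sqnorm_qmul p1 q1 mulr1.
Qed.

Definition qline_equiv m :=
  EquivRel (@qline m) (@qline_refl m) (@qline_sym m) (@qline_trans m).

Definition HP n : topologicalType :=
  quotient_topology {eq_quot (qline_equiv (n + 1))}.

Definition HP_pi n : usphere R ((n + 1) * 4) -> HP n :=
  \pi_(quotient_topology {eq_quot (qline_equiv (n + 1))}).

Lemma HP_piP n (x y : usphere R ((n + 1) * 4)) :
  HP_pi x = HP_pi y <->
  exists2 q, sqnorm q = 1 & val y = qscale (val x) q.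
Proof.
have E := @eqmodP _ (qline_equiv (n + 1)) x y.
by split=> [/E/asboolP//|xy]; apply/E/asboolP.
Qed.

Lemma HP_pi_surj n (p : HP n) : exists x, HP_pi x = p.
Proof. by exists (repr p); exact: reprK. Qed.

Lemma HP_pi_continuous n : continuous (@HP_pi n).
Proof. exact: pi_continuous. Qed.

Variable n : nat.

(* HP^(n-1), the points [x_0 : ... : x_n] with x_n = 0 *)
Definition HP_skel : set (HP n) :=
  [set HP_pi x | x in
    [set x : usphere R ((n + 1) * 4) | dsubmx (vec_mx (val x)) = 0]].

(* the point (v, sqrt (1 - |v|^2)) of the unit sphere of H^n x H *)
Definition HP_lift (v : 'rV[R]_(n * 4)) : 'rV[R]_((n + 1) * 4) :=
  mxvec (col_mx (vec_mx v) (qreal (Num.sqrt (1 - sqnorm v)))).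

Lemma sqnorm_col_mx (A : 'M[R]_(n, 4)) (q : 'rV[R]_4) :
  sqnorm (mxvec (col_mx A q)) = sqnorm (mxvec A) + sqnorm q.
Proof.
rewrite !sqnorm_rows !mxvecK big_split_ord /= big_ord1 rowKd row_id.
by congr (_ + _); apply: eq_bigr => i _; rewrite rowKu.
Qed.

Lemma HP_lift_subproof (v : udisc R (n * 4)) :
  HP_lift (val v) \in usphere R ((n + 1) * 4).
Proof.
apply/mem_set; rewrite /usphere /= sqnorm_col_mx vec_mxK sqnorm_qreal.
by rewrite sqr_sqrtr ?subr_ge0 ?subrKC//; exact: (set_valP v).
Qed.

Definition HP_char (v : udisc R (n * 4)) : HP n :=
  HP_pi (SigSub (HP_lift_subproof v)).

Lemma HP_liftd v : dsubmx (vec_mx (HP_lift v)) = qreal (Num.sqrt (1 - sqnorm v)).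
Proof. by rewrite /HP_lift mxvecK col_mxKd. Qed.

Lemma HP_liftu v : mxvec (usubmx (vec_mx (HP_lift v))) = v.
Proof. by rewrite /HP_lift mxvecK col_mxKu vec_mxK. Qed.

Lemma dsubmx_qscale (x : 'rV[R]_((n + 1) * 4)) q :
  dsubmx (vec_mx (qscale x q)) = qmul (dsubmx (vec_mx x)) q.
Proof.
by rewrite -[LHS](row_id 0) row_dsubmx row_qscale -row_dsubmx row_id.
Qed.

Lemma HP_skelP x : HP_skel (HP_pi x) <-> dsubmx (vec_mx (val x)) = 0.
Proof.
split=> [[y y0 /HP_piP[q _ ->]]|]; last by exists x.
by rewrite dsubmx_qscale y0; apply/rowP; apply: ord4P; rewrite !mxE /=; ring.
Qed.

Lemma qreal_eq0 (s : R) : qreal s = 0 -> s = 0.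
Proof. by move/rowP/(_ 0); rewrite !mxE. Qed.

Lemma HP_char_boundary v : usphere R (n * 4) (val v) -> HP_skel (HP_char v).
Proof.
move=> v1; apply/HP_skelP; rewrite HP_liftd v1 subrr sqrtr0.
by apply/rowP; apply: ord4P; rewrite !mxE.
Qed.

Lemma HP_char_interior :
  [set HP_char v | v in [set v | sqnorm (val v) < 1]] = ~` HP_skel.
Proof.
apply/seteqP; split=> [_ [v /= v1 <-]|p Sp] /=.
  move=> /HP_skelP; rewrite HP_liftd => /qreal_eq0 /eqP.
  by rewrite sqrtr_eq0 subr_le0 leNgt v1.
have [x px] := HP_pi_surj p; rewrite -px in Sp *.
set d := dsubmx (vec_mx (val x)).
set u := mxvec (usubmx (vec_mx (val x))).
have x1 : sqnorm u + sqnorm d = 1.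
  have := set_valP x; rewrite /usphere /= => <-.
  rewrite /u /d -sqnorm_col_mx vsubmxK vec_mxK.
  by [].
have d0 : 0 < sqnorm d.
  rewrite lt_neqAle sumr_ge0 ?andbT; last by move=> i _; exact: sqr_ge0.
  apply/eqP => /esym/eqP; rewrite psumr_eq0; last by move=> i _; exact: sqr_ge0.
  move=> /allP d0; apply/Sp/HP_skelP/rowP => i; rewrite [RHS]mxE.
  by apply/eqP; rewrite -sqrf_eq0; exact: d0 (mem_index_enum i).
have s0 : Num.sqrt (sqnorm d) != 0 by rewrite sqrtr_eq0 -ltNge.
pose q := (Num.sqrt (sqnorm d))^-1 *: qconj d.
have sqZ m s (w : 'rV[R]_m) : sqnorm (s *: w) = s ^+ 2 * sqnorm w.
  by rewrite /sqnorm mulr_sumr; apply: eq_bigr => i _; rewrite mxE exprMn.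
have q1 : sqnorm q = 1.
  by rewrite sqZ sqnorm_qconj exprVn sqr_sqrtr ?mulVf ?gt_eqF// ltW.
have uq : sqnorm (qscale u q) = sqnorm u by rewrite sqnorm_qscale q1 mulr1.
have uq1 : qscale u q \in udisc R (n * 4).
  by apply/mem_set; rewrite /udisc /= uq; lra.
exists (SigSub uq1); first by rewrite /= uq; lra.
apply/esym/HP_piP; exists q => //=.
rewrite -[RHS]vec_mxK -[vec_mx (qscale _ _)]vsubmxK dsubmx_qscale -/d.
rewrite /HP_lift uq (_ : 1 - sqnorm u = sqnorm d); last lra.
congr (mxvec (col_mx _ _)); last first.
  rewrite qmulZr qmulqV; apply/rowP; apply: ord4P; rewrite !mxE /= ?mulr0 //.
  by rewrite -{3}(sqr_sqrtr (ltW d0)) expr2 mulKf.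
apply/row_matrixP => i.
by rewrite row_qscale /u mxvecK !row_usubmx row_qscale.
Qed.

Lemma HP_char_inj v w : sqnorm (val v) < 1 -> sqnorm (val w) < 1 ->
  HP_char v = HP_char w -> v = w.
Proof.
move=> v1 w1 /HP_piP[q q1 /= wE].
have sq_gt0 (x : udisc R (n * 4)) : sqnorm (val x) < 1 ->
    0 < Num.sqrt (1 - sqnorm (val x)).
  by rewrite sqrtr_gt0 subr_gt0.
have /(congr1 (@sqnorm _ _)) := congr1 (fun x => dsubmx (vec_mx x)) wE.
rewrite dsubmx_qscale !HP_liftd sqnorm_qmul q1 mulr1 !sqnorm_qreal => /eqP.
rewrite eqrXn2 ?ltW ?sq_gt0 // => /eqP sE.
have := congr1 (fun x => dsubmx (vec_mx x)) wE.
rewrite dsubmx_qscale !HP_liftd qmulrq sE => qE.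
have qE1 : q = qreal 1.
  apply: (scalerI (lt0r_neq0 (sq_gt0 _ v1))); rewrite -qE.
  by apply/rowP; apply: ord4P; rewrite !mxE /= ?mulr1 ?mulr0.
apply/val_inj; rewrite -[val v]HP_liftu -[val w]HP_liftu wE qE1.
by rewrite qscale1.
Qed.

Lemma qmul_continuous (X : topologicalType) (f g : X -> 'rV[R]_4) :
  continuous f -> continuous g -> continuous (fun x => qmul (f x) (g x)).
Proof.
move=> cf cg; apply: mx_continuous => i; apply: ord4P.
- apply: (@eq_continuous _ _ (fun x => f x 0 0 * g x 0 0 - f x 0 1 * g x 0 1
    - f x 0 2 * g x 0 2 - f x 0 3 * g x 0 3)) => [x|]; first by rewrite mxE.
  by do !(apply: subr_continuous || apply: addr_continuous ||
    (apply: mulr_continuous; exact: entry_continuous)).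
- apply: (@eq_continuous _ _ (fun x => f x 0 0 * g x 0 1 + f x 0 1 * g x 0 0
    + f x 0 2 * g x 0 3 - f x 0 3 * g x 0 2)) => [x|]; first by rewrite mxE.
  by do !(apply: subr_continuous || apply: addr_continuous ||
    (apply: mulr_continuous; exact: entry_continuous)).
- apply: (@eq_continuous _ _ (fun x => f x 0 0 * g x 0 2 - f x 0 1 * g x 0 3
    + f x 0 2 * g x 0 0 + f x 0 3 * g x 0 1)) => [x|]; first by rewrite mxE.
  by do !(apply: subr_continuous || apply: addr_continuous ||
    (apply: mulr_continuous; exact: entry_continuous)).
- apply: (@eq_continuous _ _ (fun x => f x 0 0 * g x 0 3 + f x 0 1 * g x 0 2
    - f x 0 2 * g x 0 1 + f x 0 3 * g x 0 0)) => [x|]; first by rewrite mxE.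
  by do !(apply: subr_continuous || apply: addr_continuous ||
    (apply: mulr_continuous; exact: entry_continuous)).
Qed.

Lemma qscale_continuous (X : topologicalType) m (f : X -> 'rV[R]_(m * 4))
    (g : X -> 'rV[R]_4) :
  continuous f -> continuous g -> continuous (fun x => qscale (f x) (g x)).
Proof.
move=> cf cg; apply: mx_continuous => i k; rewrite (ord1 i).
case/mxvec_indexP: k => a b.
apply: (@eq_continuous _ _ (fun x => qmul (row a (vec_mx (f x))) (g x) 0 b)) => [x|].
  by rewrite /qscale mxvecE [RHS]mxE.
apply: entry_continuous; apply: qmul_continuous => //.
apply: mx_continuous => c d.
apply: (@eq_continuous _ _ (fun x => f x 0 (mxvec_index a d))) => [x|].
  by rewrite !mxE.
exact: entry_continuous.
Qed.

Lemma HP_lift_continuous : continuous HP_lift.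
Proof.
apply: mx_continuous => i k; rewrite (ord1 i).
case/mxvec_indexP: k => a b; rewrite -(fintype.splitK a); case: (fintype.split a) => a' /=.
  apply: (@eq_continuous _ _ (fun v : 'rV[R]_(n * 4) => v 0 (mxvec_index a' b))).
    by move=> v; rewrite /HP_lift mxvecE col_mxEu mxE.
  exact: coord_continuous.
apply: (@eq_continuous _ _ (fun v => qreal (Num.sqrt (1 - sqnorm v)) a' b)).
  by move=> v; rewrite /HP_lift mxvecE col_mxEd.
apply: (@eq_continuous _ _
  (fun v => [:: Num.sqrt (1 - sqnorm v); 0; 0; 0]`_b)) => [v|].
  by rewrite mxE.
move: b; apply: ord4P => /= v; try exact: cst_continuous.
apply: (@continuous_comp _ _ _ (fun v => 1 - sqnorm v) (@Num.sqrt R)).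
  apply: subr_continuous; first exact: cst_continuous.
  exact: sqnorm_continuous.
exact: sqrt_continuous.
Qed.

Lemma HP_char_continuous : continuous HP_char.
Proof.
move=> v; apply: (@continuous_comp _ _ _
  (fun v => SigSub (HP_lift_subproof v) : usphere R ((n + 1) * 4)) (@HP_pi n));
  last exact: HP_pi_continuous.
move: v; apply: to_set_continuous => v.
apply: (@continuous_comp _ _ _ (val : udisc R (n * 4) -> _) HP_lift).
  exact: set_val_continuous.
exact: HP_lift_continuous.
Qed.

Lemma HP_closed (C : set (HP n)) : closed (HP_char @^-1` C) ->
  closed ((val : HP_skel -> HP n) @^-1` C) -> closed C.
Proof.
move=> DC SC.
pose K := [set val x | x in @HP_pi n @^-1` C].
suff Kcl : closed K.
  suff : closed (@HP_pi n @^-1` C).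
    by rewrite -!openC; exact.
  rewrite (_ : _ @^-1` C = val @^-1` K); last first.
    apply/seteqP; split=> [x Cx|x [y Cy /val_inj <-]]//; by exists x.
  have /continuous_closedP := @set_val_continuous _ (usphere R ((n + 1) * 4)).
  exact.
pose S0 := usphere R ((n + 1) * 4) `&`
  [set x : 'rV[R]_((n + 1) * 4) | dsubmx (vec_mx x) = 0].
have S0cl : closed S0.
  apply: closedI; first exact: usphere_closed.
  have -> : [set x : 'rV[R]_((n + 1) * 4) | dsubmx (vec_mx x) = 0] =
     (fun x => sqnorm (dsubmx (vec_mx x))) @^-1` [set t | t = 0].
    apply/seteqP; split=> x /= => [->|/eqP].
      by rewrite /sqnorm big1 // => i _; rewrite mxE expr0n.
    rewrite psumr_eq0; last by move=> i _; exact: sqr_ge0.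
    move=> /allP x0; apply/rowP => i; rewrite [RHS]mxE.
    by apply/eqP; rewrite -sqrf_eq0; exact: x0 (mem_index_enum i).
  apply: closed_comp; last exact: closed_eq.
  move=> x _; apply: continuous_comp; last exact: sqnorm_continuous.
  move: x; apply: mx_continuous => i j.
  apply: (@eq_continuous _ _ (fun x : 'rV[R]_((n + 1) * 4) =>
    x 0 (mxvec_index (rshift n i) j))) => [x|]; first by rewrite !mxE.
  exact: coord_continuous.
have S0s (x : S0) : val x \in usphere R ((n + 1) * 4).
  by apply/mem_set; have [] := set_valP x.
have S0k (x : S0) : HP_pi (SigSub (S0s x)) \in HP_skel.
  by apply/mem_set/HP_skelP; have [] := set_valP x.
pose h (x : S0) : HP_skel := SigSub (S0k x).
have hc : continuous h.
  apply: to_set_continuous => x.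
  apply: (@continuous_comp _ _ _
    (fun x => SigSub (S0s x) : usphere R ((n + 1) * 4)) (@HP_pi n));
    last exact: HP_pi_continuous.
  move: x; apply: to_set_continuous; exact: set_val_continuous.
pose K2 := [set val x | x in h @^-1` (val @^-1` C)].
have K2cl : closed K2.
  by apply: closed_val_image => //; move/continuous_closedP: hc; exact.
pose D := [set val v | v in HP_char @^-1` C].
have Dcl : closed D by apply: closed_val_image => //; exact: udisc_closed.
pose K1 := [set qscale (HP_lift p.1) p.2 | p in D `*` usphere R 4].
have K1cl : closed K1.
  apply: compact_closed; first exact: norm_hausdorff.
  apply: continuous_compact; last first.
    apply: compact_setX.
      by apply: udisc_compact => // _ [v _ <-]; exact: (set_valP v).
    by apply: udisc_compact; [exact: usphere_udisc|exact: usphere_closed].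
  apply: continuous_subspaceT.
  apply: (@qscale_continuous _ _ (HP_lift \o fst) snd) => p; last exact: cvg_snd.
  apply: (@continuous_comp _ _ _ fst HP_lift); first exact: cvg_fst.
  exact: HP_lift_continuous.
rewrite (_ : K = K1 `|` K2); first exact: closedU.
apply/seteqP; split=> [_ [x Cx <-]|y []].
- have [Sx|Sx] := pselect (HP_skel (HP_pi x)).
    right; move/HP_skelP: Sx => Sx.
    have S0x : val x \in S0 by apply/mem_set; split => //; exact: set_valP x.
    exists (SigSub S0x) => //; rewrite /= /h /=.
    by rewrite (_ : SigSub _ = x) //; exact: val_inj.
  left; move: Sx; rewrite -[~ _]/((~` HP_skel) _) -HP_char_interior.
  move=> [v _ vx]; move/HP_piP: (vx) => [q q1 xE].
  exists (val v, q) => //=; split => //=; exists v => //.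
  by rewrite /= vx.
- move=> [[w q] [[v Cv vw] q1] <-]; rewrite /= in vw q1 *.
  have qv1 : qscale (HP_lift (val v)) q \in usphere R ((n + 1) * 4).
    apply/mem_set; rewrite /usphere /= sqnorm_qscale q1 mulr1.
    exact: set_mem (HP_lift_subproof v).
  exists (SigSub qv1); last by rewrite -vw.
  suff E : HP_pi (SigSub qv1) = HP_char v.
    by rewrite -[_ _]/(C (HP_pi (SigSub qv1))) E.
  by apply/esym/HP_piP; exists q.
- by move=> [x Cx <-]; exists (SigSub (S0s x)).
Qed.

Lemma HP_open (U : set (HP n)) : open (HP_char @^-1` U) ->
  open ((val : HP_skel -> HP n) @^-1` U) -> open U.
Proof.
rewrite -!closedC => DU SU; exact: HP_closed.
Qed.

(* HP^n = HP^(n-1) \cup e^(4n), the attaching map of the cell being the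
   quotient map from S^(4n-1) to HP^(n-1) *)
Definition HP_top_cell : top_cell R (n * 4) (HP n) :=
  TopCell HP_char_continuous HP_char_boundary HP_char_inj HP_char_interior
    HP_open.

End projective_space.

(* Main.v *)
Require Import Defs.
From HB Require Import structures.
From Stdlib Require Import Relations.
From mathcomp Require Import all_boot all_order all_algebra generic_quotient.
From mathcomp Require Import all_classical all_reals all_analysis.
From mathcomp Require Import ring lra zify.

(** Write H for the quaternions and R^8 = H^2. Left multiplication by a unit
    quaternion on the first coordinate of H^2 commutes with the scalars, which
    act on the right; hence it descends to HP^1, and the attaching map
    S^7 -> HP^1 of the top cell of HP^2 is equivariant for it. If a map
    S^3 -> SO(8) consists of such multiplications, say by the quaternion u x
    at the point x, then the homeomorphism (p, x) |-> (u x . p, x) of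
    HP^1 x S^3 transforms the untwisted attaching data of the gyration into
    the twisted one, so that both gyrations are homeomorphic
    ([pushout_homeomorphic], [attach_mul_first]). A homotopy of maps
    S^3 -> SO(8), on the other hand, changes the gyration by a homotopy
    equivalence, because S^7 x S^3 has a collar in S^7 x D^4
    ([homotopic_pushout]). Hence all gyrations are equivalent to the untwisted
    one as soon as every map S^3 -> SO(8) is freely homotopic to one that
    consists of left multiplications on the first coordinate: this is the
    surjectivity of pi_3(Sp(1)) -> pi_3(SO(8)), proved in [SO8_left_mul] in
    three steps.

    - From SO(8) down to SO(4). The image of a basis vector under
      tau : S^3 -> SO(m), with m > 4, is a map from S^3 to a sphere of larger
      dimension. It is close to a Lipschitz map, whose image cannot fill the
      sphere by a counting argument ([lipschitz_misses]); once it misses a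
      point it contracts, and rotations of the plane spanned by the old and
      the new image lift the contraction to SO(m) ([rotate_vector],
      [deform_off_a_point], [deform_to_SO4]).

    - From SO(4) to S^3 x S^3. A rotation of H has the form x |-> p x q, and
      (p, q) is determined up to a common sign; as S^3 is simply connected, a
      map S^3 -> SO(4) lifts to a pair of maps P, Q : S^3 -> S^3
      ([lift_homotopy], [lift_SO4]).

    - From right to left. Quaternion conjugation exchanges right and left
      multiplications, x q = conj (conj q conj x). It has determinant -1 on H, but
      it extends to a rotation of H^2, which a path joins to the identity.
      So right multiplication by Q is homotopic in SO(8) to left
      multiplication by conj Q ([right_to_left]), and the map with lift (P, Q)
      is homotopic to left multiplication by P conj Q. *)

Set Implicit Arguments.
Unset Strict Implicit.
Unset Printing Implicit Defensive.

Import Order.TTheory GRing.Theory Num.Theory.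
Import numFieldNormedType.Exports.

Local Open Scope classical_set_scope.
Local Open Scope ring_scope.
Local Open Scope quotient_scope.

(** * Pasting and homotopies *)

Lemma comp_continuous (X Y Z : topologicalType) (f : X -> Y) (g : Y -> Z) :
  continuous f -> continuous g -> continuous (fun x => g (f x)).
Proof. by move=> cf cg x; apply: continuous_comp; [exact: cf|exact: cg]. Qed.

Lemma continuous_ext (X Y : topologicalType) (f g : X -> Y) :
  (forall x, f x = g x) -> continuous g -> continuous f.
Proof. by move=> /funext ->. Qed.

Lemma pair_continuous_at (X Y Z : topologicalType) (f : X -> Y) (g : X -> Z) x :
  {for x, continuous f} -> {for x, continuous g} ->
  {for x, continuous (fun x => (f x, g x))}.
Proof. by move=> cf cg; exact: (cvg_pair cf cg). Qed.

Lemma pair_continuous (X Y Z : topologicalType) (f : X -> Y) (g : X -> Z) :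
  continuous f -> continuous g -> continuous (fun x => (f x, g x)).
Proof. by move=> cf cg x; apply: pair_continuous_at; [exact: cf|exact: cg]. Qed.

Lemma fst_continuous (X Y : topologicalType) : continuous (@fst X Y).
Proof. by move=> p; exact: cvg_fst. Qed.

Lemma snd_continuous (X Y : topologicalType) : continuous (@snd X Y).
Proof. by move=> p; exact: cvg_snd. Qed.

Lemma id_continuous (X : topologicalType) : continuous (fun x : X => x).
Proof. by move=> x; exact: cvg_id. Qed.

Lemma shear_continuous (X Y Z W : topologicalType) (f : X * W -> Z) (u : Y -> W) :
  continuous f -> continuous u ->
  continuous (fun p : X * Y => (f (p.1, u p.2), p.2)).
Proof.
move=> cf cu; apply: pair_continuous; last exact: snd_continuous.
apply: comp_continuous cf; apply: pair_continuous; first exact: fst_continuous.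
by apply: comp_continuous cu; exact: snd_continuous.
Qed.

Lemma near_eq_continuous_at (X Y : topologicalType) (f g : X -> Y) (x : X) :
  (\forall z \near x, f z = g z) -> {for x, continuous g} ->
  {for x, continuous f}.
Proof.
move=> fg cg W; rewrite (nbhs_singleton fg) => gW.
suff sub : [set z | f z = g z] `&` g @^-1` W `<=` f @^-1` W.
  by apply: (@filterS _ (nbhs x) _ _ _ sub); apply: filterI => //; exact: cg.
by move=> z [/= fgz]; rewrite /preimage /= fgz.
Qed.

Section pasting.
Variables (R : realType) (X Y : topologicalType).

Lemma cvg_if (F : set_system X) (b : X -> bool) (f g : X -> Y) (y : Y) :
  Filter F -> f @ F --> y -> g @ F --> y ->
  (fun x => if b x then f x else g x) @ F --> y.
Proof.
move=> FF fy gy A Ay; have := @filterI _ F FF _ _ (fy A Ay) (gy A Ay).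
by apply: (@filterS _ F FF) => x [fA gA] /=; case: (b x).
Qed.

(** Each of the two maps has to be continuous only on its own closed region,
    so they may be partial maps completed arbitrarily, such as the direction
    of a vector. *)
Lemma paste_continuous (alpha beta : X -> R) (f g : X -> Y) :
  continuous alpha -> continuous beta ->
  (forall x, alpha x <= beta x -> {for x, continuous f}) ->
  (forall x, beta x <= alpha x -> {for x, continuous g}) ->
  (forall x, alpha x = beta x -> f x = g x) ->
  continuous (fun x => if alpha x <= beta x then f x else g x).
Proof.
move=> ca cb cf cg fg x.
have cd : (fun x => beta x - alpha x) @ x --> beta x - alpha x.
  exact: (@cvgB R R X (nbhs x) _ beta alpha _ _ (cb x) (ca x)).
have [ab|ba|ab] := ltgtP (alpha x) (beta x).
- apply: near_eq_continuous_at (cf x (ltW ab)).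
  have : \forall z \near x, 0 < beta z - alpha z.
    by apply: (cvgr_gt _ cd); rewrite subr_gt0.
  by apply: filterS => z; rewrite subr_gt0 => /ltW ->.
- apply: near_eq_continuous_at (cg x (ltW ba)).
  have : \forall z \near x, beta z - alpha z < 0.
    by apply: (cvgr_lt _ cd); rewrite subr_lt0.
  by apply: filterS => z; rewrite subr_lt0 ltNge => /negbTE ->.
- rewrite /continuous_at ab lexx; apply: cvg_if; first by apply: cf; rewrite ab.
  by rewrite (fg x ab); apply: cg; rewrite ab.
Qed.

End pasting.

Section homotopies.
Variable R : realType.

Definition clamp (t : R) : R := Num.max 0 (Num.min 1 t).

Lemma clamp01 t : 0 <= clamp t <= 1.
Proof.
by rewrite /clamp le_max lexx ge_max ler01 ge_min lexx.
Qed.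

Lemma clamp_le0 t : t <= 0 -> clamp t = 0.
Proof.
by move=> t0; rewrite /clamp (min_idPr _) ?(max_idPl _)// (le_trans t0).
Qed.

Lemma clamp_ge1 t : 1 <= t -> clamp t = 1.
Proof. by move=> t1; rewrite /clamp (min_idPl _) ?(max_idPr _). Qed.

Lemma clamp_continuous : continuous clamp.
Proof.
move=> t; have c0 := @cst_continuous R R 0; have c1 := @cst_continuous R R 1.
apply: (@continuous_max R R (cst 0) (cst 1 \min id) t (c0 t)).
by apply: (@continuous_min R R (cst 1) id t (c1 t)); exact: cvg_id.
Qed.

(** Homotopies can be taken on the whole line, constant before 0 and after 1:
    this removes the subspace [0, 1] from all continuity statements, and
    allows reparametrizations that leave [0, 1]. *)
Lemma homotopicP (X Y : topologicalType) (f g : X -> Y) : homotopic R f g <->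
  exists H : X * R -> Y, [/\ continuous H,
    forall x t, t <= 0 -> H (x, t) = f x & forall x t, 1 <= t -> H (x, t) = g x].
Proof.
split=> [[H [cH H0 H1]]|[H [cH H0 H1]]]; last first.
  exists H; split; [exact: continuous_subspaceT|by move=> x; exact: H0|].
  by move=> x; exact: H1.
exists (fun p => H (p.1, clamp p.2)); split; last 2 first.
- by move=> x t t0; rewrite /= clamp_le0.
- by move=> x t t1; rewrite /= clamp_ge1.
pose I := [set: X] `*` `[0 : R, 1].
have Ip (p : X * R) : (p.1, clamp p.2) \in I.
  by apply/mem_set; split => //=; rewrite in_itv /= clamp01.
move/subspace_sigL_continuousP : cH => cH.
have : continuous (sigL I H \o (fun p : X * R => SigSub (Ip p) : I)).
  move=> p; apply: continuous_comp; last exact: cH.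
  move: p; apply: to_set_continuous; apply: pair_continuous.
    exact: fst_continuous.
  by apply: comp_continuous; [exact: snd_continuous|exact: clamp_continuous].
exact.
Qed.

Lemma homotopic_refl (X Y : topologicalType) (f : X -> Y) :
  continuous f -> homotopic R f f.
Proof.
move=> cf; exists (f \o fst); split => //; apply: continuous_subspaceT => x.
by apply: continuous_comp; [exact: cvg_fst|exact: cf].
Qed.

Lemma homotopic_sym (X Y : topologicalType) (f g : X -> Y) :
  homotopic R f g -> homotopic R g f.
Proof.
move=> /homotopicP[H [cH H0 H1]]; apply/homotopicP.
exists (fun p => H (p.1, 1 - p.2)); split => /= [|x t t0|x t t1].
- apply: comp_continuous cH; apply: pair_continuous; first exact: fst_continuous.
  apply: subr_continuous; first exact: cst_continuous.
  exact: snd_continuous.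
- by apply: H1; lra.
- by apply: H0; lra.
Qed.

Lemma homotopic_trans (X Y : topologicalType) (f g h : X -> Y) :
  homotopic R f g -> homotopic R g h -> homotopic R f h.
Proof.
move=> /homotopicP[H [cH H0 H1]] /homotopicP[K [cK K0 K1]]; apply/homotopicP.
exists (fun p => if p.2 <= 2^-1 then H (p.1, 2 * p.2) else K (p.1, 2 * p.2 - 1)).
split => /= [|x t t0|x t t1].
- apply: (paste_continuous (alpha := snd)) => [p|p|p _|p _|[x t] /= ->].
  + exact: cvg_snd.
  + exact: cst_continuous.
  + move: p; apply: comp_continuous cH; apply: pair_continuous.
      exact: fst_continuous.
    by apply: mulr_continuous; [exact: cst_continuous|exact: snd_continuous].
  + move: p; apply: comp_continuous cK; apply: pair_continuous.
      exact: fst_continuous.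
    apply: subr_continuous; last exact: cst_continuous.
    by apply: mulr_continuous; [exact: cst_continuous|exact: snd_continuous].
  + by rewrite H1 ?K0 //; lra.
- by rewrite ifT ?H0 //; lra.
- by rewrite ifF ?K1 //; [lra|apply/negbTE; rewrite -ltNge; lra].
Qed.

Lemma homotopic_compl (X Y Z : topologicalType) (f g : X -> Y) (h : Y -> Z) :
  continuous h -> homotopic R f g -> homotopic R (h \o f) (h \o g).
Proof.
move=> ch /homotopicP[H [cH H0 H1]]; apply/homotopicP.
exists (h \o H); split => /= [|x t t0|x t t1]; last 2 first.
- by rewrite H0.
- by rewrite H1.
exact: comp_continuous ch.
Qed.

Lemma homotopic_compr (W X Y : topologicalType) (f g : X -> Y) (h : W -> X) :
  continuous h -> homotopic R f g -> homotopic R (f \o h) (g \o h).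
Proof.
move=> ch /homotopicP[H [cH H0 H1]]; apply/homotopicP.
exists (fun p => H (h p.1, p.2)); split => /= [|x t t0|x t t1]; last 2 first.
- by rewrite H0.
- by rewrite H1.
apply: comp_continuous cH; apply: pair_continuous; last exact: snd_continuous.
by apply: comp_continuous ch; exact: fst_continuous.
Qed.

Lemma homotopy_equivalent_sym (X Y : topologicalType) :
  homotopy_equivalent R X Y -> homotopy_equivalent R Y X.
Proof. by move=> [f [g [cf cg gf fg]]]; exists g, f; split. Qed.

Lemma homotopy_equivalent_trans (X Y Z : topologicalType) :
  homotopy_equivalent R X Y -> homotopy_equivalent R Y Z ->
  homotopy_equivalent R X Z.
Proof.
move=> [f [g [cf cg gf fg]]] [f' [g' [cf' cg' gf' fg']]].
exists (f' \o f), (g \o g'); split.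
- by move=> x; apply: continuous_comp; [exact: cf|exact: cf'].
- by move=> x; apply: continuous_comp; [exact: cg'|exact: cg].
- apply: homotopic_trans gf.
  exact: (homotopic_compl cg (homotopic_compr cf gf')).
- apply: homotopic_trans fg'.
  exact: (homotopic_compl cf' (homotopic_compr cg' fg)).
Qed.

End homotopies.

(** * Maps out of a pushout *)

Section quotient_times_locally_compact.
Variables (X Q T Z : topologicalType) (q : X -> Q) (H : Q * T -> Z).

(** The product of a quotient map with a locally compact Hausdorff space is a
    quotient map (Whitehead). For a compact neighbourhood K of t0, the set U
    of the points p such that H sends p x K into the given open set has an
    open preimage in X by the tube lemma, and U x K is the required
    neighbourhood. *)
Lemma quotient_prod_continuous :
  (forall U : set Q, open (q @^-1` U) -> open U) ->
  (forall p, exists x, q x = p) ->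
  hausdorff_space T -> locally_compact [set: T] ->
  continuous (fun xt : X * T => H (q xt.1, xt.2)) -> continuous H.
Proof.
move=> qo qs hT lT cG [p0 t0]; have [x0 qx0] := qs p0.
move=> W; rewrite nbhsE => -[W' [oW' W't0] W'W].
pose G (xt : X * T) := H (q xt.1, xt.2).
have nW' x t : W' (G (x, t)) -> nbhs (x, t) (G @^-1` W').
  by move=> GW; apply: (cG (x, t)); exact: open_nbhs_nbhs.
have nV : nbhs t0 [set t | W' (G (x0, t))].
  have : nbhs (x0, t0) (G @^-1` W') by apply: nW'; rewrite /G /= qx0.
  move=> [[A B] /= [Ax Bt] AB]; apply: filterS Bt => t Bt /=.
  by apply: (AB (x0, t)); split => //; exact: nbhs_singleton Ax.
have [//|N + [cN clN]] := @lT t0; rewrite withinET => nN.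
have [B nB clB] := compact_regular hT cN nN nV.
pose K := N `&` closure B.
have cK : compact K by apply: compact_closedI => //; exact: closed_closure.
have nK : nbhs t0 K by apply: filterI => //; exact: filterS (@subset_closure _ B) nB.
pose U : set Q := [set p | forall t, K t -> W' (H (p, t))].
have oU : open U.
  apply: qo; rewrite openE => x Ux.
  have /compact_near_coveringP/(_ X (nbhs x) (fun x' t => W' (G (x', t)))) := cK.
  apply => t Kt.
  have [[A C] /= [Ax Ct] AC] := nW' x t (Ux t Kt).
  exists (C, A) => /=; first by split.
  by move=> [t' x'] /= [Ct' Ax']; exact: (AC (x', t')).
exists (U, K) => /=; last by move=> [p t] /= [Up Kt]; apply: W'W; exact: Up.
split => //; apply: open_nbhs_nbhs; split => // t [_ Bt].
by rewrite -qx0; exact: clB.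
Qed.

End quotient_times_locally_compact.

Section pushout_maps.
Variables (R : realType) (A B C : topologicalType) (f : A -> B) (g : A -> C).

Definition po_inl (b : B) : pushout f g :=
  \pi_(quotient_topology {eq_quot pushout_equiv f g}) (pushout_inl C b).

Definition po_inr (c : C) : pushout f g :=
  \pi_(quotient_topology {eq_quot pushout_equiv f g}) (pushout_inr B c).

Lemma po_glue a : po_inl (f a) = po_inr (g a).
Proof. by apply/eqmodP/asboolP; apply: rst_step; exists a. Qed.

Lemma po_cases p : (exists b, p = po_inl b) \/ (exists c, p = po_inr c).
Proof.
by rewrite -[p]reprK; case: (repr p) => -[] z; [left|right]; exists z.
Qed.

Lemma po_inl_continuous : continuous po_inl.
Proof.
apply: comp_continuous; last exact: pi_continuous.
exact: (@existT_continuous _ (pushout_summand B C) true).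
Qed.

Lemma po_inr_continuous : continuous po_inr.
Proof.
apply: comp_continuous; last exact: pi_continuous.
exact: (@existT_continuous _ (pushout_summand B C) false).
Qed.

Definition sum_case (Z : Type) (F1 : B -> Z) (F2 : C -> Z)
    (u : pushout_sum B C) : Z :=
  match u with
  | existT true b => F1 b
  | existT false c => F2 c
  end.

Definition po_map (Z : Type) (F1 : B -> Z) (F2 : C -> Z) (p : pushout f g) :=
  sum_case F1 F2 (repr p).

Section po_map_theory.
Variables (Z : Type) (F1 : B -> Z) (F2 : C -> Z).
Hypothesis F12 : forall a, F1 (f a) = F2 (g a).

Lemma po_map_pi u :
  po_map F1 F2 (\pi_(quotient_topology {eq_quot pushout_equiv f g}) u) =
  sum_case F1 F2 u.
Proof.
rewrite /po_map; set v := repr _.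
have : pushout_rel f g v u.
  by apply/(@eqmodP _ (pushout_equiv f g)); rewrite /v reprK.
move/asboolP; elim=> [_ _ [a [-> ->]]|//|w1 w2 _ -> //|w1 w2 w3 _ -> _ -> //].
exact: F12.
Qed.

Lemma po_map_inl b : po_map F1 F2 (po_inl b) = F1 b.
Proof. exact: po_map_pi. Qed.

Lemma po_map_inr c : po_map F1 F2 (po_inr c) = F2 c.
Proof. exact: po_map_pi. Qed.

End po_map_theory.

(** A homotopy on a pushout is given by compatible homotopies on both pieces;
    this is where the product with the line must preserve the quotient
    topology. *)
Lemma po_homotopy_continuous (Z : topologicalType) (F1 : B * R -> Z)
    (F2 : C * R -> Z) :
  (forall a t, F1 (f a, t) = F2 (g a, t)) -> continuous F1 -> continuous F2 ->
  continuous (fun pt : pushout f g * R =>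
    po_map (fun b => F1 (b, pt.2)) (fun c => F2 (c, pt.2)) pt.1).
Proof.
move=> F12 c1 c2.
apply: (@quotient_prod_continuous _ _ _ _
  (\pi_(quotient_topology {eq_quot pushout_equiv f g}))).
- by [].
- by move=> p; exists (repr p); exact: reprK.
- exact: Rhausdorff.
- exact: locally_compactR.
have -> : (fun xt : pushout_sum B C * R =>
      po_map (fun b => F1 (b, xt.2)) (fun c => F2 (c, xt.2))
        (\pi_(quotient_topology {eq_quot pushout_equiv f g}) xt.1)) =
    (fun xt => sum_case (fun b => F1 (b, xt.2)) (fun c => F2 (c, xt.2)) xt.1).
  by apply/funext => -[u t]; rewrite po_map_pi.
have nbhs_sum (i : bool) (x : pushout_summand B C i) (t : R)
    (P' : set (pushout_summand B C i * R)) (P : set (pushout_sum B C * R)) :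
    nbhs (x, t) P' -> (forall y s, P' (y, s) -> P (existT _ i y, s)) ->
    nbhs (existT _ i x : pushout_sum B C, t) P.
  move=> [[U V] /= [Ux Vt] UV] P'P; exists (existT _ i @` U, V) => /=.
    by split => //; exact: existT_nbhs.
  by move=> [_ s] /= [[y Uy <-] Vs]; apply: P'P; exact: (UV (y, s)).
move=> [[[] x] t] W FW.
  exact: (@nbhs_sum true x t (F1 @^-1` W) _ (c1 (x, t) W FW)).
exact: (@nbhs_sum false x t (F2 @^-1` W) _ (c2 (x, t) W FW)).
Qed.

Lemma po_map_continuous (Z : topologicalType) (F1 : B -> Z) (F2 : C -> Z) :
  (forall a, F1 (f a) = F2 (g a)) -> continuous F1 -> continuous F2 ->
  continuous (po_map F1 F2).
Proof.
move=> F12 c1 c2; rewrite /po_map.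
apply: (@comp_continuous _ _ _ (fun p => (p, 0 : R))
  (fun pt => po_map (fun b => (F1 \o fst) (b, pt.2)) (fun c => (F2 \o fst) (c, pt.2)) pt.1)).
  by apply: pair_continuous; [exact: id_continuous|exact: cst_continuous].
apply: po_homotopy_continuous; first by move=> a t; exact: F12.
  exact: (comp_continuous (@fst_continuous B R) c1).
exact: (comp_continuous (@fst_continuous C R) c2).
Qed.

End pushout_maps.

(** * Polar coordinates in the disc *)

Lemma to_set_continuous_at (X Y : topologicalType) (A : set X) (f : Y -> A) y :
  {for y, continuous (val \o f)} -> {for y, continuous f}.
Proof.
move=> cf W [_ [[V oV <-] Vfy VW]].
have /cf : nbhs ((val \o f) y) V by exact: open_nbhs_nbhs.
by apply: (@filterS _ (nbhs y)) => z Vz; exact: VW.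
Qed.

Lemma restrict_continuous (X Y : topologicalType) (A : set X) (f : X * Y -> X)
    (h : A * Y -> A) :
  continuous f -> (forall p, val (h p) = f (val p.1, p.2)) -> continuous h.
Proof.
move=> cf hf; apply: to_set_continuous.
apply: (continuous_ext (g := fun p : A * Y => f (val p.1, p.2))) => //.
apply: comp_continuous cf; apply: pair_continuous; last exact: snd_continuous.
by apply: comp_continuous; [exact: fst_continuous|exact: set_val_continuous].
Qed.

Section radius.
Variable R : realType.

Definition radius n (v : 'rV[R]_n) : R := Num.sqrt (sqnorm v).

Lemma sqnorm_ge0 n (v : 'rV[R]_n) : 0 <= sqnorm v.
Proof. by apply: sumr_ge0 => i _; exact: sqr_ge0. Qed.

Lemma sqnorm_eq0 n (v : 'rV[R]_n) : (sqnorm v == 0) = (v == 0).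
Proof.
rewrite psumr_eq0; last by move=> i _; exact: sqr_ge0.
apply/allP/eqP => [v0|-> i _]; last by rewrite mxE expr0n /= eqxx.
apply/rowP => i; rewrite [RHS]mxE; apply/eqP; rewrite -sqrf_eq0.
exact: v0 (mem_index_enum i).
Qed.

Lemma sqnormZ n s (v : 'rV[R]_n) : sqnorm (s *: v) = s ^+ 2 * sqnorm v.
Proof.
by rewrite /sqnorm mulr_sumr; apply: eq_bigr => i _; rewrite mxE exprMn.
Qed.

Lemma radius_ge0 n (v : 'rV[R]_n) : 0 <= radius v.
Proof. exact: sqrtr_ge0. Qed.

Lemma radius_eq0 n (v : 'rV[R]_n) : (radius v == 0) = (v == 0).
Proof. by rewrite sqrtr_eq0 -sqnorm_eq0 eq_le sqnorm_ge0 andbT. Qed.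

Lemma radiusZ n s (v : 'rV[R]_n) : 0 <= s -> radius (s *: v) = s * radius v.
Proof.
by move=> s0; rewrite /radius sqnormZ sqrtrM ?sqr_ge0// sqrtr_sqr ger0_norm.
Qed.

Lemma sqnorm_radius n (v : 'rV[R]_n) : sqnorm v = radius v ^+ 2.
Proof. by rewrite sqr_sqrtr ?sqnorm_ge0. Qed.

Lemma radius_usphere n (v : usphere R n) : radius (val v) = 1.
Proof. by rewrite /radius (set_valP v) sqrtr1. Qed.

Lemma radius_udisc n (v : udisc R n) : radius (val v) <= 1.
Proof.
rewrite -(@ler_pXn2r _ 2) ?nnegrE ?radius_ge0// -sqnorm_radius expr1n.
exact: set_valP v.
Qed.

Lemma radius_continuous n : continuous (@radius n).
Proof.
apply: (comp_continuous (f := @sqnorm R n)); first exact: sqnorm_continuous.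
exact: sqrt_continuous.
Qed.

Variable k : nat.

Lemma retract_subproof (v : 'rV[R]_k.+1) :
  (Num.max 1 (radius v))^-1 *: v \in udisc R k.+1.
Proof.
apply/mem_set; rewrite /udisc /= sqnorm_radius.
have m1 : 1 <= Num.max 1 (radius v) by rewrite le_max lexx.
have m0 := lt_le_trans ltr01 m1.
rewrite radiusZ ?invr_ge0 ?(ltW m0)//.
apply: exprn_ile1; first by rewrite mulr_ge0 ?invr_ge0 ?radius_ge0 ?(ltW m0).
by rewrite mulrC ler_pdivrMr// mul1r le_max lexx orbT.
Qed.

(** The retraction onto the disc makes v |-> v / rho a total map to the disc,
    correct where the norm of v is at most rho. *)
Definition retract (v : 'rV[R]_k.+1) : udisc R k.+1 := SigSub (retract_subproof v).

Lemma val_retract v : radius v <= 1 -> val (retract v) = v.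
Proof. by move=> v1 /=; rewrite (max_idPl v1) invr1 scale1r. Qed.

Lemma retract_continuous : continuous retract.
Proof.
apply: to_set_continuous => v; apply: (@continuousZ _ _ _
  (fun v : 'rV[R]_k.+1 => (Num.max 1 (radius v))^-1) idfun); last exact: cvg_id.
apply: (@continuousV _ _ (fun v : 'rV[R]_k.+1 => Num.max 1 (radius v))).
  by rewrite gt_eqF// lt_max ltr01.
apply: (@continuous_max R _ (cst 1) (@radius k.+1) v); first exact: cst_continuous.
exact: radius_continuous.
Qed.

Lemma direction_subproof (v : 'rV[R]_k.+1) :
  (if v == 0 then delta_mx 0 0 else (radius v)^-1 *: v) \in usphere R k.+1.
Proof.
apply/mem_set; rewrite /usphere /=; case: ifPn => [_|v0].
  rewrite /sqnorm (bigD1 0) //= mxE !eqxx expr1n big1 ?addr0// => i i0.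
  by rewrite mxE (negbTE i0) andbF expr0n.
rewrite sqnormZ sqnorm_radius exprVn mulVf// expf_eq0/= radius_eq0.
by rewrite (negbTE v0).
Qed.

(** The value at 0 only makes the map total. *)
Definition direction (v : 'rV[R]_k.+1) : usphere R k.+1 :=
  SigSub (direction_subproof v).

Lemma val_direction v : v != 0 -> val (direction v) = (radius v)^-1 *: v.
Proof. by move=> /negbTE v0 /=; rewrite v0. Qed.

Lemma directionZ s v : 0 < s -> direction (s *: v) = direction v.
Proof.
move=> s0; apply/val_inj => /=; rewrite scaler_eq0 gt_eqF//=.
case: ifPn => // v0; rewrite radiusZ ?ltW// scalerA invfM mulrAC mulVf ?mul1r//.
by rewrite gt_eqF.
Qed.

Lemma direction_usphere (v : usphere R k.+1) : direction (val v) = v.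
Proof.
apply/val_inj; rewrite val_direction ?radius_usphere ?invr1 ?scale1r//.
by rewrite -radius_eq0 radius_usphere oner_eq0.
Qed.

Lemma direction_continuous (v : 'rV[R]_k.+1) : v != 0 -> {for v, continuous direction}.
Proof.
move=> v0; apply: to_set_continuous_at.
have cd : {for v, continuous (fun v : 'rV[R]_k.+1 => (radius v)^-1 *: v)}.
  apply: (@continuousZ _ _ _ (fun v : 'rV[R]_k.+1 => (radius v)^-1) idfun).
    apply: (@continuousV _ _ (@radius k.+1)); first by rewrite radius_eq0.
    exact: radius_continuous.
  exact: cvg_id.
apply: near_eq_continuous_at cd.
have v1 : 0 < radius v by rewrite lt_neqAle eq_sym radius_eq0 v0 radius_ge0.
have : \forall z \near v, 0 < radius z.
  exact: cvgr_gt (radius v) (@radius_continuous _ v) 0 v1.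
by apply: filterS => z /lt0r_neq0; rewrite radius_eq0; exact: val_direction.
Qed.

End radius.

(** * Homotopy invariance of the pushout *)

(** In this section the pushouts are Y with X x D attached along X x S, for
    maps g : X x S -> Y. *)
Section gluing.
Variables (R : realType) (k : nat) (X Y : topologicalType).

Let S := usphere R k.+1.
Let D := udisc R k.+1.

Definition rim (p : X * S) : X * D := (p.1, subfun (@usphere_udisc R k.+1) p.2).

Local Notation P g := (pushout rim g).

Lemma rimE (a : X) (v : D) : radius (val v) = 1 ->
  rim (a, direction (val v)) = (a, v).
Proof.
move=> v1; congr (_, _); apply/val_inj => /=.
have v0 : val v != 0 by rewrite -radius_eq0 v1 oner_eq0.
by rewrite (negbTE v0) v1 invr1 scale1r.
Qed.

Lemma retract_id (v : D) : retract (val v) = v.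
Proof. by apply/val_inj/val_retract/radius_udisc. Qed.

(** The disc of radius rho is expanded to the whole cell, and the remaining
    collar is sent to Y by G, at a time s that depends on the radius only. *)
Definition collar (g : X * S -> Y) (G : X * S * R -> Y) (rho : R) (s : R -> R)
    (p : X * D) : P g :=
  if radius (val p.2) <= rho then po_inl rim g (p.1, retract (rho^-1 *: val p.2))
  else po_inr rim g (G (p.1, direction (val p.2), s (radius (val p.2)))).

Lemma collar_continuous (g : X * S -> Y) (G : X * S * R -> Y) (rho : R -> R)
    (s : R * R -> R) :
  continuous G -> continuous rho -> continuous s ->
  (forall l, 0 < rho l) -> (forall b l, G (b, s (l, rho l)) = g b) ->
  continuous (fun pl : X * D * R =>
    collar g G (rho pl.2) (fun r => s (pl.2, r)) pl.1).
Proof.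
move=> cG crho cs rho0 Grho; rewrite /collar.
have cv : continuous (fun pl : X * D * R => val pl.1.2).
  apply: comp_continuous; last exact: set_val_continuous.
  by apply: comp_continuous; [exact: fst_continuous|exact: snd_continuous].
have ca : continuous (fun pl : X * D * R => pl.1.1).
  by apply: comp_continuous; exact: fst_continuous.
have cr : continuous (fun pl : X * D * R => radius (val pl.1.2)).
  by apply: comp_continuous cv _; exact: radius_continuous.
have cl : continuous (fun pl : X * D * R => rho pl.2).
  by apply: comp_continuous crho; exact: snd_continuous.
apply: (paste_continuous (alpha := fun pl : X * D * R => radius (val pl.1.2)))
  => // [pl _|pl rl|[[a v] l] /= rE].
- move: pl; apply: comp_continuous; last exact: po_inl_continuous.
  apply: pair_continuous => //; apply: comp_continuous; last exact: retract_continuous.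
  move=> pl; apply: (@continuousZ _ _ _ (fun pl : X * D * R => (rho pl.2)^-1)
    (fun pl : X * D * R => val pl.1.2)); last exact: cv.
  by apply: continuousV; [rewrite gt_eqF|exact: cl].
- have v0 : val pl.1.2 != 0.
    by rewrite -radius_eq0 gt_eqF// (lt_le_trans (rho0 pl.2)).
  apply: (@continuous_comp _ _ _ (fun pl : X * D * R => (pl.1.1,
    direction (val pl.1.2), s (pl.2, radius (val pl.1.2)))) (fun q => po_inr rim g (G q))).
    apply: pair_continuous_at.
      apply: pair_continuous_at; first exact: ca.
      apply: (@continuous_comp _ _ _ (fun pl : X * D * R => val pl.1.2)).
        exact: cv.
      exact: direction_continuous.
    apply: (comp_continuous (f := fun pl : X * D * R =>
      (pl.2, radius (val pl.1.2)))) => //.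
    by apply: pair_continuous => //; exact: snd_continuous.
  by apply: comp_continuous cG _ _; exact: po_inr_continuous.
- rewrite rE Grho -po_glue; congr (po_inl _ _ _).
  have r1 : radius (val (retract ((rho l)^-1 *: val v))) = 1.
    rewrite val_retract radiusZ ?invr_ge0 ?(ltW (rho0 l))// rE mulVf//;
      by rewrite gt_eqF.
  rewrite -(rimE a r1); congr (rim (a, _)).
  rewrite val_retract ?directionZ ?invr_gt0//.
  by rewrite radiusZ ?invr_ge0 ?(ltW (rho0 l))// rE mulVf// gt_eqF.
Qed.

(** The map of pushouts defined by a homotopy G from g0 to g1: the collar of
    radii 1/2 to 1 runs through G, at time 0 on the boundary and 1 at radius
    1/2, where it meets the expanded cell. *)
Definition slide (G : X * S * R -> Y) (g0 g1 : X * S -> Y) : P g0 -> P g1 :=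
  po_map (collar g1 G 2^-1 (fun r => 2 - 2 * r)) (po_inr rim g1).

Arguments slide : clear implicits.

Section slide_theory.
Variables (g0 g1 : X * S -> Y) (G : X * S * R -> Y).
Hypothesis G_continuous : continuous G.
Hypothesis G_le0 : forall b t, t <= 0 -> G (b, t) = g0 b.
Hypothesis G_ge1 : forall b t, 1 <= t -> G (b, t) = g1 b.

Lemma slide_compat a : collar g1 G 2^-1 (fun r => 2 - 2 * r) (rim a) = po_inr rim g1 (g0 a).
Proof.
rewrite /collar /= radius_usphere direction_usphere ifF; last first.
  by apply/negbTE; rewrite -ltNge; lra.
by rewrite G_le0; [case: a|lra].
Qed.

Lemma slide_continuous : continuous (slide G g0 g1).
Proof.
apply: (po_map_continuous R); [exact: slide_compat| |exact: po_inr_continuous].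
apply: (comp_continuous (f := fun p : X * D => (p, 0 : R)) (g := fun pl : X * D * R =>
   collar g1 G ((cst 2^-1) pl.2) (fun r => (fun q => 2 - 2 * q.2) (pl.2, r)) pl.1)).
  by apply: pair_continuous; [exact: id_continuous|exact: cst_continuous].
apply: (@collar_continuous g1 G (cst 2^-1) (fun q => 2 - 2 * q.2)) => //.
- exact: cst_continuous.
- apply: subr_continuous; first exact: cst_continuous.
  by apply: mulr_continuous; [exact: cst_continuous|exact: snd_continuous].
- by move=> l /=; lra.
- by move=> b l /=; rewrite G_ge1 //; lra.
Qed.

Lemma slide_inl b :
  slide G g0 g1 (po_inl rim g0 b) = collar g1 G 2^-1 (fun r => 2 - 2 * r) b.
Proof. by rewrite /slide po_map_inl//; exact: slide_compat. Qed.

Lemma slide_inr y : slide G g0 g1 (po_inr rim g0 y) = po_inr rim g1 y.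
Proof. by rewrite /slide po_map_inr//; exact: slide_compat. Qed.

End slide_theory.

Section slide_back.
Variables (g0 g1 : X * S -> Y) (G : X * S * R -> Y).
Hypothesis G_continuous : continuous G.
Hypothesis G_le0 : forall b t, t <= 0 -> G (b, t) = g0 b.
Hypothesis G_ge1 : forall b t, 1 <= t -> G (b, t) = g1 b.

Let back (bt : X * S * R) := G (bt.1, 1 - bt.2).

Let back_le0 b t : t <= 0 -> back (b, t) = g1 b.
Proof. by move=> t0; apply: G_ge1 => /=; lra. Qed.

Let back_ge1 b t : 1 <= t -> back (b, t) = g0 b.
Proof. by move=> t0; apply: G_le0 => /=; lra. Qed.

Let rho (l : R) := 4^-1 + 3 / 4 * clamp l.
Let s (lr : R * R) := Num.min (2 - 2 * lr.2) (4 * (lr.2 - rho lr.1)).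

(** The composition of the slides along G and along its reverse expands the
    disc of radius 1/4, and in the collar goes forth and back along G. The
    homotopy to the identity goes less and less far along G while the expanded
    disc grows: at time l its radius is rho l, and the time at which G is
    taken is the minimum s (l, r) of two affine functions of the radius r,
    which vanish at r = 1 and at r = rho l. *)
Lemma slide_reverse :
  homotopic R (slide back g1 g0 \o slide G g0 g1) idfun.
Proof.
have rho1 l : 4^-1 <= rho l <= 1.
  by rewrite /rho; have /andP[c0 c1] := clamp01 l; apply/andP; split; lra.
have crho : continuous rho.
  apply: addr_continuous; first exact: cst_continuous.
  by apply: mulr_continuous; [exact: cst_continuous|exact: clamp_continuous].
have cs : continuous s.
  have c1 : continuous (fun lr : R * R => 2 - 2 * lr.2).
    apply: subr_continuous; first exact: cst_continuous.
    by apply: mulr_continuous; [exact: cst_continuous|exact: snd_continuous].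
  have c2 : continuous (fun lr : R * R => 4 * (lr.2 - rho lr.1)).
    apply: mulr_continuous; first exact: cst_continuous.
    apply: subr_continuous; first exact: snd_continuous.
    by apply: comp_continuous crho; exact: fst_continuous.
  by move=> lr; exact: (continuous_min (c1 lr) (c2 lr)).
pose F1 (pl : X * D * R) := collar g0 G (rho pl.2) (fun r => s (pl.2, r)) pl.1.
pose F2 (yl : Y * R) := po_inr rim g0 yl.1.
have F12 a l : F1 (rim a, l) = F2 (g0 a, l).
  rewrite /F1 /F2 /collar /= radius_usphere direction_usphere.
  have /andP[r4 r1] := rho1 l; case: ifPn => [r1'|_].
    have -> : rho l = 1 by apply/le_anti; rewrite r1 r1'.
    rewrite invr1 scale1r -po_glue; congr (po_inl _ _ _).
    case: a => a x; congr (_, _) => /=; apply/val_inj; rewrite val_retract//.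
    by rewrite radius_usphere.
  rewrite G_le0; first by case: a.
  by rewrite /s /= ge_min; apply/orP; left; lra.
have c1 : continuous F1.
  apply: (@collar_continuous g0 G rho s) => // [l|b l]; first by have /andP[] := rho1 l; lra.
  by rewrite G_le0// /s /= subrr mulr0 ge_min lexx orbT.
have c2 : continuous F2.
  by apply: comp_continuous; [exact: fst_continuous|exact: po_inr_continuous].
exists (fun pl : P g0 * R =>
  po_map (fun b => F1 (b, pl.2)) (fun c => F2 (c, pl.2)) pl.1); split.
- by apply: continuous_subspaceT; exact: po_homotopy_continuous.
- move=> p; have [[[a v] ->]|[y ->]] := po_cases p; last first.
    by rewrite /= !slide_inr// po_map_inr// => b; exact: F12.
  rewrite /= po_map_inl; last by move=> b; exact: F12.
  rewrite slide_inl// /F1 /collar /= /s /rho /= clamp_le0// mulr0 addr0 !invrK.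
  have r2 : radius (2 *: sval v) = 2 * radius (sval v) by rewrite radiusZ.
  case: ifPn => [v4|]; last (rewrite -ltNge => v4; case: ifPn => v2).
  + rewrite ifT; last lra.
    have := val_retract (v := 2 *: sval v); rewrite r2.
    move: (retract (2 *: sval v)) => w wE.
    rewrite slide_inl// /collar /= invrK wE; last lra.
    rewrite ifT ?r2; last lra.
    by rewrite scalerA -natrM.
  + have := val_retract (v := 2 *: sval v); rewrite r2.
    move: (retract (2 *: sval v)) => w wE.
    rewrite slide_inl// /collar /= invrK wE; last lra.
    rewrite ifF ?r2; last by apply/negbTE; rewrite -ltNge; lra.
    rewrite directionZ// /back /= (min_idPr _); last lra.
    by congr (po_inr _ _ (G (_, _))); lra.
  + rewrite -ltNge in v2; rewrite slide_inr//.
    by rewrite (min_idPl _)//; lra.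
- move=> p; have [[[a v] ->]|[y ->]] := po_cases p; last first.
    by rewrite /= po_map_inr// => b; exact: F12.
  rewrite /= po_map_inl; last by move=> b; exact: F12.
  rewrite /F1 /collar /= /rho clamp_ge1//.
  rewrite (_ : 4^-1 + 3 / 4 * 1 = 1 :> R); last by field.
  by rewrite radius_udisc invr1 scale1r retract_id.
Qed.

End slide_back.

(** A homotopy from g0 to g1 and its reverse define slides in both directions,
    and the previous lemma applies to each of them. *)
Lemma homotopic_pushout (g0 g1 : X * S -> Y) :
  homotopic R g0 g1 -> homotopy_equivalent R (P g0) (P g1).
Proof.
move=> /homotopicP[G [cG G0 G1]].
pose back (bt : X * S * R) := G (bt.1, 1 - bt.2).
have cback : continuous back.
  apply: comp_continuous cG; apply: pair_continuous; first exact: fst_continuous.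
  apply: subr_continuous; first exact: cst_continuous.
  exact: snd_continuous.
have back0 b t : t <= 0 -> back (b, t) = g1 b by move=> t0; apply: G1 => /=; lra.
have back1 b t : 1 <= t -> back (b, t) = g0 b by move=> t1; apply: G0 => /=; lra.
exists (slide G g0 g1), (slide back g1 g0); split.
- exact: slide_continuous.
- exact: slide_continuous.
- exact: slide_reverse.
- have := slide_reverse cback back0 back1.
  rewrite (_ : (fun bt => _) = G) //; apply/funext => -[b t].
  by rewrite /back /= subKr.
Qed.
End gluing.

Lemma pushout_homeomorphic (R : realType) (A B C C' : topologicalType) (f : A -> B)
    (g : A -> C) (psi : C -> C') (psi' : C' -> C) :
  continuous psi -> continuous psi' -> cancel psi psi' -> cancel psi' psi ->
  homotopy_equivalent R (pushout f g) (pushout f (psi \o g)).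
Proof.
move=> cpsi cpsi' psiK psiK'.
pose F := po_map (f := f) (g := g) (po_inl f (psi \o g)) (po_inr f (psi \o g) \o psi).
pose F' := po_map (f := f) (g := psi \o g) (po_inl f g) (po_inr f g \o psi').
have gF a : po_inl f (psi \o g) (f a) = (po_inr f (psi \o g) \o psi) (g a).
  by rewrite po_glue.
have gF' a : po_inl f g (f a) = (po_inr f g \o psi') ((psi \o g) a).
  by rewrite po_glue /= psiK.
exists F, F'; split.
- apply: (po_map_continuous R) => //; first exact: po_inl_continuous.
  by apply: comp_continuous cpsi _; exact: po_inr_continuous.
- apply: (po_map_continuous R) => //; first exact: po_inl_continuous.
  by apply: comp_continuous cpsi' _; exact: po_inr_continuous.
- rewrite (_ : F' \o F = id); first by apply: homotopic_refl; exact: id_continuous.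
  apply/funext => p; rewrite /F /F' /=.
  have [[b ->]|[c ->]] := po_cases p.
    by rewrite (po_map_inl gF) (po_map_inl gF').
  by rewrite (po_map_inr gF) (po_map_inr gF') /= psiK.
- rewrite (_ : F \o F' = id); first by apply: homotopic_refl; exact: id_continuous.
  apply/funext => p; rewrite /F /F' /=.
  have [[b ->]|[c ->]] := po_cases p.
    by rewrite (po_map_inl gF') (po_map_inl gF).
  by rewrite (po_map_inr gF') (po_map_inr gF) /= psiK'.
Qed.

(** * Rotations as products of two reflections *)

Lemma mulmx_continuous (R : realType) (X : topologicalType) m n p
    (f : X -> 'M[R]_(m, n)) (g : X -> 'M[R]_(n, p)) :
  continuous f -> continuous g -> continuous (fun x => f x *m g x).
Proof.
move=> cf cg; apply: mx_continuous => i j.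
apply: (@eq_continuous _ _ (fun x => \sum_k f x i k * g x k j)) => [x|].
  by rewrite mxE.
apply: continuous_big => [|k _]; first exact: add_continuous.
by apply: mulr_continuous; exact: entry_continuous.
Qed.

Lemma trmx_continuous (R : realType) (X : topologicalType) m n
    (f : X -> 'M[R]_(m, n)) : continuous f -> continuous (fun x => (f x)^T).
Proof.
move=> cf; apply: mx_continuous => i j.
apply: (@eq_continuous _ _ (fun x => f x j i)) => [x|]; first by rewrite mxE.
exact: entry_continuous.
Qed.

Section reflections.
Variables (R : realType) (n : nat).
Implicit Types (u v w c : 'rV[R]_n) (A B : 'M[R]_n).

Definition dot u v : R := (u *m v^T) 0 0.

Lemma dotE u v : dot u v = \sum_i u 0 i * v 0 i.
Proof. by rewrite /dot mxE; apply: eq_bigr => i _; rewrite mxE. Qed.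

Lemma dotC u v : dot u v = dot v u.
Proof. by rewrite !dotE; apply: eq_bigr => i _; rewrite mulrC. Qed.

Lemma dotDl u v w : dot (u + v) w = dot u w + dot v w.
Proof. by rewrite /dot mulmxDl mxE. Qed.

Lemma dotDr u v w : dot u (v + w) = dot u v + dot u w.
Proof. by rewrite dotC dotDl !(dotC u). Qed.

Lemma dotZl s u v : dot (s *: u) v = s * dot u v.
Proof. by rewrite /dot -scalemxAl mxE. Qed.

Lemma dotZr s u v : dot u (s *: v) = s * dot u v.
Proof. by rewrite dotC dotZl dotC. Qed.

Lemma dotNl u v : dot (- u) v = - dot u v.
Proof. by rewrite -scaleN1r dotZl mulN1r. Qed.

Lemma dotNr u v : dot u (- v) = - dot u v.
Proof. by rewrite dotC dotNl dotC. Qed.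

Lemma dotvv v : dot v v = sqnorm v.
Proof. by rewrite sqnormE. Qed.

Lemma dot_delta v i : dot v (delta_mx 0 i) = v 0 i.
Proof.
rewrite dotE (bigD1 i) //= mxE !eqxx mulr1 big1 ?addr0// => k /negbTE ki.
by rewrite mxE ki andbF mulr0.
Qed.

Lemma dot_SO A u v : SO R n A -> dot (u *m A^T) (v *m A^T) = dot u v.
Proof.
move=> [AAT _]; rewrite /dot trmx_mul trmxK mulmxA -(mulmxA u).
by rewrite (mulmx1C AAT) mulmx1.
Qed.

Lemma SO_mul A B : SO R n A -> SO R n B -> SO R n (A *m B).
Proof.
move=> [AA dA] [BB dB]; split; last by rewrite det_mulmx dA dB mulr1.
by rewrite trmx_mul mulmxA -(mulmxA A) BB mulmx1.
Qed.

(** The matrix determinant lemma: both sides are the determinant of the block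
    matrix with rows (1, v) and (u^T, 1), factored as lower times upper and as
    upper times lower triangular. *)
Lemma det_1Bmul u v : \det (1%:M - u^T *m v) = 1 - dot u v.
Proof.
pose M := block_mx (1%:M : 'M[R]_1) v u^T 1%:M.
have : M = block_mx 1%:M 0 u^T 1%:M *m block_mx 1%:M v 0 (1%:M - u^T *m v).
  by rewrite mulmx_block !mul1mx ?mul0mx ?mulmx0 ?mulmx1 !addr0 subrKC.
move=> /(congr1 determinant); rewrite det_mulmx det_lblock det_ublock !det1 !mul1r => <-.
have -> : M = block_mx 1%:M v 0 1%:M *m block_mx (1%:M - v *m u^T) 0 u^T 1%:M.
  by rewrite mulmx_block !mul1mx ?mul0mx ?mulmx0 ?mulmx1 !add0r subrK.
rewrite det_mulmx det_ublock det_lblock !det1 !mul1r mulr1 det_mx11.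
by rewrite dotC /dot !mxE eqxx.
Qed.

(** For c = 0 this is the identity, as the inverse of 0 is 0. *)
Definition refl c : 'M[R]_n := 1%:M - (2 / sqnorm c) *: (c^T *m c).

Lemma refl_sym c : (refl c)^T = refl c.
Proof. by rewrite /refl linearB /= trmx1 linearZ /= trmx_mul trmxK. Qed.

Lemma mul_refl v c : v *m refl c = v - (2 * dot v c / sqnorm c) *: c.
Proof.
rewrite /refl mulmxBr mulmx1 -scalemxAr mulmxA; congr (_ - _).
have -> : v *m c^T = (dot v c)%:M by rewrite [LHS]mx11_scalar.
by rewrite mul_scalar_mx scalerA mulrAC.
Qed.

Lemma refl_refl c : c != 0 -> refl c *m refl c = 1%:M.
Proof.
rewrite -sqnorm_eq0 => c0; apply/row_matrixP => i; rewrite !rowE mulmxA mulmx1.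
rewrite !mul_refl dotDl dotNl dotZl dotvv.
move: (sqnorm c) c0 (dot _ c) => q q0 d.
by apply/rowP => k; rewrite !mxE; field.
Qed.

Lemma det_refl c : c != 0 -> \det (refl c) = -1.
Proof.
rewrite -sqnorm_eq0 => c0; rewrite /refl scalemxAl -linearZ det_1Bmul.
by rewrite dotZl dotvv divfK//; ring.
Qed.

Lemma SO_refl2 c d : c != 0 -> d != 0 -> SO R n (refl c *m refl d).
Proof.
move=> c0 d0; split; last by rewrite det_mulmx !det_refl// mulrNN mulr1.
by rewrite trmx_mul !refl_sym mulmxA -(mulmxA (refl c)) refl_refl// mulmx1 refl_refl.
Qed.

Lemma refl_fix c i : c 0 i = 0 ->
  (delta_mx 0 i : 'rV[R]_n) *m refl c = delta_mx 0 i.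
Proof. by move=> ci; rewrite mul_refl dotC dot_delta ci mulr0 mul0r scale0r subr0. Qed.

(** The reflection along v maps v to - v, and the one along v + w maps - v to
    w: their product rotates v to w in the plane of v and w. Unlike a formula
    with angles, it is rational, and it makes sense as long as w is not
    antipodal to v. *)
Lemma refl_rotate v w : sqnorm v = 1 -> sqnorm w = 1 -> v + w != 0 ->
  v *m (refl (v + w) *m refl v)^T = w.
Proof.
move=> v1 w1; rewrite -sqnorm_eq0 => vw0.
rewrite trmx_mul !refl_sym mulmxA (mul_refl v v) dotvv v1 divr1 mulr1.
rewrite mul_refl dotDl dotNl dotZl !dotDr dotvv v1.
have E : sqnorm (v + w) = 2 + 2 * dot v w.
  by rewrite -dotvv dotDl !dotDr !dotvv v1 w1 (dotC w); ring.
rewrite E in vw0 *; rewrite (_ : 2 * _ / _ = -1); last by field.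
by rewrite scaleN1r opprK; apply/rowP => i; rewrite !mxE; ring.
Qed.

Lemma refl_continuous (X : topologicalType) (f : X -> 'rV[R]_n) :
  continuous f -> (forall x, f x != 0) -> continuous (fun x => refl (f x)).
Proof.
move=> cf f0; apply: mx_continuous => i j.
apply: (@eq_continuous _ _ (fun x => (i == j)%:R - 2 / sqnorm (f x) * (f x 0 i * f x 0 j))).
  by move=> x; rewrite !mxE big_ord1 !mxE.
apply: subr_continuous; first exact: cst_continuous.
apply: mulr_continuous; last by apply: mulr_continuous; exact: entry_continuous.
apply: mulr_continuous; first exact: cst_continuous.
move=> x; apply: (@continuousV _ _ (fun x => sqnorm (f x))).
  by rewrite sqnorm_eq0.
by apply: (comp_continuous cf); exact: sqnorm_continuous.
Qed.

End reflections.

Section rotating.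
Variables (R : realType) (n : nat) (X : topologicalType).
Implicit Types (tau : X -> SO R n) (v w : X -> 'rV[R]_n).

(** Homotopies of maps to SO(n) are given by matrices, so that the membership
    in SO(n) can be proved separately from continuity. *)
Lemma SO_homotopy tau0 tau1 (F : X * R -> 'M[R]_n) :
  continuous F -> (forall x t, 0 <= t <= 1 -> SO R n (F (x, t))) ->
  (forall x, F (x, 0) = val (tau0 x)) -> (forall x, F (x, 1) = val (tau1 x)) ->
  homotopic R tau0 tau1.
Proof.
move=> cF FSO F0 F1.
have FSO' (p : X * R) : F (p.1, clamp p.2) \in SO R n.
  by apply/mem_set/FSO/clamp01.
exists (fun p => SigSub (FSO' p)); split=> [|x|x].
- apply: continuous_subspaceT; apply: to_set_continuous.
  apply: (comp_continuous (f := fun p : X * R => (p.1, clamp p.2))) cF.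
  apply: pair_continuous; first exact: fst_continuous.
  by apply: comp_continuous; [exact: snd_continuous|exact: clamp_continuous].
- by apply/val_inj; rewrite /= clamp_le0// F0.
- by apply/val_inj; rewrite /= clamp_ge1// F1.
Qed.

(** The reflections along v and along v + t w have product 1 at t = 0 and the
    rotation of v to w at t = 1; v + t w does not vanish for t in [0, 1],
    because v and w are unit vectors and v + w is not 0. *)
Lemma rotate tau v w : continuous tau -> continuous v -> continuous w ->
  (forall x, sqnorm (v x) = 1) -> (forall x, sqnorm (w x) = 1) ->
  (forall x, v x + w x != 0) ->
  exists tau', [/\ continuous tau', homotopic R tau tau' &
    forall x, val (tau' x) = refl (v x + w x) *m refl (v x) *m val (tau x)].
Proof.
move=> ct cv cw v1 w1 vw.
have v0 x : v x != 0 by rewrite -sqnorm_eq0 v1 oner_eq0.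
have c0 x t : 0 <= t <= 1 -> v x + t *: w x != 0.
  move=> /andP[t0 t1]; apply/eqP => /eqP; rewrite addr_eq0 -scaleNr => /eqP vE.
  have : sqnorm (v x) = t ^+ 2 by rewrite vE sqnormZ w1 sqrrN mulr1.
  rewrite v1 => /esym /eqP; rewrite -[X in _ == X](expr1n _ 2) eqrXn2// => /eqP tE.
  by move: (vw x); rewrite vE tE scaleN1r addrC subrr eqxx.
have SO' x : refl (v x + w x) *m refl (v x) *m val (tau x) \in SO R n.
  apply/mem_set/SO_mul; last exact: set_valP (tau x).
  by apply: SO_refl2 => //.
have ctau : continuous (fun x => val (tau x)).
  by apply: (comp_continuous ct); exact: set_val_continuous.
have cvw : continuous (fun x => v x + w x).
  by move=> x; apply: (@continuousD _ _ _ v w); [exact: cv|exact: cw].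
exists (fun x => SigSub (SO' x)); split => //.
  apply: to_set_continuous; apply: mulmx_continuous => //.
  by apply: mulmx_continuous; exact: refl_continuous.
pose F (p : X * R) :=
  refl (v p.1 + clamp p.2 *: w p.1) *m refl (v p.1) *m val (tau p.1).
apply: (SO_homotopy (F := F)) => [|x t|x|x].
- have cfst : continuous (@fst X R) by exact: fst_continuous.
  apply: mulmx_continuous; last exact: (comp_continuous cfst ctau).
  apply: mulmx_continuous; apply: refl_continuous => //.
  + move=> p; apply: (@continuousD _ _ _ (fun p : X * R => v p.1)
      (fun p : X * R => clamp p.2 *: w p.1)).
      exact: (comp_continuous cfst cv).
    apply: (@continuousZ _ _ _ (fun p : X * R => clamp p.2) (fun p : X * R => w p.1)).
      by apply: (comp_continuous (@snd_continuous X R)); exact: clamp_continuous.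
    exact: (comp_continuous cfst cw).
  + by move=> p; apply/c0/clamp01.
  + exact: (comp_continuous cfst cv).
- move=> t01; apply: SO_mul; last exact: set_valP (tau x).
  by apply: SO_refl2 => //; apply/c0/clamp01.
- by rewrite /F /= clamp_le0// scale0r addr0 refl_refl ?mul1mx.
- by rewrite /F /= clamp_ge1// scale1r.
Qed.

(** A homotopy of the image of the vector e is covered by a homotopy of tau.
    The basis vectors which are fixed by tau and orthogonal to e and w stay
    fixed, since they are orthogonal to both reflecting vectors. *)
Lemma rotate_vector tau e w : continuous tau -> continuous w ->
  sqnorm e = 1 ->
  (forall x, sqnorm (w x) = 1) -> (forall x, e *m (val (tau x))^T + w x != 0) ->
  exists tau', [/\ continuous tau', homotopic R tau tau',
    forall x, e *m (val (tau' x))^T = w x &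
    forall i x, delta_mx 0 i *m (val (tau x))^T = (delta_mx 0 i : 'rV[R]_n) ->
      e 0 i = 0 -> w x 0 i = 0 ->
      delta_mx 0 i *m (val (tau' x))^T = (delta_mx 0 i : 'rV[R]_n)].
Proof.
move=> ct cw e1 w1 ew.
pose v x := e *m (val (tau x))^T.
have v1 x : sqnorm (v x) = 1.
  by rewrite -dotvv dot_SO ?dotvv//; exact: set_valP (tau x).
have cv : continuous v.
  apply: mulmx_continuous; first exact: cst_continuous.
  apply: trmx_continuous; apply: (comp_continuous ct); exact: set_val_continuous.
have [tau' [ct' ht' tE]] := rotate ct cv cw v1 w1 ew.
exists tau'; split => // [x|i x ti ei wi].
  by rewrite tE trmx_mul mulmxA -/(v x) (refl_rotate (v1 x) (w1 x) (ew x)).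
have vi : v x 0 i = 0.
  by rewrite -dot_delta -ti dot_SO ?dot_delta//; exact: set_valP (tau x).
rewrite tE trmx_mul mulmxA ti trmx_mul !refl_sym mulmxA refl_fix//.
by rewrite refl_fix// mxE vi wi addr0.
Qed.

End rotating.

(** * Lipschitz approximation of maps on the sphere *)

(** The norm of row vectors is the maximum norm, while the radius is
    Euclidean; the bounds between both are the only relation used. *)
Section lipschitz_approximation.
Variables (R : realType) (k : nat).
Local Notation E := 'rV[R]_k.+1.
Implicit Types (x y z : E) (L : R).

Lemma normrV_entry y i : `|y 0 i| <= `|y|.
Proof.
rewrite {2}/Num.norm /= mx_normrE.
exact: (le_bigmax _ (fun ij : 'I_1 * 'I_k.+1 => `|y ij.1 ij.2|) (0, i)).
Qed.

Lemma normrV_le y (M : R) : 0 <= M -> (forall i, `|y 0 i| <= M) -> `|y| <= M.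
Proof.
move=> M0 yM; rewrite /Num.norm /= mx_normrE; apply: bigmax_le => // -[i j] _ /=.
by rewrite (ord1 i).
Qed.

Lemma normrV_radius y : `|y| <= radius y.
Proof.
apply: normrV_le; first exact: radius_ge0.
move=> i; rewrite -(@ler_pXn2r _ 2) ?nnegrE ?radius_ge0// -sqnorm_radius.
rewrite real_normK ?num_real// /sqnorm (bigD1 i) //= lerDl sumr_ge0// => j _.
exact: sqr_ge0.
Qed.

Let C : R := k.+1%:R.

Lemma radius_normrV y : radius y <= C * `|y|.
Proof.
rewrite -(@ler_pXn2r _ 2) ?nnegrE ?radius_ge0 ?mulr_ge0// -sqnorm_radius.
apply: (@le_trans _ _ (\sum_(i < k.+1) `|y| ^+ 2)).
  apply: ler_sum => i _; rewrite -(real_normK (num_real (y 0 i))).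
  by rewrite ler_pXn2r ?nnegrE// normrV_entry.
rewrite sumr_const card_ord -mulr_natl exprMn ler_wpM2r ?sqr_ge0//.
by rewrite expr2 ler_peMr// ler1n.
Qed.

Variable f : usphere R k.+1 -> R.
Hypothesis f_continuous : continuous f.
Hypothesis f_le1 : forall s, `|f s| <= 1.

(** Extending f homogeneously to the whole space makes its Lipschitz
    regularization homogeneous as well; this is used to treat the radial
    projection of the approximation to a sphere. *)
Definition conic y : R := radius y * f (direction y).

Lemma conic_le y : `|conic y| <= C * `|y|.
Proof.
rewrite normrM (ger0_norm (radius_ge0 y)).
apply: le_trans (radius_normrV y).
by rewrite ler_piMr// radius_ge0.
Qed.

Lemma conicZ t y : 0 < t -> conic (t *: y) = t * conic y.
Proof. by move=> t0; rewrite /conic directionZ// radiusZ ?ltW// mulrA. Qed.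

Lemma conic_usphere (x : usphere R k.+1) : conic (val x) = f x.
Proof. by rewrite /conic radius_usphere direction_usphere mul1r. Qed.

Lemma conic_continuous x : x != 0 -> {for x, continuous conic}.
Proof.
move=> x0; apply: (@continuousM _ _ (@radius R k.+1) (fun y => f (direction y))).
  exact: radius_continuous.
apply: (@continuous_comp _ _ _ (@direction R k) f); last exact: f_continuous.
exact: direction_continuous.
Qed.

(** The infimal convolution of the conical extension with L times the norm: as
    an infimum of L-Lipschitz functions of y it is L-Lipschitz. *)
Definition lip_reg L y : R := inf [set conic z + L * `|y - z| | z in [set: E]].

(** The bound from below which makes the infimum in the regularization finite
    as soon as L is at least C, and which shows that only the z close to y
    matter when L is large. *)
Lemma conic_lb L y z :
  (L - C) * `|y - z| - C * `|y| <= conic z + L * `|y - z|.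
Proof.
have : - (C * `|z|) <= conic z by have := conic_le z; rewrite ler_norml => /andP[].
have : `|z| <= `|y| + `|y - z| by rewrite -{1}(subKr y z) (le_trans (ler_normB _ _)).
by move=> /(ler_wpM2l (ler0n R k.+1)); lra.
Qed.

Lemma lip_reg_le L y z : C <= L -> lip_reg L y <= conic z + L * `|y - z|.
Proof.
move=> CL; apply: ge_inf; last by exists z.
exists (- (C * `|y|)) => _ [u _ <-]; apply: le_trans (conic_lb L y u).
by rewrite lerDr mulr_ge0// subr_ge0.
Qed.

Lemma lip_reg_ge L y (b : R) :
  (forall z, b <= conic z + L * `|y - z|) -> b <= lip_reg L y.
Proof.
move=> bz; apply: lb_le_inf; first by exists (conic 0 + L * `|y - 0|), 0.
by move=> _ [u _ <-].
Qed.

Lemma lip_reg_lipschitz L y y' : C <= L ->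
  `|lip_reg L y - lip_reg L y'| <= L * `|y - y'|.
Proof.
move=> CL; have L0 : 0 <= L by apply: le_trans CL; exact: ler0n.
suff le u u' : lip_reg L u - L * `|u - u'| <= lip_reg L u'.
  by rewrite ler_distl; have := le y y'; have := le y' y; rewrite distrC; lra.
apply: lip_reg_ge => z; have := lip_reg_le u z CL.
have : `|u - z| <= `|u - u'| + `|u' - z| by exact: ler_distD.
by move=> /(ler_wpM2l L0); lra.
Qed.

Lemma lip_regZ L t y : C <= L -> 0 < t -> lip_reg L (t *: y) = t * lip_reg L y.
Proof.
move=> CL.
have le u s : 0 < s -> lip_reg L (s *: u) <= s * lip_reg L u.
  move=> s0; rewrite mulrC -ler_pdivrMr//; apply: lip_reg_ge => z.
  rewrite ler_pdivrMr//; have := lip_reg_le (s *: u) (s *: z) CL.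
  by rewrite conicZ// -scalerBr normrZ gtr0_norm//; lra.
move=> t0; apply/le_anti/andP; split; first exact: le.
have ti0 : 0 < t^-1 by rewrite invr_gt0.
have := le (t *: y) t^-1 ti0; rewrite scalerA mulVf ?gt_eqF// scale1r.
by rewrite mulrC ler_pdivlMr// mulrC.
Qed.

(** For x on the sphere, points z near x contribute about f x to the infimum
    by continuity, and the other ones contribute a lot when L is large.
    Compactness of the sphere makes L uniform. *)
Lemma lip_reg_approx (e : R) : 0 < e ->
  \forall L \near +oo, forall x : usphere R k.+1, `|lip_reg L (val x) - f x| <= e.
Proof.
move=> e0.
pose P L x := forall z, conic x - e <= conic z + L * `|x - z|.
have K : compact (usphere R k.+1).
  by apply: udisc_compact; [exact: usphere_udisc|exact: usphere_closed].
have cover : \forall L \near +oo, usphere R k.+1 `<=` P L.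
  move/compact_near_coveringP : K; apply => x0 Sx0.
  have x00 : x0 != 0 by rewrite -sqnorm_eq0 Sx0 oner_eq0.
  have /cvgr_dist_lt /(_ (e / 2)) := conic_continuous x00.
  rewrite divr_gt0// => /(_ isT) /nbhs_ballP [d /= d0 dV].
  pose L0 : R := C + 4 * C * (`|x0| + d) / d.
  exists (ball x0 (d / 2), [set L | L0 < L]).
    split; first by apply: nbhsx_ballx; rewrite divr_gt0.
    by exists L0; split => //; exact: num_real.
  move=> [x L] /= [x0x L0L] z.
  rewrite -ball_normE /= in x0x.
  have dx u : `|x0 - u| < d -> `|conic x0 - conic u| < e / 2.
    by move=> xu; apply: dV; rewrite -ball_normE.
  have Vx := dx x ltac:(lra).
  have C0 : 0 <= C by exact: ler0n.
  have L1 : 0 <= 4 * C * (`|x0| + d) / d.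
    by rewrite divr_ge0 ?(ltW d0)// mulr_ge0 ?addr_ge0 ?mulr_ge0 ?(ltW d0).
  have [xz|xz] := ltrP (`|x - z|) (d / 2).
    have Vz : `|conic x0 - conic z| < e / 2.
      by apply: dx; have := ler_distD x x0 z; lra.
    have : 0 <= L * `|x - z| by rewrite mulr_ge0//; rewrite /L0 in L0L; lra.
    by move: Vx Vz; rewrite !ltr_distl => /andP[? ?] /andP[? ?]; lra.
  apply: le_trans (conic_lb L x z).
  have Vx' : conic x <= C * `|x| by have := conic_le x; rewrite ler_norml => /andP[].
  have x'x : C * `|x| <= C * (`|x0| + d).
    by rewrite ler_wpM2l//; have := ler_normB x0 (x0 - x); rewrite subKr; lra.
  have : 4 * C * (`|x0| + d) / d * (d / 2) <= (L - C) * `|x - z|.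
    by apply: ler_pM => //; [lra|rewrite /L0 in L0L; lra].
  rewrite (_ : _ / d * (d / 2) = 2 * (C * (`|x0| + d))); first lra.
  by field; rewrite gt_eqF.
have := nbhs_pinfty_ge (num_real C); apply: filterS2 cover => L LP CL x.
rewrite -conic_usphere ler_distl; apply/andP; split.
  by apply: lip_reg_ge => z; apply: LP; exact: set_valP x.
have := lip_reg_le (val x) (val x) CL; rewrite subrr normr0 mulr0 addr0; lra.
Qed.

End lipschitz_approximation.

(** * General position *)

Section general_position.
Variable R : realType.

(** The grid of the points p c has K^5 elements at distances at least h = 1 /
    8K, while the cube splits into about (2 N)^4 cells of width 1 / N. If all
    grid points were values of F, choosing preimages would inject the grid
    into the cells, because a cell is mapped to a set of diameter L / N, which
    is less than h for N = 9 K (L + 1). But N is proportional to K, so that (2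
    N)^4 is less than K^5 when K is large. *)
Lemma lipschitz_misses n (F : 'rV[R]_4 -> 'rV[R]_n) (L : nat) (j : 'I_5 -> 'I_n) :
  (forall y y' i, `|F y 0 i - F y' 0 i| <= L%:R * `|y - y'|) ->
  injective j ->
  exists p : 'rV[R]_n, [/\ forall i, 0 < p 0 (j i) <= 8^-1,
    forall i, (forall i', i != j i') -> p 0 i = 0 &
    forall y, `|y| <= 1 -> F y <> p].
Proof.
move=> Flip jinj.
pose Q := (27 * L.+1)%N.
have [K [Kgt0 QK]] : exists K, (0 < K)%N /\ (Q ^ 4 < K)%N by exists (Q ^ 4).+1.
pose N := (9 * K * L.+1)%N.
have Ngt0 : (0 < N)%N by rewrite /N !muln_gt0 Kgt0.
have N0 : 0 < N%:R :> R by rewrite ltr0n.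
pose h : R := (8 * K%:R)^-1.
have K0 : 0 < K%:R :> R by rewrite ltr0n.
have h0 : 0 < h by rewrite invr_gt0 mulr_gt0.
pose p (c : {ffun 'I_5 -> 'I_K}) : 'rV[R]_n :=
  \row_i \sum_(i' < 5) (if i == j i' then (c i').+1%:R * h else 0).
have pj c i : p c 0 (j i) = (c i).+1%:R * h.
  rewrite mxE (bigD1 i) //= eqxx big1 ?addr0// => i' /negbTE i'i.
  by rewrite (inj_eq jinj) eq_sym i'i.
apply: contrapT => noP.
have hit c : exists y, `|y| <= 1 /\ F y = p c.
  apply: contrapT => noy; apply: noP; exists (p c); split.
  - move=> i; rewrite pj mulr_gt0 ?ltr0n//=.
    rewrite /h invfM mulrCA -ler_pdivlMl ?invr_gt0// invrK mulfV ?gt_eqF//.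
    by rewrite ler_pdivrMr// mul1r ler_nat.
  - by move=> i ij; rewrite mxE big1 // => i' _; rewrite (negbTE (ij i')).
  - by move=> y y1 Fy; apply: noy; exists y.
have [y yP] := choice hit.
pose cell c : {ffun 'I_4 -> 'I_(2 * N).+1} :=
  [ffun i => inord (Num.truncn ((y c 0 i + 1) * N%:R))].
have cellE c i : (cell c i : nat) = Num.truncn ((y c 0 i + 1) * N%:R).
  have [y1 _] := yP c.
  have := normrV_entry (y c) i; move=> /le_trans/(_ y1); rewrite ler_norml => /andP[y0' y1'].
  rewrite ffunE inordK// ltnS truncn_le_nat -natr1 natrM.
  have : (y c 0 i + 1) * N%:R <= 2 * N%:R by rewrite ler_pM2r//; lra.
  by lra.
have cell_inj : injective cell.
  move=> c c' cc'.
  have [yc Fc] := yP c; have [yc' Fc'] := yP c'.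
  have close : `|y c - y c'| <= N%:R^-1.
    apply: normrV_le => [|i]; first by rewrite invr_ge0.
    have ge0 c0 : 0 <= (y c0 0 i + 1) * N%:R.
      have [y1 _] := yP c0; have /le_trans/(_ y1) := normrV_entry (y c0) i.
      by rewrite ler_norml => /andP[? _]; rewrite mulr_ge0 ?ler0n//; lra.
    have /andP[] := truncn_itv (ge0 c); have /andP[] := truncn_itv (ge0 c').
    rewrite -!cellE cc' -natr1 => a b a' b'.
    rewrite !mxE -[leRHS]mul1r ler_pdivlMr// -{1}(ger0_norm (ltW N0)) -normrM ler_norml.
    by apply/andP; split; lra.
  apply/ffunP => i; apply/val_inj/eqP.
  have := le_trans (Flip (y c) (y c') (j i)) (ler_wpM2l (ler0n R L) close).
  rewrite Fc Fc' !pj -mulrBl normrM (ger0_norm (ltW h0)).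
  have LN : L%:R / N%:R < h.
    rewrite /h ltr_pdivrMr// mulrC ltr_pdivlMr ?mulr_gt0// -!natrM ltr_nat /N.
    by lia.
  move=> /le_lt_trans/(_ LN); rewrite gtr_pMl// ltr_norml -!natr1 => /andP[a b].
  have : ((c i)%:R < (c' i).+1%:R :> R) by rewrite -natr1; lra.
  have : ((c' i)%:R < (c i).+1%:R :> R) by rewrite -natr1; lra.
  by rewrite !ltr_nat !ltnS eqn_leq => -> ->.
have := leq_card _ cell_inj; rewrite !card_ffun !card_ord.
apply/negP; rewrite -ltnNge.
apply: (@leq_ltn_trans ((3 * N) ^ 4)).
  by rewrite leq_exp2r//; lia.
rewrite (_ : 3 * N = K * Q)%N; last by rewrite /N /Q; lia.
by rewrite expnMn (expnS K 4) mulnC ltn_pmul2r ?expn_gt0 ?Kgt0.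
Qed.

End general_position.

Section deform_off_a_point.
Variables (R : realType) (n m : nat).
Hypotheses (m5 : (5 <= m)%N) (mn : (m <= n)%N).

Lemma sqnorm_entry (u : 'rV[R]_n) i : u 0 i ^+ 2 <= sqnorm u.
Proof.
by rewrite /sqnorm (bigD1 i) //= lerDl sumr_ge0// => k _; exact: sqr_ge0.
Qed.

Lemma sqnorm_le_entries (u : 'rV[R]_n) (e : R) :
  (forall i, `|u 0 i| <= e) -> sqnorm u <= n%:R * e ^+ 2.
Proof.
move=> ue; apply: (@le_trans _ _ (\sum_(i < n) e ^+ 2)).
  apply: ler_sum => i _; rewrite -(real_normK (num_real (u 0 i))).
  by rewrite ler_pXn2r ?nnegrE// (le_trans _ (ue i)).
by rewrite sumr_const card_ord mulr_natl.
Qed.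

Lemma sqnormB (u v : 'rV[R]_n) : sqnorm (u - v) = sqnorm u - 2 * dot u v + sqnorm v.
Proof.
by rewrite -dotvv dotDl !dotDr -scaleN1r !dotZl !dotZr !dotvv (dotC v); ring.
Qed.

(** The error 1 / 8n on every coordinate makes the square of the distance at
    most n / (8n)^2, hence at most 1 / 8. *)
Lemma conic_lipschitz_approx (v : usphere R 4 -> 'rV[R]_n) :
  continuous v -> (forall x, sqnorm (v x) = 1) ->
  (forall x (i : 'I_n), (m <= i)%N -> v x 0 i = 0) ->
  exists (L : nat) (F : 'rV[R]_4 -> 'rV[R]_n),
  [/\ forall y y' i, `|F y 0 i - F y' 0 i| <= L%:R * `|y - y'|,
      forall t y, 0 < t -> F (t *: y) = t *: F y,
      forall y (i : 'I_n), (m <= i)%N -> F y 0 i = 0 &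
      forall x, sqnorm (F (val x) - v x) <= 8^-1].
Proof.
move=> cv v1 vm.
have n0 : (0 < n)%N by lia.
pose e : R := (8 * n%:R)^-1.
have n1 : 1 <= n%:R :> R by rewrite ler1n.
have e0 : 0 < e by rewrite invr_gt0 mulr_gt0// ltr0n.
have cvi i : continuous (fun x => v x 0 i) by exact: entry_continuous.
have vi1 i x : `|v x 0 i| <= 1.
  rewrite -(@ler_pXn2r _ 2) ?nnegrE// expr1n real_normK ?num_real//.
  by rewrite -(v1 x) sqnorm_entry.
have : \forall L \near +oo, forall i (x : usphere R 4),
    `|lip_reg (fun x => v x 0 i) L (val x) - v x 0 i| <= e.
  by apply: filter_forall => i; exact: lip_reg_approx.
move=> [L0 [_ L0P]].
pose L := (Num.truncn (Num.max L0 4)).+1.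
have /andP[L0L L4] : (L0 < L%:R) && (4 <= L%:R :> R).
  by have := truncnS_gt (Num.max L0 4); rewrite -/L gt_max => /andP[-> /ltW].
exists L, (fun y => \row_i if (i < m)%N then lip_reg (fun x => v x 0 i) L%:R y else 0).
split.
- move=> y y' i; rewrite !mxE; case: ifP => _; first exact: lip_reg_lipschitz.
  by rewrite subr0 normr0 mulr_ge0.
- move=> t y t0; apply/rowP => i; rewrite !mxE; case: ifP => _; last by rewrite mulr0.
  exact: lip_regZ.
- by move=> y i mi; rewrite mxE ltnNge mi.
- move=> x; apply: (@le_trans _ _ (n%:R * e ^+ 2)).
    apply: sqnorm_le_entries => i; rewrite !mxE; case: ltnP => [_|mi].
      exact: L0P.
    by rewrite vm// subr0 normr0 ltW.
  rewrite /e exprVn -ler_pdivlMr ?invr_gt0 ?exprn_gt0 ?mulr_gt0 ?ltr0n//.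
  rewrite invrK expr2; have : n%:R <= n%:R * n%:R :> R by rewrite ler_peMr.
  by lra.
Qed.

(** Let F be the conical Lipschitz approximation of v and w its projection to
    the sphere, which is not antipodal to v. If w x were the projection of a
    point p missed by F, then p would be the value F (t x), where t is the
    quotient of the norms of p and F x, and t is at most 1 for p small enough.
    The vector called p in the conclusion is antipodal to that projection, the
    place to which the complement of the missed point contracts; having five
    nonzero coordinates, it is not antipodal to a basis vector. *)
Lemma deform_off_a_point (v : usphere R 4 -> 'rV[R]_n) :
  continuous v -> (forall x, sqnorm (v x) = 1) ->
  (forall x (i : 'I_n), (m <= i)%N -> v x 0 i = 0) ->
  exists (w : usphere R 4 -> 'rV[R]_n) (p : 'rV[R]_n),
  [/\ [/\ continuous w, forall x, sqnorm (w x) = 1,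
          forall x (i : 'I_n), (m <= i)%N -> w x 0 i = 0 & forall x, v x + w x != 0],
      [/\ sqnorm p = 1, forall i : 'I_n, (m <= i)%N -> p 0 i = 0 &
          forall i, p + delta_mx 0 i != 0] &
      forall x, w x + p != 0].
Proof.
move=> cv v1 vm.
have [L [F [Flip FZ Fm Fv]]] := conic_lipschitz_approx cv v1 vm.
have jP (i : 'I_5) : (i < n)%N by rewrite (leq_trans (ltn_ord i))// (leq_trans m5).
pose j i := Ordinal (jP i).
have jinj : injective j by move=> i i' /(congr1 val) /= /val_inj.
have [p [p0 pj Fp]] := lipschitz_misses Flip jinj.
have F38 (x : usphere R 4) : 3 / 8 <= sqnorm (F (val x)).
  have := sqnorm_ge0 (2 *: F (val x) - v x).
  by have := Fv x; rewrite !sqnormB sqnormZ dotZl v1; lra.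
have Fdot (x : usphere R 4) : 0 < dot (F (val x)) (v x).
  by have := Fv x; have := F38 x; rewrite sqnormB v1; lra.
have F0 (x : usphere R 4) : F (val x) != 0.
  by rewrite -sqnorm_eq0 gt_eqF// (lt_le_trans _ (F38 x)).
have cF : continuous (fun x : usphere R 4 => F (val x)).
  apply: comp_continuous; first exact: set_val_continuous.
  apply: mx_continuous => i0 i; rewrite (ord1 i0) => y W /nbhs_ballP[e /= e0 eW].
  have L0 : 0 < L%:R + 1 :> R by rewrite ltr_wpDl.
  apply/nbhs_ballP; exists (e / (L%:R + 1)) => /=; first by rewrite divr_gt0.
  move=> z; rewrite -ball_normE /= ltr_pdivlMr// => yz; apply: eW.
  rewrite -ball_normE /=.
  apply: le_lt_trans (Flip _ _ _) _; apply: le_lt_trans yz.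
  by rewrite mulrC ler_wpM2l// lerDl.
have pn0 : p != 0.
  apply/eqP => pE; have := p0 0; rewrite pE mxE ltxx//.
have p564 : sqnorm p <= 5 / 64.
  have n5 : (5 <= n)%N by exact: leq_trans mn.
  rewrite /sqnorm (bigID (fun i : 'I_n => (i < 5)%N)) /= [X in _ + X]big1 ?addr0.
    rewrite (big_ord_narrow n5) (@le_trans _ _ (\sum_(i < 5) 8^-1 ^+ 2))//.
      apply: ler_sum => i _; rewrite (_ : widen_ord n5 i = j i); last exact/val_inj.
      by have /andP[? ?] := p0 i; rewrite ler_pXn2r ?nnegrE// ltW.
    by rewrite sumr_const card_ord; lra.
  move=> i i5; rewrite pj ?expr0n// => i'; apply: contraNneq i5 => ->.
  exact: (ltn_ord i').
exists (fun x => (radius (F (val x)))^-1 *: F (val x)), (- (radius p)^-1 *: p).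
split.
- split.
  + move=> x; apply: (@continuousZ _ _ _ (fun x : usphere R 4 => (radius (F (val x)))^-1)).
      apply: (@continuousV _ _ (fun x : usphere R 4 => radius (F (val x)))).
        by rewrite radius_eq0.
      by move: x; apply: (comp_continuous cF); exact: radius_continuous.
    exact: cF.
  + by move=> x; rewrite sqnormZ sqnorm_radius exprVn mulVf// expf_neq0// radius_eq0.
  + by move=> x i mi; rewrite mxE Fm// mulr0.
  + move=> x; apply/eqP => /(congr1 (fun u => dot u (v x))).
    have r0 : 0 < (radius (F (val x)))^-1.
      by rewrite invr_gt0 lt_neqAle eq_sym radius_eq0 F0 radius_ge0.
    have := mulr_gt0 r0 (Fdot x).
    have dot0 : dot 0 (v x) = 0 by rewrite /dot mul0mx mxE.
    by rewrite dotDl dotZl dotvv v1 dot0; lra.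
- split.
  + by rewrite sqnormZ sqrrN sqnorm_radius exprVn mulVf// expf_neq0// radius_eq0.
  + move=> i mi; rewrite mxE pj ?mulr0// => i'; apply/eqP => /(congr1 val) /= iE.
    by move: mi; rewrite iE leqNgt (leq_trans (ltn_ord i')).
  + move=> i; have [i' ii'] : exists i', i != j i'.
      have [ij|] := eqVneq i (j 0); last by exists 0.
      by exists 1; rewrite ij (inj_eq jinj).
    apply/eqP => /rowP /(_ (j i')); rewrite !mxE eqxx eq_sym (negbTE ii') addr0.
    move/eqP; rewrite mulf_eq0 oppr_eq0 invr_eq0 radius_eq0 (negbTE pn0) /=.
    by have /andP[/lt0r_neq0/negbTE ->] := p0 i'.
- move=> x; rewrite scaleNr subr_eq0; apply/eqP => Fxp.
  have rF : 0 < radius (F (val x)) by rewrite lt_neqAle eq_sym radius_eq0 F0 radius_ge0.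
  have rp : 0 < radius p by rewrite lt_neqAle eq_sym radius_eq0 pn0 radius_ge0.
  (* The factor t makes F (t x) equal to p. *)
  pose t := radius p / radius (F (val x)).
  have t0 : 0 < t by rewrite divr_gt0.
  apply: (Fp (t *: val x)); last first.
    by rewrite FZ// /t -scalerA Fxp scalerA mulfV ?scale1r// gt_eqF.
  rewrite normrZ gtr0_norm// mulr_ile1 ?(ltW t0)//; last first.
    by rewrite -(radius_usphere x) normrV_radius.
  rewrite ler_pdivrMr// mul1r -(@ler_pXn2r _ 2) ?nnegrE ?(ltW rp) ?(ltW rF)//.
  by rewrite -!sqnorm_radius; have := F38 x; lra.
Qed.

End deform_off_a_point.

(** * Deforming rotations of R^8 into rotations of R^4 *)

Section fixing_basis_vectors.
Variable R : realType.

Definition fixes_from n (m : nat) (A : 'M[R]_n) :=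
  forall i : 'I_n, (m <= i)%N ->
    (delta_mx 0 i : 'rV[R]_n) *m A^T = delta_mx 0 i.

Lemma sqnorm_delta n (i : 'I_n) : sqnorm (delta_mx 0 i : 'rV[R]_n) = 1.
Proof. by rewrite -dotvv dot_delta mxE !eqxx. Qed.

Lemma delta_entry n (i k : 'I_n) : (delta_mx 0 i : 'rV[R]_n) 0 k = (k == i)%:R.
Proof. by rewrite mxE eqxx. Qed.

(** The image v of the basis vector e is moved in three steps: to a map w
    which misses a point, then to the constant antipodal to that point, then
    to the constant e. Consecutive maps are nowhere antipodal, as
    rotate_vector requires. *)
Lemma fix_one_more n m (tau : usphere R 4 -> SO R n) :
  (4 <= m)%N -> (m < n)%N -> continuous tau ->
  (forall x, fixes_from m.+1 (val (tau x))) ->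
  exists tau', [/\ continuous tau', homotopic R tau tau' &
    forall x, fixes_from m (val (tau' x))].
Proof.
move=> m4 mn ct fx; pose i0 := Ordinal mn.
pose e : 'rV[R]_n := delta_mx 0 i0.
have e1 : sqnorm e = 1 by exact: sqnorm_delta.
have e0 (i : 'I_n) : (m.+1 <= i)%N -> e 0 i = 0.
  by move=> mi; rewrite delta_entry; case: eqP => // ii; rewrite ii ltnn in mi.
pose v x := e *m (val (tau x))^T.
have cv : continuous v.
  apply: mulmx_continuous; first exact: cst_continuous.
  apply: trmx_continuous; apply: (comp_continuous ct); exact: set_val_continuous.
have v1 x : sqnorm (v x) = 1.
  by rewrite -dotvv dot_SO ?dotvv//; exact: set_valP (tau x).
have v0 x (i : 'I_n) : (m.+1 <= i)%N -> v x 0 i = 0.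
  move=> mi; rewrite -dot_delta -(fx x i mi) dot_SO ?dot_delta ?e0//.
  exact: set_valP (tau x).
have [w [p [[cw w1 w0 vw] [p1 p0 pe] wp]]] := @deform_off_a_point R n m.+1 m4 mn v cv v1 v0.
have [t1 [ct1 h1 E1 f1]] := rotate_vector ct cw e1 w1 vw.
have [|t2 [ct2 h2 E2 f2]] :=
  rotate_vector ct1 (@cst_continuous _ _ p) e1 (fun=> p1) _.
  by move=> x; rewrite E1; exact: wp.
have [|t3 [ct3 h3 E3 f3]] :=
  rotate_vector ct2 (@cst_continuous _ _ e) e1 (fun=> e1) _.
  by move=> x; rewrite E2; exact: pe.
exists t3; split => //.
  exact: homotopic_trans (homotopic_trans h1 h2) h3.
move=> x i; rewrite leq_eqVlt => /predU1P[mi|mi].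
  by rewrite (_ : i = i0); [rewrite -/e E3|apply/val_inj].
apply: f3; rewrite ?e0//; apply: f2; rewrite ?e0 ?p0//.
by apply: f1; rewrite ?e0 ?w0//; exact: fx.
Qed.

Lemma deform_to_SO4 n (tau : usphere R 4 -> SO R n) : continuous tau ->
  exists tau', [/\ continuous tau', homotopic R tau tau' &
    forall x, fixes_from 4 (val (tau' x))].
Proof.
move=> ct.
suff down m : (m <= n)%N -> forall tau : usphere R 4 -> SO R n, continuous tau ->
    (forall x, fixes_from m (val (tau x))) ->
    exists tau', [/\ continuous tau', homotopic R tau tau' &
      forall x, fixes_from 4 (val (tau' x))].
  by apply: (down n) => // x i; rewrite leqNgt ltn_ord.
elim: m => [|m IHm] mn {ct}tau ct fx.
  exists tau; split => //; first exact: homotopic_refl.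
  by move=> x i _; exact: fx.
have [m4|m4] := ltnP m 4.
  exists tau; split => //; first exact: homotopic_refl.
  by move=> x i i4; apply: fx; exact: leq_trans i4.
have [t1 [ct1 h1 f1]] := fix_one_more m4 mn ct fx.
have [t2 [ct2 h2 f2]] := IHm (ltnW mn) t1 ct1 f1.
by exists t2; split => //; exact: homotopic_trans h1 h2.
Qed.

(** Cartan and Dieudonne: if A maps e to v and not to e, the reflection along
    v - e exchanges v and e, and it fixes the basis vectors which are fixed by
    A, so that one more basis vector is fixed after composition with A. *)
Lemma orthogonal_reflections n (A : 'M[R]_n) : A *m A^T = 1%:M ->
  exists s : seq 'rV[R]_n, all (fun c => c != 0) s /\
    A = foldr (fun c B => refl c *m B) 1%:M s.
Proof.
move=> AA.
have dotA (B : 'M[R]_n) u v : B *m B^T = 1%:M -> dot (u *m B^T) (v *m B^T) = dot u v.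
  move=> BB; rewrite /dot trmx_mul trmxK mulmxA -(mulmxA u).
  by rewrite (mulmx1C BB) mulmx1.
suff down m : (m <= n)%N -> forall B : 'M[R]_n, B *m B^T = 1%:M ->
    fixes_from m B -> exists s : seq 'rV[R]_n, all (fun c => c != 0) s /\
    B = foldr (fun c B => refl c *m B) 1%:M s.
  by apply: (down n) => // i; rewrite leqNgt ltn_ord.
elim: m => [|m IHm] mn B BB fB.
  exists [::]; split => //=; apply: trmx_inj; rewrite trmx1.
  by apply/row_matrixP => i; rewrite !rowE mulmx1 fB.
pose i0 := Ordinal mn; pose e : 'rV[R]_n := delta_mx 0 i0.
pose v := e *m B^T.
have v1 : sqnorm v = 1 by rewrite -dotvv dotA// dotvv sqnorm_delta.
have [ve|ve] := eqVneq v e.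
  apply: (IHm (ltnW mn)) => // i; rewrite leq_eqVlt => /predU1P[mi|]; last exact: fB.
  by rewrite (_ : i = i0); [exact: ve|apply/val_inj].
have c0 : v - e != 0 by rewrite subr_eq0.
have ec : v *m refl (v - e) = e.
  have e1 : sqnorm e = 1 by exact: sqnorm_delta.
  move: c0; rewrite -sqnorm_eq0 mul_refl sqnormB v1 e1 => c0.
  rewrite dotDr dotNr dotvv v1 (_ : _ / _ = 1); first by rewrite scale1r subKr.
  by field; move: c0; rewrite (_ : 1 - 2 * dot v e + 1 = 2 - 2 * dot v e)//; ring.
have ci (i : 'I_n) : (m.+1 <= i)%N -> (v - e) 0 i = 0.
  move=> mi; have ei : e 0 i = 0.
    by rewrite delta_entry; case: eqP => // ii; rewrite ii ltnn in mi.
  have vi : v 0 i = 0 by rewrite -dot_delta -(fB i mi) dotA// dot_delta.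
  by rewrite mxE vi add0r mxE ei oppr0.
have [s [s0 sE]] : exists s : seq 'rV[R]_n, all (fun c => c != 0) s /\
    refl (v - e) *m B = foldr (fun c B => refl c *m B) 1%:M s.
  apply: (IHm (ltnW mn)).
    by rewrite trmx_mul refl_sym mulmxA -(mulmxA _ B) BB mulmx1 refl_refl.
  move=> i; rewrite leq_eqVlt trmx_mul refl_sym mulmxA => /predU1P[mi|mi].
    by rewrite (_ : i = i0); [exact: ec|apply/val_inj].
  by rewrite fB// refl_fix// ci.
exists (v - e :: s); rewrite /= c0; split => //.
by rewrite -sE mulmxA refl_refl// mul1mx.
Qed.

Lemma det_refls n (s : seq 'rV[R]_n) : all (fun c => c != 0) s ->
  \det (foldr (fun c B => refl c *m B) 1%:M s) = (-1) ^+ size s.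
Proof.
elim: s => [|c s IHs] /=; first by rewrite det1 expr0.
by move=> /andP[c0 s0]; rewrite det_mulmx det_refl// IHs// exprS.
Qed.

(** The determinant counts reflections modulo 2, so they come in pairs. *)
Lemma SO_ind n (P : 'M[R]_n -> Prop) : P 1%:M ->
  (forall a b A, a != 0 -> b != 0 -> P A -> P (refl a *m refl b *m A)) ->
  forall A, SO R n A -> P A.
Proof.
move=> P1 PM A [AA dA]; have [s [s0 sE]] := orthogonal_reflections AA.
have : ~~ odd (size s).
  have := det_refls s0; rewrite -sE dA -signr_odd; case: odd => //= /eqP.
  by rewrite expr1 -subr_eq0 opprK (_ : 1 + 1 = 2%:R)// pnatr_eq0.
rewrite {}sE {dA AA A}; move: {2}(size s) (leqnn (size s)) => N.
elim: N s s0 => [|N IHN] [|a [|b s]] //= /and3P[a0 b0 s0] sN.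
by rewrite negbK => os; rewrite mulmxA; apply: PM => //; apply: IHN => //; lia.
Qed.

End fixing_basis_vectors.

(** * Rotations of R^4 as quaternionic multiplications *)

Section quaternion_rotations.
Variable R : realType.
Local Notation H := 'rV[R]_4.
Implicit Types (p q x a b : H) (A B : 'M[R]_4).

Definition sandwich p q x : H := qmul (qmul p x) q.

Lemma qmulDr p x y : qmul p (x + y) = qmul p x + qmul p y.
Proof. by apply/rowP; apply: ord4P; rewrite !mxE /= ?mxE /=; ring. Qed.

Lemma qmulDl p x y : qmul (x + y) p = qmul x p + qmul y p.
Proof. by apply/rowP; apply: ord4P; rewrite !mxE /= ?mxE /=; ring. Qed.

Lemma qmulZl s p q : qmul (s *: p) q = s *: qmul p q.
Proof. by apply/rowP; apply: ord4P; rewrite !mxE /= ?mxE /=; ring. Qed.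

Lemma sandwich_linear p q : linear (sandwich p q).
Proof.
by move=> s x y; rewrite /sandwich qmulDr qmulZr qmulDl qmulZl.
Qed.

HB.instance Definition _ p q :=
  GRing.isLinear.Build R H H _ (sandwich p q) (sandwich_linear p q).

Definition LRmx p q : 'M[R]_4 := (lin1_mx (sandwich p q))^T.

Lemma mul_LRmx x p q : x *m (LRmx p q)^T = qmul (qmul p x) q.
Proof. by rewrite trmxK mul_rV_lin1. Qed.

Lemma mx_act_inj A B : (forall x : H, x *m A^T = x *m B^T) -> A = B.
Proof.
by move=> AB; apply: trmx_inj; apply/row_matrixP => i; rewrite !rowE AB.
Qed.

Lemma qmul1 x : qmul x (qreal 1) = x.
Proof. by rewrite qmulqr scale1r. Qed.

Lemma qmul1l x : qmul (qreal 1) x = x.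
Proof. by rewrite qmulrq scale1r. Qed.

Lemma qconjM p q : qconj (qmul p q) = qmul (qconj q) (qconj p).
Proof. by apply/rowP; apply: ord4P; rewrite !mxE /= ?mxE /=; ring. Qed.

Lemma qconjK p : qconj (qconj p) = p.
Proof. by apply/rowP; apply: ord4P; rewrite !mxE /= ?mxE /= ?opprK. Qed.

Lemma qconjZ s p : qconj (s *: p) = s *: qconj p.
Proof. by apply/rowP; apply: ord4P; rewrite !mxE /= ?mxE /=; ring. Qed.

Lemma qmulV p : sqnorm p = 1 -> qmul p (qconj p) = qreal 1.
Proof. by rewrite qmulqV => ->. Qed.

Lemma qmulVr p : sqnorm p = 1 -> qmul (qconj p) p = qreal 1.
Proof. by rewrite qmulVq => ->. Qed.

Lemma LRmx1 : LRmx (qreal 1) (qreal 1) = 1%:M.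
Proof. by apply: mx_act_inj => x; rewrite mul_LRmx trmx1 mulmx1 qmul1 qmul1l. Qed.

Lemma LRmxM p q p' q' : LRmx p q *m LRmx p' q' = LRmx (qmul p p') (qmul q' q).
Proof.
by apply: mx_act_inj => x; rewrite trmx_mul mulmxA !mul_LRmx !qmulA.
Qed.

Lemma LRmxZ s t p q : LRmx (s *: p) (t *: q) = (s * t) *: LRmx p q.
Proof.
apply: mx_act_inj => x; rewrite linearZ /= -scalemxAr !mul_LRmx.
by rewrite qmulZr !qmulZl scalerA mulrC.
Qed.

(** For a unit quaternion a the reflection along a is x |-> - a (conj x) a. *)
Lemma mul_refl_quaternion a x : a != 0 ->
  x *m refl a = (- (sqnorm a)^-1) *: qmul (qmul a (qconj x)) a.
Proof.
rewrite -sqnorm_eq0 mul_refl dotE => a0.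
apply/rowP; apply: ord4P; rewrite !mxE /= ?mxE /=;
  move: a0; rewrite /sqnorm !sum4 => a0; field; exact: a0.
Qed.

(** A product of the reflections along the unit quaternions b, then a, is x
    |-> a conj (b (conj x) b) a = (a conj b) x (conj b a). *)
Lemma SO4_sandwich A : SO R 4 A ->
  exists p q, [/\ sqnorm p = 1, sqnorm q = 1 & A = LRmx p q].
Proof.
apply: (SO_ind (P := fun A => exists p q,
  [/\ sqnorm p = 1, sqnorm q = 1 & A = LRmx p q])).
  by exists (qreal 1), (qreal 1); rewrite sqnorm_qreal expr1n LRmx1.
move=> a b _ a0 b0 [p [q [p1 q1 ->]]].
pose r := (radius a * radius b)^-1.
have r1 : r ^+ 2 * (sqnorm a * sqnorm b) = 1.
  rewrite !sqnorm_radius -exprMn -exprMn /r mulVf ?expr1n//.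
  by rewrite mulf_neq0// radius_eq0.
exists (qmul (r *: qmul a (qconj b)) p), (qmul q (r *: qmul (qconj b) a)).
split.
- by rewrite sqnorm_qmul p1 mulr1 sqnormZ sqnorm_qmul sqnorm_qconj.
- by rewrite sqnorm_qmul q1 mul1r sqnormZ sqnorm_qmul sqnorm_qconj (mulrC (sqnorm b)).
apply: mx_act_inj => x; rewrite !trmx_mul !refl_sym !mulmxA mul_LRmx.
rewrite (mul_refl_quaternion _ b0) (mul_refl_quaternion _ a0) mul_LRmx.
rewrite !qconjZ !qconjM !qconjK !(qmulZr, qmulZl) !scalerA !qmulA; congr (_ *: _).
move: r1; rewrite -sqnorm_eq0 in a0; rewrite -sqnorm_eq0 in b0.
move: (sqnorm a) (sqnorm b) a0 b0 => u v u0 v0 /(canRL (mulfK _)) rE.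
by rewrite -expr2 rE ?mulf_neq0//; field; rewrite ?u0 ?v0.
Qed.

Definition qI : H := \row_j [:: 0; 1; 0; 0]`_j.
Definition qJ : H := \row_j [:: 0; 0; 1; 0]`_j.
Definition qK : H := \row_j [:: 0; 0; 0; 1]`_j.

(** If p x q = p2 x q2 for all x, then r = conj p2 p and s = q conj q2 satisfy
    r x s = x. For x = 1 this gives s = conj r, so that r commutes with all x,
    and r is real of norm 1. *)
Lemma LRmx_unique p q p' q' : sqnorm p = 1 -> sqnorm q = 1 ->
  sqnorm p' = 1 -> sqnorm q' = 1 -> LRmx p q = LRmx p' q' ->
  [/\ dot p p' ^+ 2 = 1, p = dot p p' *: p' & q = dot p p' *: q'].
Proof.
move=> p1 q1 p'1 q'1 E.
have Ex x : qmul (qmul p x) q = qmul (qmul p' x) q' by rewrite -!mul_LRmx E.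
pose r := qmul (qconj p') p.
have r1 : sqnorm r = 1 by rewrite sqnorm_qmul sqnorm_qconj p1 p'1 mulr1.
pose s := qmul q (qconj q').
have rxs x : qmul (qmul r x) s = x.
  rewrite /r /s !qmulA -(qmulA (qconj p')) -(qmulA (qconj p')) Ex.
  rewrite -!qmulA qmulV// qmul1 !qmulA qmulVr// qmul1l.
  by [].
have sE : s = qconj r.
  by have := congr1 (qmul (qconj r)) (rxs (qreal 1)); rewrite !qmul1 qmulA qmulVr// qmul1l.
have comm x : qmul r x = qmul x r.
  by rewrite -{2}(rxs x) sE -qmulA qmulVr// qmul1.
have rd : r 0 0 = dot p p' by rewrite dotE sum4 !mxE /= ?mxE /=; ring.
have rE : r = qreal (r 0 0).
  move: r comm {r1 rxs sE rd} => r comm.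
  have /rowP cI := comm qI; have /rowP cJ := comm qJ.
  move: (cI 2) (cI 3) (cJ 3); rewrite !mxE /= ?mxE /= => c2 c3 c1.
  apply/rowP; apply: ord4P; rewrite !mxE //=; lra.
have pE : p = dot p p' *: p'.
  by rewrite -rd -qmulqr -rE /r qmulA qmulV// qmul1l.
split => //.
- by rewrite -rd -sqnorm_qreal -rE.
- have : q = qmul s q' by rewrite /s -qmulA qmulVr// qmul1.
  move=> ->; rewrite sE rE -rd (_ : qconj (qreal _) = qreal (r 0 0)) ?qmulrq//.
  by rewrite rE; move: (r 0 0) => t; apply/rowP; apply: ord4P; rewrite !mxE /= ?mxE /= ?oppr0.
Qed.

(** The sum of A(e) conj(e) over the basis e = 1, i, j, k. For A x = p x q it
    equals 4 Re(q) p, as the sum of e q conj(e) is 4 Re(q); so p can be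
    recovered from A, continuously, as long as q is not purely imaginary. *)
Definition left_factor A : H :=
  qreal 1 *m A^T + qmul (qI *m A^T) (qconj qI) +
  qmul (qJ *m A^T) (qconj qJ) + qmul (qK *m A^T) (qconj qK).

Lemma left_factorE p q : left_factor (LRmx p q) = (4 * q 0 0) *: p.
Proof.
have trace : q + qmul (qmul qI q) (qconj qI) + qmul (qmul qJ q) (qconj qJ) +
    qmul (qmul qK q) (qconj qK) = qreal (4 * q 0 0).
  have LI x : qmul qI x = \row_j [:: - x 0 1; x 0 0; - x 0 3; x 0 2]`_j.
    by apply/rowP; apply: ord4P; rewrite !mxE /= ?mxE /=; ring.
  have LJ x : qmul qJ x = \row_j [:: - x 0 2; x 0 3; x 0 0; - x 0 1]`_j.
    by apply/rowP; apply: ord4P; rewrite !mxE /= ?mxE /=; ring.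
  have LK x : qmul qK x = \row_j [:: - x 0 3; - x 0 2; x 0 1; x 0 0]`_j.
    by apply/rowP; apply: ord4P; rewrite !mxE /= ?mxE /=; ring.
  have RI x : qmul x (qconj qI) = \row_j [:: x 0 1; - x 0 0; - x 0 3; x 0 2]`_j.
    by apply/rowP; apply: ord4P; rewrite !mxE /= ?mxE /=; ring.
  have RJ x : qmul x (qconj qJ) = \row_j [:: x 0 2; x 0 3; - x 0 0; - x 0 1]`_j.
    by apply/rowP; apply: ord4P; rewrite !mxE /= ?mxE /=; ring.
  have RK x : qmul x (qconj qK) = \row_j [:: x 0 3; - x 0 2; x 0 1; - x 0 0]`_j.
    by apply/rowP; apply: ord4P; rewrite !mxE /= ?mxE /=; ring.
  rewrite LI LJ LK RI RJ RK.
  by apply/rowP; apply: ord4P; rewrite !mxE /=; ring.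
rewrite -qmulqr -trace !qmulDr /left_factor !mul_LRmx -!qmulA.
by rewrite qmul1l.
Qed.

Lemma left_factor_continuous (X : topologicalType) (f : X -> 'M[R]_4) :
  continuous f -> continuous (fun z => left_factor (f z)).
Proof.
move=> cf.
have c (u : H) : continuous (fun z => u *m (f z)^T).
  by apply: mulmx_continuous; [exact: cst_continuous|exact: trmx_continuous].
have add (g h : X -> H) : continuous g -> continuous h ->
    continuous (fun z => g z + h z).
  by move=> cg ch z; apply: (@continuousD _ _ _ g h); [exact: cg|exact: ch].
have cq (u v : H) : continuous (fun z => qmul (u *m (f z)^T) v).
  by apply: qmul_continuous; [exact: c|exact: cst_continuous].
rewrite /left_factor; apply: (add _ _ _ (cq _ _)); apply: (add _ _ _ (cq _ _)).
exact: (add _ _ (c _) (cq _ _)).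
Qed.

Definition right_factor A : H :=
  qmul (qconj (val (direction (left_factor A)))) (qreal 1 *m A^T).

(** A section over the open set where left_factor does not vanish of the two-
    fold covering S^3 x S^3 -> SO(4); this set contains 1. *)
Lemma local_factorization A : SO R 4 A -> left_factor A != 0 ->
  A = LRmx (val (direction (left_factor A))) (right_factor A) /\
  sqnorm (right_factor A) = 1.
Proof.
move=> /SO4_sandwich[p [q [p1 q1 ->]]] S0.
rewrite /right_factor mul_LRmx qmul1 val_direction//.
move: S0; rewrite left_factorE => S0.
have q0 : 4 * q 0 0 != 0 by move: S0; rewrite scaler_eq0 negb_or => /andP[].
pose s := (radius ((4 * q 0 0) *: p))^-1 * (4 * q 0 0).
have s1 : s ^+ 2 = 1.
  rewrite /s exprMn exprVn -sqnorm_radius sqnormZ p1 mulr1 mulVf//.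
  by rewrite expf_neq0.
rewrite scalerA -/s qconjZ qmulZl qmulA qmulVr// qmul1l LRmxZ -expr2 s1 scale1r.
by rewrite sqnormZ s1 q1 mulr1.
Qed.

End quaternion_rotations.

(** * Lifting families of rotations to pairs of quaternions *)

Lemma compact_set_type (X : topologicalType) (A : set X) :
  compact A -> compact [set: A].
Proof.
move=> cA F PF _.
have FA : (val @ F) A.
  by apply: (@filterS _ F _ setT); [move=> a _; exact: set_valP a|exact: filterT].
have [a [Aa cl]] := cA _ (fmap_proper_filter val PF) FA.
exists (SigSub (mem_set Aa)); split => // U V FU [W [[W' oW' <-] W'a WV]].
have [x [[b Ub <-] W'b]] : [set val b | b in U] `&` W' !=set0.
  apply: cl; last exact: open_nbhs_nbhs.
  by apply: (@filterS _ F _ U) => // b Ub; exists b.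
by exists b; split => //; exact: WV.
Qed.

Lemma compact_usphere (R : realType) n : compact [set: usphere R n].
Proof.
apply: compact_set_type; apply: udisc_compact; first exact: usphere_udisc.
exact: usphere_closed.
Qed.

Section lifting.
Variable R : realType.
Local Notation H := 'rV[R]_4.

Lemma qconj_continuous (X : topologicalType) (f : X -> H) :
  continuous f -> continuous (fun x => qconj (f x)).
Proof.
move=> cf; apply: mx_continuous => i j; rewrite (ord1 i) {i}.
have cj j0 : continuous (fun x => f x 0 j0) by exact: entry_continuous.
have cN (g : X -> R) : continuous g -> continuous (fun x => - g x).
  by move=> cg x; apply: (@continuousN _ _ _ g); exact: cg.
by move: j; apply: ord4P; [apply: (eq_continuous _ (cj 0))
  |apply: (eq_continuous _ (cN _ (cj 1)))|apply: (eq_continuous _ (cN _ (cj 2)))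
  |apply: (eq_continuous _ (cN _ (cj 3)))] => x; rewrite mxE.
Qed.

Section lifting_homotopies.
Variables (X : topologicalType) (B : X * R -> 'M[R]_4).
Hypothesis X_compact : compact [set: X].
Hypothesis B_continuous : continuous B.
Hypothesis B_SO : forall p, SO R 4 (B p).

(** The increment at s = t is 1, where left_factor does not vanish;
    compactness gives a common subdivision for all x. *)
Lemma small_increments : exists N : nat, forall x s t,
  0 <= s <= 1 -> 0 <= t <= 1 -> `|s - t| <= N.+1%:R^-1 ->
  left_factor (B (x, t) *m (B (x, s))^T) != 0.
Proof.
pose G (q : X * R * R) := left_factor (B (q.1.1, q.2) *m (B q.1)^T).
have cG : continuous G.
  apply: left_factor_continuous; apply: mulmx_continuous.
    apply: comp_continuous B_continuous.
    apply: pair_continuous; last exact: snd_continuous.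
    by apply: comp_continuous; exact: fst_continuous.
  apply: trmx_continuous; apply: comp_continuous B_continuous.
  exact: fst_continuous.
have K : compact ([set: X] `*` `[0 : R, 1]).
  by apply: compact_setX => //; exact: segment_compact.
pose P (d : R) (xs : X * R) := forall t, `|xs.2 - t| <= d -> G (xs, t) != 0.
have /= : \forall d \near (0 : R), [set: X] `*` `[0 : R, 1] `<=` P d.
  apply: (iffLR (compact_near_coveringP _) K R (nbhs (0 : R)) P) => -[x0 s0] _.
  have G0 : G (x0, s0, s0) != 0.
    rewrite /G /=; have [-> _] := B_SO (x0, s0).
    by rewrite -LRmx1 left_factorE scaler_eq0 -sqnorm_eq0 sqnorm_qreal expr1n
      mxE /= mulr1 oner_eq0 pnatr_eq0.
  have r0 : 0 < radius (G (x0, s0, s0)) by rewrite lt_neqAle eq_sym radius_eq0 G0 radius_ge0.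
  have cr : continuous (fun q => radius (G q)).
    by apply: (comp_continuous cG); exact: radius_continuous.
  have : \forall q \near (x0, s0, s0), 0 < radius (G q).
    exact: cvgr_gt (radius (G (x0, s0, s0))) (cr (x0, s0, s0)) 0 r0.
  move=> [[U V] /= [[[U1 U2] /= [U1x U2s] U12] /nbhs_ballP[e /= e0 eV]] UV].
  exists (U1 `*` (U2 `&` ball s0 (e / 2)), ball 0 (e / 2)) => /=.
    split; last by apply: nbhsx_ballx; rewrite divr_gt0.
    exists (U1, U2 `&` ball s0 (e / 2)) => //=; split => //; apply: filterI => //.
    by apply: nbhsx_ballx; rewrite divr_gt0.
  move=> [[x s] d] /= [[U1x' [U2s' s0s]] d0] t /= st.
  rewrite -radius_eq0 gt_eqF//; apply: (UV (x, s, t)); split => /=.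
    exact: (U12 (x, s)).
  apply: eV; move: s0s d0; rewrite -!ball_normE /= => s0s d0.
  have := ler_distD s s0 t; have := ler_norm d.
  by rewrite sub0r normrN in d0; move: st d0 s0s => /=; lra.
move=> /nbhs_ballP[e /= e0 eP].
pose N := Num.truncn e^-1; exists N => x s t s01 t01 st.
have N0 : 0 < N.+1%:R :> R by rewrite ltr0n.
have eN : N.+1%:R^-1 < e.
  by rewrite -[e]invrK ltf_pV2 ?posrE ?invr_gt0//; exact: truncnS_gt.
apply: (eP N.+1%:R^-1 _ (x, s) _ t st).
  by rewrite -ball_normE /= sub0r normrN gtr0_norm ?invr_gt0.
by split => //=; rewrite in_itv.
Qed.

(** Along a fine subdivision of [0, 1] all increments B (x, t) B (x, s)^-1 lie
    in the domain of the local section; their lifts are multiplied, starting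
    from a lift of the constant value at time 0. *)
Lemma lift_homotopy (A0 : 'M[R]_4) : (forall x, B (x, 0) = A0) ->
  exists P Q : X -> H, [/\ continuous P, continuous Q,
    forall x, sqnorm (P x) = 1, forall x, sqnorm (Q x) = 1 &
    forall x, B (x, 1) = LRmx (P x) (Q x)].
Proof.
move=> B0; have [N NP] := small_increments.
have N0 : 0 < N.+1%:R :> R by rewrite ltr0n.
suff lift i : (i <= N.+1)%N -> exists P Q : X -> H, [/\ continuous P, continuous Q,
    forall x, sqnorm (P x) = 1, forall x, sqnorm (Q x) = 1 &
    forall x, B (x, i%:R / N.+1%:R) = LRmx (P x) (Q x)].
  by have := lift N.+1 (leqnn _); rewrite mulfV// gt_eqF.
elim: i => [_|i IHi iN].
  (* A point of X is needed to know that A0 is a rotation. *)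
  have [x0|noX] := pselect (exists x0 : X, True); last first.
    exists (fun=> 0), (fun=> 0); split; first exact: cst_continuous.
    - exact: cst_continuous.
    - by move=> x; exfalso; apply: noX; exists x.
    - by move=> x; exfalso; apply: noX; exists x.
    - by move=> x; exfalso; apply: noX; exists x.
  case: x0 => x0 _; have := B_SO (x0, 0); rewrite B0 => /SO4_sandwich[p [q [p1 q1 E]]].
  exists (fun=> p), (fun=> q); split => //; try exact: cst_continuous.
  by move=> x; rewrite mul0r B0.
have [P [Q [cP cQ P1 Q1 PQ]]] := IHi (ltnW iN).
pose s : R := i%:R / N.+1%:R; pose t : R := i.+1%:R / N.+1%:R.
have t01 : 0 <= t <= 1.
  by rewrite /t divr_ge0 ?ler0n//= ler_pdivrMr// mul1r ler_nat.
have s01 : 0 <= s <= 1.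
  by rewrite /s divr_ge0 ?ler0n//= ler_pdivrMr// mul1r ler_nat ltnW.
have st : `|s - t| <= N.+1%:R^-1.
  by rewrite /s /t -mulrBl -natr1 opprD addrA subrr add0r mulN1r normrN
    gtr0_norm ?invr_gt0.
pose C x := B (x, t) *m (B (x, s))^T.
have C0 x : left_factor (C x) != 0 by exact: NP.
have CSO x : SO R 4 (C x).
  apply: SO_mul => //; have [SS dS] := B_SO (x, s).
  by split; [rewrite trmxK; exact: mulmx1C|rewrite det_tr].
have cB u : continuous (fun x => B (x, u)).
  apply: (comp_continuous (f := fun x : X => (x, u))) B_continuous.
  by apply: pair_continuous; [exact: id_continuous|exact: cst_continuous].
have cC : continuous C by apply: mulmx_continuous => //; exact: trmx_continuous.
have cD : continuous (fun x => val (direction (left_factor (C x)))).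
  apply: comp_continuous; last exact: set_val_continuous.
  move=> x; apply: (@continuous_comp _ _ _ (fun x => left_factor (C x))).
    exact: left_factor_continuous.
  exact: direction_continuous.
have cE : continuous (fun x => right_factor (C x)).
  apply: qmul_continuous; last first.
    by apply: mulmx_continuous; [exact: cst_continuous|exact: trmx_continuous].
  exact: qconj_continuous.
exists (fun x => qmul (val (direction (left_factor (C x)))) (P x)).
exists (fun x => qmul (Q x) (right_factor (C x))); split.
- exact: qmul_continuous.
- exact: qmul_continuous.
- by move=> x; rewrite sqnorm_qmul P1 (set_valP (direction _)) mulr1.
- by move=> x; rewrite sqnorm_qmul Q1; have [_ ->] := local_factorization (CSO x) (C0 x); rewrite mulr1.
- move=> x; rewrite -LRmxM -PQ; have [<- _] := local_factorization (CSO x) (C0 x).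
  have [SS _] := B_SO (x, s).
  by rewrite /C -mulmxA (mulmx1C SS) mulmx1.
Qed.

End lifting_homotopies.
End lifting.

Section gluing_lifts.
Variable R : realType.
Local Notation H := 'rV[R]_4.
Local Notation S3 := (usphere R 4).

(** The hemisphere centred at e contracts to e along normalized segments.
    Folding the sphere onto the hemisphere turns this contraction into a
    homotopy defined on the whole sphere, to which lift_homotopy applies. *)
Lemma lift_on_hemisphere (A : S3 -> 'M[R]_4) (e : H) : sqnorm e = 1 ->
  continuous A -> (forall x, SO R 4 (A x)) ->
  exists P Q : S3 -> H, [/\ continuous P, continuous Q,
    forall x, sqnorm (P x) = 1, forall x, sqnorm (Q x) = 1 &
    forall x, 0 <= dot (val x) e -> A x = LRmx (P x) (Q x)].
Proof.
move=> e1 cA ASO.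
pose d (x : S3) := dot (val x) e.
pose fold (x : S3) : H := val x + (2 * Num.max 0 (- d x)) *: e.
have fold_e x : dot (fold x) e = `|d x|.
  rewrite dotDl dotZl dotvv e1 mulr1 -/(d x).
  have [d0|d0] := leP 0 (d x).
    by rewrite (max_idPl _) ?oppr_le0// mulr0 addr0 ger0_norm.
  by rewrite (max_idPr _) ?oppr_ge0 ?ltW// ltr0_norm//; ring.
have fold1 x : sqnorm (fold x) = 1.
  rewrite -dotvv dotDl !dotDr !dotZl !dotZr !dotvv e1 (dotC e) -/(d x).
  rewrite (set_valP x : sqnorm (val x) = 1).
  have [d0|d0] := leP 0 (d x).
    by rewrite (max_idPl _) ?oppr_le0//; ring.
  by rewrite (max_idPr _) ?oppr_ge0 ?ltW//; ring.
have fold_id x : 0 <= d x -> fold x = val x.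
  by move=> d0; rewrite /fold (max_idPl _) ?oppr_le0// mulr0 scale0r addr0.
pose c (xs : S3 * R) : H := (1 - clamp xs.2) *: e + clamp xs.2 *: fold xs.1.
have c0 xs : c xs != 0.
  apply/eqP => cE; have /andP[s0 s1] := clamp01 xs.2.
  have : dot (c xs) e = 0 by rewrite cE /dot mul0mx mxE.
  rewrite dotDl !dotZl dotvv e1 fold_e mulr1 => E.
  have : 0 <= clamp xs.2 * `|d xs.1| by rewrite mulr_ge0.
  move=> sd; have s1E : clamp xs.2 = 1 by lra.
  move: cE; rewrite /c s1E subrr scale0r add0r scale1r => /eqP.
  by rewrite -sqnorm_eq0 fold1 oner_eq0.
have cv : continuous (fun x : S3 => val x) by exact: set_val_continuous.
have cd : continuous d.
  apply: (@entry_continuous R S3 1 1 (fun x => val x *m e^T)).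
  by apply: mulmx_continuous => //; exact: cst_continuous.
have cscale (X : topologicalType) (f : X -> R) (g : X -> H) :
    continuous f -> continuous g -> continuous (fun z => f z *: g z).
  by move=> cf cg z; apply: (@continuousZ _ _ _ f g); [exact: cf|exact: cg].
have cadd (X : topologicalType) (f g : X -> H) :
    continuous f -> continuous g -> continuous (fun z => f z + g z).
  by move=> cf cg z; apply: (@continuousD _ _ _ f g); [exact: cf|exact: cg].
have cfold : continuous fold.
  apply: (cadd _ _ _ cv); apply: cscale; last exact: cst_continuous.
  apply: mulr_continuous; first exact: cst_continuous.
  move=> x; apply: (@continuous_max R _ (cst 0) (fun x => - d x)).
    exact: cst_continuous.
  by apply: (@continuousN _ _ _ d); exact: cd.
have cs : continuous (fun xs : S3 * R => clamp xs.2).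
  by apply: comp_continuous; [exact: snd_continuous|exact: clamp_continuous].
have cc : continuous c.
  apply: cadd.
    apply: cscale; last exact: cst_continuous.
    by apply: subr_continuous => //; exact: cst_continuous.
  apply: (cscale _ _ _ cs).
  exact: (comp_continuous (@fst_continuous S3 R) cfold).
pose B xs := A (direction (c xs)).
have cB : continuous B.
  apply: (comp_continuous _ cA) => xs.
  apply: (@continuous_comp _ _ _ c); first exact: cc.
  exact: direction_continuous.
have B0 x : B (x, 0) = A (direction e).
  by rewrite /B /c /= clamp_le0// subr0 scale1r scale0r addr0.
have [P [Q [cP cQ P1 Q1 PQ]]] :=
  lift_homotopy (@compact_usphere R 4) cB (fun xs => ASO _) B0.
exists P, Q; split => // x dx.
by rewrite -PQ /B /c /= clamp_ge1// subrr scale0r add0r scale1r fold_id// direction_usphere.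
Qed.

(** The equator is a sphere of dimension 2, hence connected: points which are
    not antipodal are joined by a normalized segment, and antipodal points are
    compared through a third one. *)
Lemma equator_sign (f : S3 -> R) : continuous f ->
  (forall x : S3, val x 0 0 = 0 -> f x ^+ 2 = 1) ->
  exists e, e ^+ 2 = 1 /\ forall x : S3, val x 0 0 = 0 -> f x = e.
Proof.
move=> cf f1.
have path (x y : S3) : val x 0 0 = 0 -> val y 0 0 = 0 -> val x + val y != 0 -> f x = f y.
  move=> x0 y0 xy.
  pose c (t : R) : H := (1 - clamp t) *: val x + clamp t *: val y.
  have c0 t : c t != 0.
    apply/eqP => cE; have /andP[t0 t1] := clamp01 t; set s := clamp t in cE t0 t1.
    have E : (1 - s) *: val x = (- s) *: val y.
      by move/eqP: cE; rewrite /c addr_eq0 -scaleNr => /eqP.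
    have := congr1 (@sqnorm R 4) E; rewrite !sqnormZ.
    rewrite (set_valP x : sqnorm (val x) = 1) (set_valP y : sqnorm (val y) = 1).
    move=> sE; have s2 : s = 2^-1 by lra.
    have h0 : 2^-1 != 0 :> R by rewrite invr_eq0 pnatr_eq0.
    move/eqP: xy; apply; apply: (scalerI h0); rewrite scaler0 scalerDr -{1}s2.
    move: E; rewrite s2 (_ : 1 - 2^-1 = 2^-1 :> R); last lra.
    by move=> ->; rewrite scaleNr addNr.
  have cc : continuous c.
    move=> t; apply: (@continuousD _ _ _ (fun t => (1 - clamp t) *: val x)
      (fun t => clamp t *: val y)).
      apply: (@continuousZ _ _ _ (fun t => 1 - clamp t) (cst (val x))).
        by move: t; apply: subr_continuous; [exact: cst_continuous|exact: clamp_continuous].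
      exact: cst_continuous.
    apply: (@continuousZ _ _ _ (@clamp R) (cst (val y))).
      exact: clamp_continuous.
    exact: cst_continuous.
  pose g t := f (direction (c t)).
  have g0 : g 0 = f x.
    by rewrite /g /c clamp_le0// subr0 scale1r scale0r addr0 direction_usphere.
  have g1 : g 1 = f y.
    by rewrite /g /c clamp_ge1// subrr scale1r scale0r add0r direction_usphere.
  have gsq t : g t ^+ 2 = 1.
    by apply: f1; rewrite val_direction// !mxE x0 y0 !mulr0 addr0 mulr0.
  have cg : continuous g.
    apply: (comp_continuous _ cf) => t.
    apply: (@continuous_comp _ _ _ c); first exact: cc.
    exact: direction_continuous.
  have noroot t : g t != 0.
    by apply/eqP => gt; have := gsq t; rewrite gt expr0n /= => /eqP; rewrite eq_sym oner_eq0.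
  have := gsq 0; have := gsq 1; rewrite g0 g1 => /eqP; rewrite sqrf_eq1 => fy.
  move=> /eqP; rewrite sqrf_eq1 => fx.
  have [//|fxy] := eqVneq (f x) (f y).
  have [t _ gt] : exists2 t, t \in `[0, 1]%R & g t = 0.
    apply: IVT => //; first exact: continuous_subspaceT.
    rewrite g0 g1.
    by case/orP: fx fxy => /eqP ->; case/orP: fy => /eqP ->; rewrite ?eqxx// => _;
       rewrite ge_min le_max; lra.
  by move: (noroot t); rewrite gt eqxx.
pose b (i : 'I_4) : S3 := direction (delta_mx 0 i).
have bE i : val (b i) = delta_mx 0 i.
  rewrite val_direction -?sqnorm_eq0 ?sqnorm_delta ?oner_eq0//.
  by rewrite /radius sqnorm_delta sqrtr1 invr1 scale1r.
have b0 i : i != 0 -> val (b i) 0 0 = 0.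
  by move=> i0; rewrite bE delta_entry eq_sym (negbTE i0).
exists (f (b 1)); split; first by apply: f1; exact: b0.
move=> x x0; have [xb|xb] := eqVneq (val x + val (b 1)) 0; last by apply: path => //; exact: b0.
(* If x = - b 1, then b 2 is antipodal to neither x nor b 1. *)
have b12 (i j : 'I_4) s : i != j -> s *: val (b i) + val (b j) != 0.
  move=> ij; apply/eqP => /rowP /(_ j); rewrite !bE mxE [X in X + _]mxE [RHS]mxE.
  rewrite !delta_entry eqxx (eq_sym j) (negbTE ij) mulr0 add0r => /eqP.
  by rewrite oner_eq0.
rewrite (path x (b 2)) ?b0//; last first.
  have -> : val x = -1 *: val (b 1) by rewrite scaleN1r; apply/eqP; rewrite -addr_eq0 xb.
  exact: b12.
by apply: path; rewrite ?b0// -[val (b 2)]scale1r; exact: b12.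
Qed.

(** The lifts on the two hemispheres centred at 1 and -1 agree up to sign on
    the equator, and this sign is constant. *)
Lemma lift_SO4 (A : S3 -> 'M[R]_4) : continuous A -> (forall x, SO R 4 (A x)) ->
  exists P Q : S3 -> H, [/\ continuous P, continuous Q,
    forall x, sqnorm (P x) = 1, forall x, sqnorm (Q x) = 1 &
    forall x, A x = LRmx (P x) (Q x)].
Proof.
move=> cA ASO.
have e1 : sqnorm (qreal (1 : R)) = 1 by rewrite sqnorm_qreal expr1n.
have e1' : sqnorm (qreal (- 1 : R)) = 1 by rewrite sqnorm_qreal sqrrN expr1n.
have dotr (x : H) s : dot x (qreal s) = s * x 0 0.
  by rewrite dotE sum4 !mxE /=; ring.
have [P [Q [cP cQ P1 Q1 PQ]]] := lift_on_hemisphere e1 cA ASO.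
have [P' [Q' [cP' cQ' P1' Q1' PQ']]] := lift_on_hemisphere e1' cA ASO.
pose f x := dot (P x) (P' x).
have cf : continuous f.
  apply: (@entry_continuous R S3 1 1 (fun x => P x *m (P' x)^T)).
  by apply: mulmx_continuous => //; exact: trmx_continuous.
have equator (x : S3) : val x 0 0 = 0 ->
    [/\ f x ^+ 2 = 1, P x = f x *: P' x & Q x = f x *: Q' x].
  move=> x0; apply: LRmx_unique => //; rewrite -PQ ?PQ' ?dotr ?x0 ?mulr0//.
have [|e [ee fe]] := equator_sign cf _; first by move=> x /equator[].
have pastes (g g' : S3 -> H) : continuous g -> continuous g' ->
    (forall x : S3, val x 0 0 = 0 -> g x = e *: g' x) ->
    continuous (fun x : S3 => if 0 <= val x 0 0 then g x else e *: g' x).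
  move=> cg cg' gg'; apply: (paste_continuous (alpha := cst 0)).
  - exact: cst_continuous.
  - by apply: entry_continuous; exact: set_val_continuous.
  - by move=> x _; exact: cg.
  - move=> x _; apply: (@continuousZ _ _ _ (cst e) g'); first exact: cst_continuous.
    exact: cg'.
  - by move=> x /= /esym; exact: gg'.
exists (fun x : S3 => if 0 <= val x 0 0 then P x else e *: P' x).
exists (fun x : S3 => if 0 <= val x 0 0 then Q x else e *: Q' x).
split.
- by apply: pastes => // x x0; have [_ PE _] := equator x x0; rewrite PE fe.
- by apply: pastes => // x x0; have [_ _ QE] := equator x x0; rewrite QE fe.
- by move=> x; case: ifP => _ //; rewrite sqnormZ ee mul1r.
- by move=> x; case: ifP => _ //; rewrite sqnormZ ee mul1r.
- move=> x; case: leP => x0; first by apply: PQ; rewrite dotr mul1r.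
  by rewrite LRmxZ -expr2 ee scale1r; apply: PQ'; rewrite dotr; lra.
Qed.

End gluing_lifts.

(** * Left multiplications *)

Lemma index_allpairs_pair (T1 T2 : eqType) (s : seq T1) (t : seq T2) x y :
  x \in s -> y \in t ->
  index (x, y) [seq (a, b) | a <- s, b <- t] = (index x s * size t + index y t)%N.
Proof.
move=> + yt; elim: s => //= a s IHs; rewrite inE index_cat.
have [->|xa] := eqVneq x a.
  by rewrite (map_f (pair a) yt) index_map// => ? ? [].
move=> /= xs.
have /negbTE -> : (x, y) \notin [seq (a, b) | b <- t].
  by apply/mapP => -[b _ [xa' _]]; rewrite xa' eqxx in xa.
by rewrite IHs// size_map mulSn addnA.
Qed.

(** Rows are stored one after the other, so the first of the two quaternions
    of a vector of R^8 consists of the first four coordinates. *)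
Lemma val_mxvec_index m n (i : 'I_m) (j : 'I_n) :
  mxvec_index i j = (i * n + j)%N :> nat.
Proof.
rewrite /mxvec_index /=; set x := (i, j).
have -> : enum_rank x = index x (enum {: 'I_m * 'I_n}) :> nat.
  by rewrite -{2}(nth_enum_rank x x) index_uniq ?enum_uniq// -cardE ltn_ord.
rewrite enumT [Finite.enum]unlock /= /prod_enum index_allpairs_pair ?mem_enum//.
by rewrite size_enum_ord !index_enum_ord.
Qed.

Section left_multiplications.
Variable R : realType.
Local Notation H := 'rV[R]_4.
Implicit Types (p q x y u : H).

Lemma dot_qmull p x y : dot x (qmul p y) = dot (qmul (qconj p) x) y.
Proof. by rewrite !dotE !sum4 !mxE /= ?mxE /=; ring. Qed.

Lemma dot_qmulr q x y : dot x (qmul y q) = dot (qmul x (qconj q)) y.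
Proof. by rewrite !dotE !sum4 !mxE /= ?mxE /=; ring. Qed.

Lemma trmx_LRmx p q : (LRmx p q)^T = LRmx (qconj p) (qconj q).
Proof.
apply: mx_act_inj => x; rewrite trmxK mul_LRmx; apply/rowP => i.
rewrite -!dot_delta; set y := delta_mx 0 i.
transitivity (dot x (y *m (LRmx p q)^T)).
  by rewrite /dot trmx_mul trmxK mulmxA.
by rewrite mul_LRmx dot_qmulr dot_qmull qmulA.
Qed.

Lemma LRmx_orthogonal p q : sqnorm p = 1 -> sqnorm q = 1 ->
  LRmx p q *m (LRmx p q)^T = 1%:M.
Proof. by move=> p1 q1; rewrite trmx_LRmx LRmxM qmulV// qmulVr// LRmx1. Qed.

(** The determinant is 1 because u = s s for a unit quaternion s, namely 1 + u
    normalized: indeed u conj(1 + u) = 1 + u. The case u = -1, where 1 + u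
    vanishes, is a scalar matrix of even size. *)
Lemma SO_left_mul u : sqnorm u = 1 -> SO R 4 (LRmx u (qreal 1)).
Proof.
have q1 : sqnorm (qreal (1 : R)) = 1 by rewrite sqnorm_qreal expr1n.
move=> u1; split; first exact: LRmx_orthogonal.
have [u0|u0] := eqVneq (qreal 1 + u) 0.
  have -> : u = -1 *: qreal 1 by rewrite scaleN1r; apply/eqP; rewrite -addr_eq0 addrC u0.
  by rewrite -[X in LRmx _ X]scale1r LRmxZ LRmx1 detZ det1; ring.
pose s := (radius (qreal 1 + u))^-1 *: (qreal 1 + u).
have r0 : radius (qreal 1 + u) != 0 by rewrite radius_eq0.
have s1 : sqnorm s = 1 by rewrite sqnormZ sqnorm_radius exprVn mulVf// expf_neq0.
have uE : qreal 1 + u = qmul u (qconj (qreal 1 + u)).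
  have -> : qconj (qreal 1 + u) = qreal 1 + qconj u.
    by apply/rowP; apply: ord4P; rewrite !mxE /= ?mxE /=; ring.
  by rewrite qmulDr qmulV// qmul1 addrC.
have ss : qmul s s = u.
  have sq : qmul (qreal 1 + u) (qreal 1 + u) = sqnorm (qreal 1 + u) *: u.
    by rewrite [X in qmul X _]uE -qmulA qmulVq qmulqr.
  rewrite /s qmulZr qmulZl scalerA sq scalerA.
  by rewrite sqnorm_radius -expr2 -exprMn mulVf// expr1n scale1r.
rewrite -ss (_ : LRmx _ _ = LRmx s (qreal 1) *m LRmx s (qreal 1)); last first.
  by rewrite LRmxM qmul1.
by rewrite det_mulmx -{2}(det_tr (LRmx s _)) -det_mulmx LRmx_orthogonal// det1.
Qed.

Definition stab (B : 'M[R]_4) : 'M[R]_(4 + 4) := block_mx B 0 0 1%:M.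

Lemma stabM A B : stab (A *m B) = stab A *m stab B.
Proof. by rewrite /stab mulmx_block !mulmx0 !mul0mx !mulmx1 !addr0 add0r. Qed.

Lemma tr_stab B : (stab B)^T = stab B^T.
Proof. by rewrite /stab tr_block_mx !trmx0 trmx1. Qed.

Lemma SO_stab B : SO R (4 + 4) (stab B) <-> SO R 4 B.
Proof.
rewrite /SO /= tr_stab -stabM /stab det_ublock det1 mulr1.
split=> -[BB dB]; split => //; last by rewrite BB -scalar_mx_block.
move: BB; rewrite (scalar_mx_block 4 4 (1 : R)) => /(congr1 ulsubmx).
by rewrite !block_mxKul.
Qed.

Lemma fixes_from_stab (A : 'M[R]_(4 + 4)) : SO R (4 + 4) A -> fixes_from 4 A ->
  A = stab (ulsubmx A).
Proof.
move=> [AA _] fA.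
have colE (i : 'I_(4 + 4)) k : (4 <= i)%N -> A k i = (k == i)%:R.
  by move=> /fA /rowP /(_ k); rewrite -rowE !mxE eqxx.
have rowE' (i : 'I_(4 + 4)) k : (4 <= i)%N -> A i k = (k == i)%:R.
  move=> /fA E; have := congr1 (mulmx^~ A) E.
  rewrite -mulmxA (mulmx1C AA) mulmx1 => /rowP /(_ k).
  by rewrite -rowE !mxE eqxx /= => <-.
rewrite -{1}(submxK A) /stab; congr block_mx.
- by apply/matrixP => i k; rewrite !mxE colE ?leq_addr// eq_lrshift.
- by apply/matrixP => i k; rewrite !mxE rowE' ?leq_addr// eq_lrshift.
- by apply/matrixP => i k; rewrite !mxE colE ?leq_addr// eq_rshift.
Qed.

Lemma stab_continuous (X : topologicalType) (f : X -> 'M[R]_4) :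
  continuous f -> continuous (fun z => stab (f z)).
Proof.
move=> cf; apply: mx_continuous => i j.
case: (split_ordP i) => i' ->; case: (split_ordP j) => j' ->.
- apply: (@eq_continuous _ _ (fun z => f z i' j')) => [z|]; first by rewrite block_mxEul.
  exact: entry_continuous.
- apply: (@eq_continuous _ _ (cst 0)) => [z|]; last exact: cst_continuous.
  by rewrite block_mxEur mxE.
- apply: (@eq_continuous _ _ (cst 0)) => [z|]; last exact: cst_continuous.
  by rewrite block_mxEdl mxE.
- apply: (@eq_continuous _ _ (cst ((i' == j')%:R))) => [z|]; last exact: cst_continuous.
  by rewrite block_mxEdr mxE.
Qed.

Lemma LRmx_continuous (X : topologicalType) (P Q : X -> H) :
  continuous P -> continuous Q -> continuous (fun z => LRmx (P z) (Q z)).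
Proof.
move=> cP cQ; apply: mx_continuous => i j.
apply: (@eq_continuous _ _ (fun z => qmul (qmul (P z) (delta_mx 0 j)) (Q z) 0 i)) => [z|].
  by rewrite -mul_LRmx -rowE !mxE.
apply: entry_continuous; apply: qmul_continuous => //.
by apply: qmul_continuous => //; exact: cst_continuous.
Qed.

End left_multiplications.

(** * Exchanging right and left multiplications *)

Section right_to_left.
Variable R : realType.
Local Notation H := 'rV[R]_4.

Lemma sqnorm_row_mx m n (a : 'rV[R]_m) (b : 'rV[R]_n) :
  sqnorm (row_mx a b) = sqnorm a + sqnorm b.
Proof. by rewrite -!dotvv /dot tr_row_mx mul_row_col mxE. Qed.

Lemma refl_row_mx0 (a : H) : refl (row_mx a (0 : H)) = stab (refl a).
Proof.
rewrite /refl /stab tr_row_mx mul_col_row trmx0 !mul0mx mulmx0.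
rewrite sqnorm_row_mx (_ : sqnorm (0 : H) = 0) ?addr0; last first.
  by apply/eqP; rewrite sqnorm_eq0.
rewrite (scalar_mx_block 4 4 (1 : R)) scale_block_mx opp_block_mx add_block_mx.
by rewrite !scaler0 !oppr0 !addr0.
Qed.

Lemma refl_row_0mx (b : H) :
  refl (row_mx (0 : H) b) = block_mx 1%:M 0 0 (refl b).
Proof.
rewrite /refl tr_row_mx mul_col_row trmx0 !mul0mx mulmx0.
rewrite sqnorm_row_mx (_ : sqnorm (0 : H) = 0) ?add0r; last first.
  by apply/eqP; rewrite sqnorm_eq0.
rewrite (scalar_mx_block 4 4 (1 : R)) scale_block_mx opp_block_mx add_block_mx.
by rewrite !scaler0 !oppr0 !addr0.
Qed.

(** Conjugation changes the signs of i, j and k, so it is a product of three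
    reflections. *)
Definition conjmx : 'M[R]_4 := refl (qI R) *m refl (qJ R) *m refl (qK R).

Lemma sqnorm_units : [/\ sqnorm (qI R) = 1, sqnorm (qJ R) = 1 & sqnorm (qK R) = 1].
Proof. by rewrite /sqnorm !sum4 !mxE /= !expr2; split; ring. Qed.

Let reflI (x : H) : x *m refl (qI R) = \row_j [:: x 0 0; - x 0 1; x 0 2; x 0 3]`_j.
Proof.
have [I1 _ _] := sqnorm_units; rewrite mul_refl I1 divr1 dotE sum4.
by apply/rowP; apply: ord4P; rewrite !mxE /=; ring.
Qed.

Let reflJ (x : H) : x *m refl (qJ R) = \row_j [:: x 0 0; x 0 1; - x 0 2; x 0 3]`_j.
Proof.
have [_ J1 _] := sqnorm_units; rewrite mul_refl J1 divr1 dotE sum4.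
by apply/rowP; apply: ord4P; rewrite !mxE /=; ring.
Qed.

Let reflK (x : H) : x *m refl (qK R) = \row_j [:: x 0 0; x 0 1; x 0 2; - x 0 3]`_j.
Proof.
have [_ _ K1] := sqnorm_units; rewrite mul_refl K1 divr1 dotE sum4.
by apply/rowP; apply: ord4P; rewrite !mxE /=; ring.
Qed.

Lemma mul_conjmx (x : H) : x *m conjmx = qconj x.
Proof.
rewrite /conjmx !mulmxA reflI reflJ reflK.
by apply/rowP; apply: ord4P; rewrite !mxE /= ?mxE /=.
Qed.

Lemma mul_conjmxT (x : H) : x *m conjmx^T = qconj x.
Proof.
rewrite /conjmx !trmx_mul !refl_sym !mulmxA reflI reflJ reflK.
by apply/rowP; apply: ord4P; rewrite !mxE /= ?mxE /=.
Qed.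

Lemma conj_left_mul (q : H) :
  conjmx *m LRmx (qconj q) (qreal 1) *m conjmx^T = LRmx (qreal 1) q.
Proof.
move: conjmx mul_conjmx mul_conjmxT => K mulK mulKT.
apply: mx_act_inj => x; rewrite trmx_mul (trmx_mul K) trmxK !mulmxA mulK.
by rewrite !mul_LRmx mulKT qmul1 qmul1l qconjM !qconjK.
Qed.

(** A path in SO(8) from 1 to the rotation which is conjugation on the first
    copy of H and the reflection along 1 on the second one. Each of the two
    pairs of reflections starts with equal vectors, where the product is 1;
    one vector then moves from i to j, or from k to the unit of the second
    copy. *)
Definition turn (t : R) : 'M[R]_(4 + 4) :=
  refl (row_mx (qI R) (0 : H)) *m
  refl (row_mx ((1 - t) *: qI R + t *: qJ R) (0 : H)) *m
  (refl (row_mx (qK R) (0 : H)) *m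
   refl (row_mx ((1 - t) *: qK R) (t *: qreal 1))).

Let line0 (t : R) : (1 - t) ^+ 2 + t ^+ 2 != 0.
Proof.
rewrite gt_eqF// -[X in X < _]addr0.
have [->|t0] := eqVneq t 0; first by rewrite subr0 expr1n expr0n /= addr0 addr0 ltr01.
by rewrite ler_ltD ?sqr_ge0// exprn_even_gt0.
Qed.

Let turn_neq0 t : row_mx ((1 - t) *: qI R + t *: qJ R) (0 : H) != 0 /\
  row_mx ((1 - t) *: qK R) (t *: qreal 1) != 0.
Proof.
have l0 := line0 t.
have E1 : sqnorm ((1 - t) *: qI R + t *: qJ R) + sqnorm (0 : H) = (1 - t) ^+ 2 + t ^+ 2.
  by rewrite /sqnorm !sum4 !mxE /=; ring.
have E2 : sqnorm ((1 - t) *: qK R) + sqnorm (t *: qreal 1) = (1 - t) ^+ 2 + t ^+ 2.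
  by rewrite /sqnorm !sum4 !mxE /=; ring.
by rewrite -!sqnorm_eq0 !sqnorm_row_mx E1 E2.
Qed.

Let unit_neq0 : row_mx (qI R) (0 : H) != 0 /\ row_mx (qK R) (0 : H) != 0.
Proof.
have [I1 _ K1] := sqnorm_units.
have s0 : sqnorm (0 : H) = 0 by apply/eqP; rewrite sqnorm_eq0.
by rewrite -!sqnorm_eq0 !sqnorm_row_mx I1 K1 s0 addr0 oner_eq0.
Qed.

Lemma SO_turn t : SO R (4 + 4) (turn t).
Proof.
have [a b] := turn_neq0 t; have [c d] := unit_neq0.
by apply: SO_mul; apply: SO_refl2.
Qed.

Lemma turn0 : turn 0 = 1%:M.
Proof.
have [c d] := unit_neq0.
by rewrite /turn subr0 !scale1r !scale0r addr0 !refl_refl// mulmx1.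
Qed.

Lemma turn1_conj (q : H) : turn 1 *m stab (LRmx (qconj q) (qreal 1)) *m (turn 1)^T =
  stab (LRmx (qreal 1) q).
Proof.
have e0 : qreal (1 : R) != 0 by rewrite -sqnorm_eq0 sqnorm_qreal expr1n oner_eq0.
have -> : turn 1 = block_mx conjmx 0 0 (refl (qreal 1)).
  rewrite /turn subrr !scale1r !scale0r add0r !refl_row_mx0 refl_row_0mx.
  rewrite mulmxA -2!stabM /stab mulmx_block -/conjmx.
  by rewrite !(mulmx0, mul0mx, mulmx1, mul1mx, addr0, add0r).
rewrite -conj_left_mul tr_block_mx !trmx0 refl_sym /stab.
by rewrite !mulmx_block !(mulmx0, mul0mx, mulmx1, mul1mx, addr0, add0r) refl_refl.
Qed.

Lemma turn_continuous : continuous turn.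
Proof.
have line (u v w z : H) :
    continuous (fun t : R => row_mx ((1 - t) *: u + t *: v) ((1 - t) *: w + t *: z)).
  have cadd (a b : 'rV[R]_(4 + 4)) : continuous (fun t : R => (1 - t) *: a + t *: b).
    move=> t; apply: (@continuousD _ _ _ (fun t : R => (1 - t) *: a) (fun t => t *: b)).
      apply: (@continuousZ _ _ _ (fun t : R => 1 - t) (cst a)); last exact: cst_continuous.
      by move: t; apply: subr_continuous; [exact: cst_continuous|exact: id_continuous].
    apply: (@continuousZ _ _ _ (fun t : R => t) (cst b)); last exact: cst_continuous.
    exact: id_continuous.
  apply: continuous_ext (cadd (row_mx u w) (row_mx v z)) => t.
  by rewrite !scale_row_mx add_row_mx.
have row1 : continuous (fun t : R => row_mx ((1 - t) *: qI R + t *: qJ R) (0 : H)).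
  by apply: continuous_ext (line (qI R) (qJ R) 0 0) => t; rewrite !scaler0 addr0.
have row2 : continuous (fun t : R => row_mx ((1 - t) *: qK R) (t *: qreal (1 : R))).
  by apply: continuous_ext (line (qK R) 0 0 (qreal 1)) => t; rewrite !scaler0 addr0 add0r.
have crefl1 := refl_continuous row1 (fun t => proj1 (turn_neq0 t)).
have crefl2 := refl_continuous row2 (fun t => proj2 (turn_neq0 t)).
have ccst (a : 'M[R]_(4 + 4)) : continuous (fun _ : R => a) by exact: cst_continuous.
exact: (mulmx_continuous (mulmx_continuous (ccst _) crefl1)
  (mulmx_continuous (ccst _) crefl2)).
Qed.

(** The homotopy conjugates left multiplication by conj Q by the path turn,
    which ends with right multiplication by Q, and multiplies the result by
    left multiplication by P. *)
Lemma right_to_left (X : topologicalType) (tau : X -> SO R (4 + 4)) (P Q : X -> H) :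
  continuous P -> continuous Q ->
  (forall x, sqnorm (P x) = 1) -> (forall x, sqnorm (Q x) = 1) ->
  (forall x, val (tau x) = stab (LRmx (P x) (Q x))) ->
  exists sigma : X -> SO R (4 + 4), homotopic R tau sigma /\
    forall x, val (sigma x) = stab (LRmx (qmul (P x) (qconj (Q x))) (qreal 1)).
Proof.
move=> cP cQ P1 Q1 tauE.
have SOL (u : H) : sqnorm u = 1 -> SO R (4 + 4) (stab (LRmx u (qreal 1))).
  by move=> u1; apply/SO_stab/SO_left_mul.
have sP x : stab (LRmx (qmul (P x) (qconj (Q x))) (qreal 1)) \in SO R (4 + 4).
  by apply/mem_set/SOL; rewrite sqnorm_qmul sqnorm_qconj P1 Q1 mulr1.
exists (fun x => SigSub (sP x)); split => //; apply: homotopic_sym.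
pose F (xt : X * R) := stab (LRmx (P xt.1) (qreal 1)) *m
  (turn xt.2 *m stab (LRmx (qconj (Q xt.1)) (qreal 1)) *m (turn xt.2)^T).
apply: (SO_homotopy (F := F)) => [|x t _|x|x].
- have cf : continuous (@fst X R) by exact: fst_continuous.
  have ct : continuous (fun xt : X * R => turn xt.2).
    by apply: comp_continuous; [exact: snd_continuous|exact: turn_continuous].
  have cL (f : X -> H) : continuous f ->
      continuous (fun xt : X * R => stab (LRmx (f xt.1) (qreal 1))).
    move=> cf'; apply/stab_continuous/LRmx_continuous.
      exact: (comp_continuous cf cf').
    exact: cst_continuous.
  have cLQ := cL _ (qconj_continuous cQ).
  exact: (mulmx_continuous (cL P cP)
    (mulmx_continuous (mulmx_continuous ct cLQ) (trmx_continuous ct))).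
- apply: SO_mul; first exact: SOL.
  apply: SO_mul.
    by apply: SO_mul; [exact: SO_turn|apply: SOL; rewrite sqnorm_qconj].
  have [TT dT] := SO_turn t.
  by split; [rewrite trmxK; exact: mulmx1C|rewrite det_tr].
- by rewrite /F /= turn0 trmx1 mul1mx mulmx1 -stabM LRmxM qmul1.
- by rewrite /F /= turn1_conj -stabM LRmxM qmul1 qmul1 tauE.
Qed.

(** Surjectivity of pi_3(Sp(1)) -> pi_3(SO(8)), for free homotopy classes. *)
Lemma SO8_left_mul (tau : usphere R 4 -> SO R (4 + 4)) : continuous tau ->
  exists (sigma : usphere R 4 -> SO R (4 + 4)) (u : usphere R 4 -> H),
  [/\ homotopic R tau sigma, continuous u, forall x, sqnorm (u x) = 1 &
    forall x, val (sigma x) = stab (LRmx (u x) (qreal 1))].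
Proof.
move=> ct; have [tau' [ct' ht' ft']] := deform_to_SO4 ct.
pose A x := ulsubmx (val (tau' x) : 'M[R]_(4 + 4)).
have AE x : val (tau' x) = stab (A x).
  by apply: fixes_from_stab => //; exact: set_valP (tau' x).
have ASO x : SO R 4 (A x) by apply/SO_stab; rewrite -AE; exact: set_valP (tau' x).
have cA : continuous A.
  apply: mx_continuous => i j.
  apply: (@eq_continuous _ _ (fun x => val (tau' x) (lshift 4 i) (lshift 4 j))) => [x|].
    by rewrite /A mxE mxE.
  by apply: entry_continuous; apply: (comp_continuous ct'); exact: set_val_continuous.
have [P [Q [cP cQ P1 Q1 PQ]]] := lift_SO4 cA ASO.
have [|sigma [hs sE]] := right_to_left (tau := tau') cP cQ P1 Q1 _.
  by move=> x; rewrite AE PQ.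
exists sigma, (fun x => qmul (P x) (qconj (Q x))); split => //.
- exact: homotopic_trans hs.
- by apply: qmul_continuous => //; exact: qconj_continuous.
- by move=> x; rewrite sqnorm_qmul sqnorm_qconj P1 Q1 mulr1.
Qed.

End right_to_left.

(** * Left multiplications on the quaternionic projective plane *)

Lemma hausdorff_set_type (R : realType) (V : normedModType R) (A : set V) :
  hausdorff_space A.
Proof.
move=> p q pq; apply/val_inj; apply: norm_hausdorff => U W Up Wq.
have cval : continuous (val : A -> V) by exact: set_val_continuous.
have [a [Ua Wa]] := pq _ _ (cval p U Up) (cval q W Wq).
by exists (val a).
Qed.

Lemma compact_locally_compact (X : topologicalType) :
  compact [set: X] -> locally_compact [set: X].
Proof.
move=> cX x _; exists setT; first by rewrite withinET; exact: filterT.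
by split => //; exact: closedT.
Qed.

Section first_coordinate.
Variable R : realType.
Local Notation H := 'rV[R]_4.

Section vectors.
Variable m : nat.
Implicit Types (u : H) (x : 'rV[R]_(m * 4)).

Definition mul_first u x : 'rV[R]_(m * 4) :=
  mxvec (\matrix_i (if i == 0 :> nat then qmul u (row i (vec_mx x))
                    else row i (vec_mx x))).

Lemma row_mul_first u x i : row i (vec_mx (mul_first u x)) =
  if i == 0 :> nat then qmul u (row i (vec_mx x)) else row i (vec_mx x).
Proof. by rewrite mxvecK rowK. Qed.

Lemma mul_first_qscale u x q : mul_first u (qscale x q) = qscale (mul_first u x) q.
Proof.
apply: rows_inj => i; rewrite row_mul_first !row_qscale row_mul_first.
by case: eqP => // _; rewrite qmulA.
Qed.

Lemma mul_firstM u v x : mul_first u (mul_first v x) = mul_first (qmul u v) x.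
Proof.
apply: rows_inj => i; rewrite !row_mul_first.
by case: eqP => // _; rewrite qmulA.
Qed.

Lemma mul_first1 x : mul_first (qreal 1) x = x.
Proof. by apply: rows_inj => i; rewrite row_mul_first qmul1l if_same. Qed.

Lemma sqnorm_mul_first u x : sqnorm u = 1 -> sqnorm (mul_first u x) = sqnorm x.
Proof.
move=> u1; rewrite !sqnorm_rows; apply: eq_bigr => i _; rewrite row_mul_first.
by case: ifP => _ //; rewrite sqnorm_qmul u1 mul1r.
Qed.

Lemma mul_first_continuous (X : topologicalType) (f : X -> H)
    (g : X -> 'rV[R]_(m * 4)) :
  continuous f -> continuous g -> continuous (fun z => mul_first (f z) (g z)).
Proof.
move=> cf cg; apply: mx_continuous => i k; rewrite (ord1 i).
case/mxvec_indexP: k => a b.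
have crow : continuous (fun z => row a (vec_mx (g z))).
  apply: mx_continuous => c d.
  apply: (@eq_continuous _ _ (fun z => g z 0 (mxvec_index a d))) => [z|].
    by rewrite !mxE.
  exact: entry_continuous.
have [a0|a0] := boolP (a == 0 :> nat).
  apply: (@eq_continuous _ _ (fun z => qmul (f z) (row a (vec_mx (g z))) 0 b)).
    by move=> z; rewrite /mul_first mxvecE [RHS]mxE a0.
  by apply: entry_continuous; exact: qmul_continuous.
apply: (@eq_continuous _ _ (fun z => row a (vec_mx (g z)) 0 b)).
  by move=> z; rewrite /mul_first mxvecE [RHS]mxE (negbTE a0).
exact: entry_continuous.
Qed.

End vectors.

Lemma mul_stab_first (u : H) (x : 'rV[R]_(2 * 4)) :
  (x : 'rV[R]_(4 + 4)) *m (stab (LRmx u (qreal 1)))^T = mul_first u x.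
Proof.
have idx0 (b : 'I_4) : mxvec_index (0 : 'I_2) b = lshift 4 b.
  by apply/ord_inj; rewrite val_mxvec_index.
have idx1 (b : 'I_4) : mxvec_index (1 : 'I_2) b = rshift 4 b.
  by apply/ord_inj; rewrite val_mxvec_index.
have rowl : row (0 : 'I_2) (vec_mx x) = lsubmx (x : 'rV[R]_(4 + 4)).
  by apply/rowP => b; rewrite !mxE idx0.
have rowr : row (1 : 'I_2) (vec_mx x) = rsubmx (x : 'rV[R]_(4 + 4)).
  by apply/rowP => b; rewrite !mxE idx1.
rewrite -{1}(hsubmxK (x : 'rV[R]_(4 + 4))) tr_stab /stab mul_row_block.
rewrite !mulmx0 addr0 add0r mulmx1 mul_LRmx qmul1 -rowl -rowr.
apply/rowP => k; case: (@mxvec_indexP 2 4 k) => a b; rewrite [RHS]mxvecE mxE.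
have [a0|a1] : a = 0 \/ a = 1.
    by case: a => [[|[|//]]] lta; [left|right]; apply/val_inj.
  by rewrite a0 idx0 row_mxEl.
by rewrite a1 idx1 row_mxEr.
Qed.

Section projective.
Variable n : nat.
Hypothesis n0 : (0 < n)%N.
Local Notation S := (usphere R ((n + 1) * 4)).
Local Notation S3 := (usphere R 4).

Lemma mul_first_usphere (u : S3) (x : S) : mul_first (val u) (val x) \in S.
Proof.
apply/mem_set; rewrite /usphere /= sqnorm_mul_first; first exact: set_valP x.
exact: set_valP u.
Qed.

Definition sphere_mul (xu : S * S3) : S := SigSub (mul_first_usphere xu.2 xu.1).

Lemma sphere_mul_continuous : continuous sphere_mul.
Proof.
apply: to_set_continuous; apply: mul_first_continuous.
  by apply: comp_continuous; [exact: snd_continuous|exact: set_val_continuous].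
by apply: comp_continuous; [exact: fst_continuous|exact: set_val_continuous].
Qed.

Definition HP_mul (pu : HP R n * S3) : HP R n :=
  HP_pi (sphere_mul (repr pu.1, pu.2)).

Lemma HP_mul_pi x u : HP_mul (HP_pi x, u) = HP_pi (sphere_mul (x, u)).
Proof.
apply/HP_piP; have /HP_piP[q q1 E] : HP_pi (repr (HP_pi x : HP R n)) = HP_pi x.
  exact: reprK.
by exists q => //=; rewrite E mul_first_qscale.
Qed.

(** Continuity in both variables jointly is not automatic on a quotient; it
    holds because S^3 is compact. *)
Lemma HP_mul_continuous : continuous HP_mul.
Proof.
apply: (@quotient_prod_continuous _ _ _ _ (@HP_pi R n)).
- by [].
- exact: HP_pi_surj.
- exact: hausdorff_set_type.
- by apply: compact_locally_compact; exact: compact_usphere.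
rewrite (_ : (fun xt => _) = (fun xt => HP_pi (sphere_mul xt))).
  by apply: (comp_continuous sphere_mul_continuous); exact: HP_pi_continuous.
by apply/funext => -[x u]; rewrite HP_mul_pi.
Qed.

Lemma HP_mul_skel (p : @HP_skel R n) (u : S3) : HP_mul (val p, u) \in (@HP_skel R n).
Proof.
apply/mem_set; have := set_valP p; have [x <-] := HP_pi_surj (val p).
rewrite HP_mul_pi => /HP_skelP x0; apply/HP_skelP.
have lastE (y : 'rV[R]_((n + 1) * 4)) :
    dsubmx (vec_mx y) = row (rshift n (0 : 'I_1)) (vec_mx y).
  by rewrite -row_dsubmx row_id.
by rewrite lastE /= row_mul_first /= addn0 (gtn_eqF n0) -lastE.
Qed.

Definition skel_mul (pu : @HP_skel R n * S3) : @HP_skel R n :=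
  SigSub (HP_mul_skel pu.1 pu.2).

Lemma skel_mul_continuous : continuous skel_mul.
Proof.
by apply: (restrict_continuous HP_mul_continuous).
Qed.

Lemma skel_mulK (p : @HP_skel R n) (u v : S3) : qmul (val v) (val u) = qreal 1 ->
  skel_mul (skel_mul (p, u), v) = p.
Proof.
move=> vu; apply/val_inj; rewrite -[LHS]/(HP_mul (HP_mul (val p, u), v)).
have [x <-] := HP_pi_surj (val p); rewrite !HP_mul_pi; congr HP_pi.
by apply/val_inj; rewrite /= mul_firstM -[RHS]mul_first1; congr mul_first.
Qed.

Lemma HP_lift_mul_first (u : H) (a : 'rV[R]_(n * 4)) : sqnorm u = 1 ->
  HP_lift (mul_first u a) = mul_first u (HP_lift a).
Proof.
move=> u1.
have rowl (b : 'rV[R]_(n * 4)) k :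
    row (lshift 1 k) (vec_mx (HP_lift b)) = row k (vec_mx b).
  by rewrite /HP_lift mxvecK rowKu.
have rowr (b : 'rV[R]_(n * 4)) k :
    row (rshift n k) (vec_mx (HP_lift b)) = row k (qreal (Num.sqrt (1 - sqnorm b))).
  by rewrite /HP_lift mxvecK rowKd.
apply: rows_inj => i; rewrite row_mul_first; case: (split_ordP i) => k ->.
  by rewrite !rowl row_mul_first.
by rewrite !rowr sqnorm_mul_first//= (ord1 k) addn0 (gtn_eqF n0).
Qed.

End projective.

(** Equivariance of the attaching map S^7 -> HP^1. *)
Lemma attach_mul_first (u : usphere R 4) (a b : usphere R (2 * 4)) :
  val b = mul_first (m := 2) (val u) (val a) ->
  attach (HP_top_cell R 2) b = skel_mul (n := 2) isT (attach (HP_top_cell R 2) a, u).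
Proof.
move=> bE; apply/val_inj.
rewrite -[LHS]/(HP_char (subfun (@usphere_udisc R (2 * 4)) b)).
rewrite -[RHS]/(HP_mul (HP_char (subfun (@usphere_udisc R (2 * 4)) a), u)).
rewrite /HP_char HP_mul_pi; congr HP_pi; apply/val_inj.
rewrite -[LHS]/(HP_lift (n := 2) (val b)) -[RHS]/(mul_first (val u) (HP_lift (n := 2) (val a))).
by rewrite bE HP_lift_mul_first//; exact: set_valP u.
Qed.

Definition trivial_clutching (p : usphere R (2 * 4) * usphere R 4) :=
  (attach (HP_top_cell R 2) p.1, p.2).

Lemma attach_continuous : continuous (attach (HP_top_cell R 2)).
Proof.
apply: (@to_set_continuous (HP R 2) _ (@HP_skel R 2)).
apply: (comp_continuous (f := subfun (@usphere_udisc R (2 * 4))) _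
  (@HP_char_continuous R 2)).
by apply: to_set_continuous; exact: set_val_continuous.
Qed.

Lemma trivial_clutching_continuous : continuous trivial_clutching.
Proof.
apply: pair_continuous; last exact: snd_continuous.
exact: (comp_continuous (@fst_continuous _ _) attach_continuous).
Qed.

Lemma SO_act_continuous (X : topologicalType) n (T : X -> SO R n)
    (a : X -> usphere R n) :
  continuous T -> continuous a -> continuous (fun z => SO_act (T z) (a z)).
Proof.
move=> cT ca; apply: to_set_continuous; apply: mulmx_continuous.
  by apply: (comp_continuous ca); exact: set_val_continuous.
by apply/trmx_continuous/(comp_continuous cT); exact: set_val_continuous.
Qed.

(** The twisting is deformed to left multiplications by u x, which are then
    moved across the attaching map to the homeomorphism psi of HP^1 x S^3. *)
Lemma gyration_trivial (tau : twisting R (2 * 4) 4) :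
  homotopy_equivalent R
    (pushout (@rim R 3 (usphere R (2 * 4))) trivial_clutching)
    (gyration (HP_top_cell R 2) tau).
Proof.
have [sigma [u [hs cu u1 sE]]] := SO8_left_mul (twist_continuous (t := tau)).
pose act (t : usphere R 4 -> SO R (2 * 4)) (p : usphere R (2 * 4) * usphere R 4) :=
  (SO_act (t p.2) p.1, p.2).
have uP x : u x \in usphere R 4 by apply/mem_set; exact: u1.
pose U x : usphere R 4 := SigSub (uP x).
have uP' x : qconj (u x) \in usphere R 4.
  by apply/mem_set; rewrite /usphere /= sqnorm_qconj u1.
pose U' x : usphere R 4 := SigSub (uP' x).
have cU : continuous U by exact: to_set_continuous.
have cU' : continuous U'.
  by apply: to_set_continuous; exact: qconj_continuous.
pose sk := @HP_skel R 2.
pose psi (p : sk * usphere R 4) := (skel_mul (n := 2) isT (p.1, U p.2), p.2).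
pose psi' (p : sk * usphere R 4) := (skel_mul (n := 2) isT (p.1, U' p.2), p.2).
have psiK : cancel psi psi'.
  by move=> [p x]; rewrite /psi /psi' /= skel_mulK// qmulVr ?u1.
have psiK' : cancel psi' psi.
  by move=> [p x]; rewrite /psi /psi' /= skel_mulK// qmulV ?u1.
have cskel := @skel_mul_continuous 2 isT.
have cpsi : continuous psi by exact: (shear_continuous cskel cU).
have cpsi' : continuous psi' by exact: (shear_continuous cskel cU').
apply: homotopy_equivalent_trans (pushout_homeomorphic R
  (@rim R 3 (usphere R (2 * 4))) trivial_clutching cpsi cpsi' psiK psiK') _.
rewrite (_ : psi \o trivial_clutching = trivial_clutching \o act sigma); last first.
  apply/funext => -[a x]; rewrite /psi /trivial_clutching /=; congr (_, _).
  by apply/esym/attach_mul_first; rewrite /= sE mul_stab_first.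
apply: homotopic_pushout.
have /homotopicP[K [cK K0 K1]] := homotopic_sym hs.
apply/homotopicP.
exists (fun pt => trivial_clutching (SO_act (K (pt.1.2, pt.2)) pt.1.1, pt.1.2)).
split=> [|[a x] t t0|[a x] t t1]; last 2 first.
- by rewrite /= K0.
- by rewrite /= K1.
have c1 : continuous (@fst (usphere R (2 * 4) * usphere R 4) R) by exact: fst_continuous.
have c2 : continuous (@snd (usphere R (2 * 4) * usphere R 4) R) by exact: snd_continuous.
have c12 := comp_continuous c1 (@snd_continuous _ _).
have c11 := comp_continuous c1 (@fst_continuous _ _).
apply: (comp_continuous _ trivial_clutching_continuous).
apply: (pair_continuous _ c12); apply: SO_act_continuous => //.
exact: (comp_continuous (pair_continuous c12 c2) cK).
Qed.

End first_coordinate.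

Theorem theorem6p12 (R : realType) :
  gyration_stable 4 (HP_top_cell R 2 : top_cell R 8 (HP R 2)).
Proof.
move=> tau omega; apply: homotopy_equivalent_trans (gyration_trivial omega).
exact: (homotopy_equivalent_sym (gyration_trivial tau)).
Qed.
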